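(* For every integer $k\ge 0$ and all $s\in\mathbb{C}$, $$\xi_k(s)=(-1)^k\,\xi_k(1-s).$$
   Context: Let $\zeta$ be the Riemann zeta function, $\chi(s)=2^s\pi^{s-1}\sin(\pi s/2)\Gamma(1-s)$ (so $\zeta(s)=\chi(s)\zeta(1-s)$), and $$\omega(s)=\frac{\chi'}{\chi}(s)=\log 2\pi-\frac{\Gamma'}{\Gamma}(s)+\frac{\pi}{2}\tan\frac{\pi s}{2}.$$ The meromorphic functions $Z_k$ are defined recursively by $Z_0(s)=\zeta(s)$ and $Z_{k+1}(s)=Z_k'(s)-\frac12\omega(s)Z_k(s)$ for $k\ge 0$. For $k\ge 0$ define $$\xi_k(s)=\pi^{-\frac{s}{2}}\,s(s-1)\,\frac{Z_k(s)}{\Gamma\left(\frac{s}{2}\right)^{k-1}\Gamma\left(\frac{1-s}{2}\right)^k},$$ which is an entire function (after filling in removable singularities). *)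

(* Defs.v *)
From Stdlib Require Import Reals ZArith.
From Coquelicot Require Import Coquelicot.

Open Scope C_scope.

(** Limit of [f] along a filter, for complex-valued [f]; like [RInt], it is
    only meaningful when the limit exists. *)
Definition Clim {T : Type} (F : (T -> Prop) -> Prop) (f : T -> C) : C :=
  iota (T := CompleteNormedModule.CompleteSpace _ C_R_CompleteNormedModule)
    (fun l : C => filterlim f F (locally l)).

Definition Cexp (z : C) : C :=
  RtoC (exp (Re z)) * (cos (Im z), sin (Im z)).

Definition Csin (z : C) : C := (Cexp (Ci * z) - Cexp (- (Ci * z))) / (2 * Ci).

(** [Rcpow x s] is x^s with its principal value, for a real base x > 0. *)
Definition Rcpow (x : R) (s : C) : C := Cexp (s * RtoC (ln x)).

(** Integer powers, as [powerRZ] on the reals. *)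
Definition CpowerZ (z : C) (n : Z) : C :=
  match n with
  | Z0 => 1
  | Zpos p => z ^ Pos.to_nat p
  | Zneg p => / z ^ Pos.to_nat p
  end.

(** s (s+1) ... (s+n) *)
Fixpoint rising (s : C) (n : nat) : C :=
  match n with
  | O => s
  | S m => rising s m * (s + RtoC (INR n))
  end.

(** Euler's limit for the Gamma function, valid at every s outside the poles
    0, -1, -2, ... *)
Definition Gamma (s : C) : C :=
  Clim eventually
    (fun n : nat => Rcpow (INR n) s * RtoC (INR (fact n)) / rising s n).

Definition analytic_at (f : C -> C) (s : C) : Prop :=
  exists (a : nat -> C) (r : R), (0 < r)%R /\
    forall z : C, (Cmod (z - s) < r)%R ->
      is_pseries (K := C_AbsRing) (V := C_NormedModule) a (z - s) (f z).

(** [zeta] is the analytic continuation of sum_{n >= 1} n^{-s} from Re s > 1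
    to the complex plane minus 1.  Its value at 1 is left unspecified. *)
Definition is_riemann_zeta (zeta : C -> C) : Prop :=
  (forall s : C, (1 < Re s)%R ->
     is_series (K := C_AbsRing) (V := C_NormedModule)
       (fun n : nat => Rcpow (INR (S n)) (- s)) (zeta s)) /\
  (forall s : C, s <> 1 -> analytic_at zeta s).

Definition chi (s : C) : C :=
  Rcpow 2 s * Rcpow PI (s - 1) * Csin (RtoC PI * s / 2) * Gamma (1 - s).

Definition omega (s : C) : C := C_derive chi s / chi s.

(** At the integers, where omega or Z_k may have poles or removable
    singularities, the values of the total functions [omega], [Zk] and
    [xi_formula] carry no meaning. *)
Fixpoint Zk (zeta : C -> C) (k : nat) : C -> C :=
  match k with
  | O => zeta
  | S j => fun s => C_derive (Zk zeta j) s - / 2 * omega s * Zk zeta j s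
  end.

Definition xi_formula (zeta : C -> C) (k : nat) (s : C) : C :=
  Rcpow PI (- (s / 2)) * (s * (s - 1)) *
  (Zk zeta k s /
    (CpowerZ (Gamma (s / 2)) (Z.of_nat k - 1) *
     CpowerZ (Gamma ((1 - s) / 2)) (Z.of_nat k))).

(** The removable singularities of [xi_formula] are filled in by taking the
    limit over a punctured neighbourhood, which leaves the regular values
    unchanged. *)
Definition xi (zeta : C -> C) (k : nat) (s : C) : C :=
  Clim (locally' s) (xi_formula zeta k).

(* Main.v *)
Require Import Defs.
From Stdlib Require Import Reals ZArith.
From Coquelicot Require Import Coquelicot.
From Stdlib Require Import Lra Lia Psatz ssreflect IndefiniteDescription FunctionalExtensionality.
Open Scope C_scope.

(** With [chi s = pi^(s - 1/2) Gamma ((1 - s) / 2) / Gamma (s / 2)] the theorem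
    reduces to [Z_k s = (-1)^k chi s * Z_k (1 - s)], which follows by induction
    on [k]: differentiate, and use [omega (1 - s) = omega s], the logarithmic
    derivative of [chi s * chi (1 - s) = 1].  The case [k = 0] is the functional
    equation of zeta.  By the identity theorem it suffices to prove it for
    [0 < s < 1], where both expansions of [q x = 1 / (e^x - 1) - 1 / x],
    [sum e^(-n x) - 1 / x] and [-1/2 + sum 2 x / (x^2 + (2 pi n)^2)], are
    truncated at [N] and integrated against [x^(s - 1)]: the first gives
    [Gamma s] times [sum_(n <= N) n^(-s) - N^(1 - s) / (1 - s)], the second a
    Beta integral times the same expression at [1 - s], and the two integrals
    differ by a quantity that tends to [0].

    [1 / Gamma] is the locally uniform limit of Euler's entire functions; its
    reflection formula is checked on the imaginary axis, where it is the product
    for [sinh], itself obtained from the partial fractions of [coth] by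
    iterating [coth (2 a) = (coth a + tanh a) / 2]. *)

(** * Convergence of complex sequences and series *)

(** For [0 < s < 1] neither Dirichlet series converges, so the expansions of [q] cannot be
    integrated term by term. Each truncated sum is therefore corrected by the integral of its
    summand over the index range [[0, N]]: [(1 - e^(-N x)) / x] for the exponentials, an arctangent
    for the partial fractions. The Mellin transforms of these corrections are multiples of the
    subtracted powers [N^(1 - s) / (1 - s)] and [N^s / s], and every limit is taken outside the
    integral sign. Only real integrals occur. Complex analysis rests on power series alone: averages
    over roots of unity stand in for contour integrals, and continuation runs along straight
    segments that bypass 0 and 1. Integer points, where [omega] and [Z_k] may be singular, are left
    out of the identities for [chi], [omega] and [Z_k]; they come back only at the end, because [xi]
    is a limit over punctured neighbourhoods. *)

Definition Ctends (u : nat -> C) (l : C) : Prop :=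
  is_lim_seq (fun n => Cmod (u n - l)) 0%R.

Lemma Csub_diag (x : C) : x - x = 0.
Proof. ring. Qed.

Lemma Csub_0_r (x : C) : x - 0 = x.
Proof. ring. Qed.

Lemma Ceq_minus (x y : C) : x - y = 0 -> x = y.
Proof. move=> h. replace x with (x - y + y) by ring. rewrite h. ring. Qed.

Lemma Csub_neq_0 (x y : C) : x <> y -> x - y <> 0.
Proof. by move=> h /Ceq_minus. Qed.

Lemma Cmod_sub_sym (x y : C) : Cmod (x - y) = Cmod (y - x).
Proof. by rewrite -Cmod_opp; f_equal; ring. Qed.

Lemma Cmod_minus_le (x y : C) : (Cmod (x - y) <= Cmod x + Cmod y)%R.
Proof. rewrite -(Cmod_opp y). exact: Cmod_triangle. Qed.

Lemma Cmod_dist_triangle (x y z : C) :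
  (Cmod (x - z) <= Cmod (x - y) + Cmod (y - z))%R.
Proof. replace (x - z) with ((x - y) + (y - z)) by ring. exact: Cmod_triangle. Qed.

Lemma Cmod_diff_ge (x y : C) : (Cmod x - Cmod y <= Cmod (x - y))%R.
Proof.
have := Cmod_triangle (x - y) y. replace (x - y + y) with x by ring. lra.
Qed.

Lemma Ctends_eps (u : nat -> C) (l : C) :
  Ctends u l <->
  forall eps : R, (0 < eps)%R ->
    exists N, forall n, (N <= n)%nat -> (Cmod (u n - l) < eps)%R.
Proof.
split.
- move=> H eps He.
  have /is_lim_seq_Reals /(_ eps He) [N HN] := H.
  exists N => n Hn. have := HN n Hn.
  rewrite /Rdist Rminus_0_r Rabs_pos_eq //. exact: Cmod_ge_0.
- move=> H. apply/is_lim_seq_Reals => eps He.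
  have [N HN] := H eps He. exists N => n Hn.
  rewrite /Rdist Rminus_0_r Rabs_pos_eq; last exact: Cmod_ge_0.
  exact: HN.
Qed.

(** The balls of [C] as a product space are squares; [sqrt 2] is the price of passing from a square
    to a disc. *)
Lemma locally_Cmod (x : C) (P : C -> Prop) :
  locally x P <-> exists d : posreal, forall y, (Cmod (y - x) < d)%R -> P y.
Proof.
split.
- move=> [d Hd]. exists d => y Hy. apply: Hd.
  exact: (C_NormedModule_mixin_compat1 x y d Hy).
- move=> [d Hd].
  have h2 : (0 < sqrt 2)%R by apply: sqrt_lt_R0; lra.
  have hd : (0 < d / sqrt 2)%R by apply: Rdiv_lt_0_compat; [exact: cond_pos|].
  exists (mkposreal _ hd) => y Hy. apply: Hd.
  have := C_NormedModule_mixin_compat2 x y (mkposreal _ hd) Hy.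
  rewrite /= /minus /plus /opp /=. move=> H.
  apply: Rlt_le_trans; first exact: H.
  right. field. lra.
Qed.

Lemma filterlim_C {T : Type} (F : (T -> Prop) -> Prop) (FF : Filter F)
  (f : T -> C) (l : C) :
  filterlim f F (locally l) <->
  forall eps : R, (0 < eps)%R -> F (fun x => (Cmod (f x - l) < eps)%R).
Proof.
split.
- move=> H eps He. apply: (H (fun y => (Cmod (y - l) < eps)%R)).
  apply/locally_Cmod. by exists (mkposreal eps He).
- move=> H P /locally_Cmod [d Hd].
  exact: (filter_imp _ _ (fun x Hx => Hd (f x) Hx) (H d (cond_pos d))).
Qed.

(** The link with [Clim]. Limit algebra is done on the real sequence of moduli, where the squeeze
    and shift lemmas apply directly. *)
Lemma Ctends_filterlim (u : nat -> C) (l : C) :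
  Ctends u l <-> filterlim u eventually (locally l).
Proof.
rewrite Ctends_eps filterlim_C. split=> H eps He; exact: H.
Qed.

Lemma Ctends_ext (u v : nat -> C) (l : C) :
  (forall n, u n = v n) -> Ctends u l -> Ctends v l.
Proof. move=> H. apply: is_lim_seq_ext => n. by rewrite H. Qed.

Lemma Ctends_ext_loc (u v : nat -> C) (l : C) (N : nat) :
  (forall n, (N <= n)%nat -> u n = v n) -> Ctends u l -> Ctends v l.
Proof.
move=> H. apply: is_lim_seq_ext_loc. exists N => n Hn. by rewrite H.
Qed.

Lemma Ctends_le (u : nat -> C) (v : nat -> R) (l : C) :
  (forall n, (Cmod (u n - l) <= v n)%R) -> is_lim_seq v 0%R -> Ctends u l.
Proof.
move=> H Hv. apply: (is_lim_seq_le_le (fun _ => 0%R) _ v).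
- move=> n. split; [exact: Cmod_ge_0 | exact: H].
- exact: is_lim_seq_const.
- exact: Hv.
Qed.

Lemma Ctends_unique (u : nat -> C) (l m : C) : Ctends u l -> Ctends u m -> l = m.
Proof.
move=> Hl Hm.
have H : is_lim_seq (fun n => Cmod (u n - l) + Cmod (u n - m))%R (0 + 0)%R.
  exact: is_lim_seq_plus'.
have H2 := is_lim_seq_le (fun _ => Cmod (l - m)) _ (Cmod (l - m)) (0 + 0)%R _
  (is_lim_seq_const _) H.
have h : (Cmod (l - m) <= 0 + 0)%R.
  apply: H2 => n. rewrite -(Cmod_sub_sym l). exact: Cmod_dist_triangle.
have h0 : Cmod (l - m) = 0%R by have := Cmod_ge_0 (l - m); lra.
exact: Ceq_minus (Cmod_eq_0 _ h0).
Qed.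

Lemma Ctends_const (c : C) : Ctends (fun _ => c) c.
Proof.
apply: (is_lim_seq_ext (fun _ => 0%R)); last exact: is_lim_seq_const.
move=> _. by rewrite Csub_diag Cmod_0.
Qed.

Lemma Ctends_plus (u v : nat -> C) (l m : C) :
  Ctends u l -> Ctends v m -> Ctends (fun n => u n + v n) (l + m).
Proof.
move=> Hu Hv.
apply: (Ctends_le _ (fun n => Cmod (u n - l) + Cmod (v n - m))%R).
- move=> n. replace (u n + v n - (l + m)) with ((u n - l) + (v n - m)) by ring.
  exact: Cmod_triangle.
- replace 0%R with (0 + 0)%R by ring. exact: is_lim_seq_plus'.
Qed.

Lemma Ctends_mult (u v : nat -> C) (l m : C) :
  Ctends u l -> Ctends v m -> Ctends (fun n => u n * v n) (l * m).
Proof.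
move=> Hu Hv.
apply: (Ctends_le _ (fun n => Cmod (u n - l) * Cmod (v n - m)
   + (Cmod (u n - l) * Cmod m + Cmod l * Cmod (v n - m)))%R).
- move=> n.
  replace (u n * v n - l * m) with
    ((u n - l) * (v n - m) + ((u n - l) * m + l * (v n - m))) by ring.
  rewrite -!Cmod_mult. apply: Rle_trans; first exact: Cmod_triangle.
  apply: Rplus_le_compat_l. exact: Cmod_triangle.
- replace 0%R with (0 * 0 + (0 * Cmod m + Cmod l * 0))%R by ring.
  apply: is_lim_seq_plus'; first exact: is_lim_seq_mult'.
  apply: is_lim_seq_plus'; apply: is_lim_seq_mult' => //; exact: is_lim_seq_const.
Qed.

Lemma Ctends_scal (c : C) (u : nat -> C) (l : C) :
  Ctends u l -> Ctends (fun n => c * u n) (c * l).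
Proof. move=> H. apply: Ctends_mult H. exact: Ctends_const. Qed.

Lemma Ctends_opp (u : nat -> C) (l : C) : Ctends u l -> Ctends (fun n => - u n) (- l).
Proof.
move=> H. apply: is_lim_seq_ext H => n.
by rewrite -Cmod_opp; f_equal; ring.
Qed.

Lemma Ctends_minus (u v : nat -> C) (l m : C) :
  Ctends u l -> Ctends v m -> Ctends (fun n => u n - v n) (l - m).
Proof. move=> Hu Hv. apply: Ctends_plus => //. exact: Ctends_opp. Qed.

Lemma Ctends_Cmod (u : nat -> C) (l : C) :
  Ctends u l -> is_lim_seq (fun n => Cmod (u n)) (Cmod l).
Proof.
move=> H. apply/is_lim_seq_Reals => eps He.
have [N HN] := proj1 (Ctends_eps u l) H eps He.
exists N => n Hn. rewrite /Rdist.
apply: Rle_lt_trans (HN n Hn).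
apply: Rabs_le. split.
- have := Cmod_diff_ge l (u n). rewrite Cmod_sub_sym. lra.
- exact: Cmod_diff_ge.
Qed.

Lemma Ctends_inv (u : nat -> C) (l : C) :
  l <> 0 -> Ctends u l -> Ctends (fun n => / u n) (/ l).
Proof.
move=> hl H. apply/Ctends_eps => eps He.
have hl0 : (0 < Cmod l)%R by apply/Cmod_gt_0.
have h1 : (0 < Rmin (Cmod l / 2) (eps * (Cmod l * Cmod l) / 2))%R.
  apply: Rmin_glb_lt; first lra.
  apply: Rdiv_lt_0_compat; last lra.
  apply: Rmult_lt_0_compat => //. exact: Rmult_lt_0_compat.
have [N HN] := proj1 (Ctends_eps u l) H _ h1.
exists N => n Hn. have := HN n Hn => h.
have ha : (Cmod (u n - l) < Cmod l / 2)%R by apply: Rlt_le_trans h (Rmin_l _ _).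
have hb := Rlt_le_trans _ _ _ h (Rmin_r _ _).
have hu : (Cmod l / 2 < Cmod (u n))%R.
  have := Cmod_diff_ge l (u n). rewrite Cmod_sub_sym. lra.
have hu0 : u n <> 0 by apply/Cmod_gt_0; lra.
replace (/ u n - / l) with (- (u n - l) / (u n * l)) by (field; by split).
rewrite Cmod_div; last exact: Cmult_neq_0.
rewrite Cmod_opp Cmod_mult.
apply/Rlt_div_l; first (apply: Rmult_lt_0_compat; lra).
apply: Rlt_le_trans; first exact: hb.
have -> : (eps * (Cmod l * Cmod l) / 2 = eps * (Cmod l / 2 * Cmod l))%R by field.
apply: Rmult_le_compat_l; first lra.
apply: Rmult_le_compat_r; lra.
Qed.

Lemma Ctends_bounded (u : nat -> C) (l : C) :
  Ctends u l -> exists M, (0 < M)%R /\ forall n, (Cmod (u n) <= M)%R.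
Proof.
move=> /Ctends_Cmod /is_lim_seq_Reals H.
have [M [HM HM2]] := maj_by_pos _ (exist _ _ H).
exists M; split=> // n. have := HM2 n.
rewrite Rabs_pos_eq //. exact: Cmod_ge_0.
Qed.

Lemma Ctends_incr (u : nat -> C) (l : C) (k : nat) :
  Ctends u l <-> Ctends (fun n => u (n + k)%nat) l.
Proof. exact: (is_lim_seq_incr_n (fun n => Cmod (u n - l)) k). Qed.

Lemma Ctends_le_bound (u : nat -> C) (l c : C) (M : R) :
  (forall n, (Cmod (u n - c) <= M)%R) -> Ctends u l -> (Cmod (l - c) <= M)%R.
Proof.
move=> H Hu.
have := Ctends_Cmod _ _ (Ctends_minus _ _ _ _ Hu (Ctends_const c)) => H1.
exact: (is_lim_seq_le _ (fun _ => M) (Cmod (l - c)) M H H1 (is_lim_seq_const M)).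
Qed.

Lemma Ctends_le_bound_loc (u : nat -> C) (l c : C) (M : R) (N : nat) :
  (forall n, (N <= n)%nat -> (Cmod (u n - c) <= M)%R) -> Ctends u l -> (Cmod (l - c) <= M)%R.
Proof.
move=> H /(proj1 (Ctends_incr u l N)). apply: Ctends_le_bound => n. apply: H. lia.
Qed.

Lemma Ctends_RtoC (u : nat -> R) (l : R) :
  is_lim_seq u l <-> Ctends (fun n => RtoC (u n)) (RtoC l).
Proof.
rewrite Ctends_eps. split.
- move=> /is_lim_seq_Reals H eps He. have [N HN] := H eps He.
  exists N => n Hn. rewrite -RtoC_minus Cmod_R. exact: (HN n Hn).
- move=> H. apply/is_lim_seq_Reals => eps He. have [N HN] := H eps He.
  exists N => n Hn. have := HN n Hn. by rewrite -RtoC_minus Cmod_R.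
Qed.

(** * Finite sums and their link with series *)

Fixpoint Csum (u : nat -> C) (n : nat) : C :=
  match n with O => 0 | S m => Csum u m + u m end.

Fixpoint Rsum (u : nat -> R) (n : nat) : R :=
  match n with O => 0%R | S m => (Rsum u m + u m)%R end.

Lemma Csum_ext (u v : nat -> C) (n : nat) :
  (forall k, (k < n)%nat -> u k = v k) -> Csum u n = Csum v n.
Proof.
elim: n => [//|n IH] H /=. rewrite IH ?H //; try lia. move=> k Hk; apply: H; lia.
Qed.

Lemma Rsum_ext (u v : nat -> R) (n : nat) :
  (forall k, (k < n)%nat -> u k = v k) -> Rsum u n = Rsum v n.
Proof.
elim: n => [//|n IH] H /=. rewrite IH ?H //; try lia. move=> k Hk; apply: H; lia.
Qed.

Lemma Csum_plus (u v : nat -> C) (n : nat) :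
  Csum (fun k => u k + v k) n = Csum u n + Csum v n.
Proof. elim: n => [|n IH] /=; [ring|]. rewrite IH; ring. Qed.

Lemma Csum_scal (c : C) (u : nat -> C) (n : nat) :
  Csum (fun k => c * u k) n = c * Csum u n.
Proof. elim: n => [|n IH] /=; [ring|]. rewrite IH; ring. Qed.

Lemma Csum_minus (u v : nat -> C) (n : nat) :
  Csum (fun k => u k - v k) n = Csum u n - Csum v n.
Proof. elim: n => [|n IH] /=; [ring|]. rewrite IH; ring. Qed.

Lemma Rsum_plus (u v : nat -> R) (n : nat) :
  Rsum (fun k => u k + v k)%R n = (Rsum u n + Rsum v n)%R.
Proof. elim: n => [|n IH] /=; [ring|]. rewrite IH; ring. Qed.

Lemma Rsum_minus (u v : nat -> R) (n : nat) :
  Rsum (fun k => u k - v k)%R n = (Rsum u n - Rsum v n)%R.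
Proof. elim: n => [|n IH] /=; [ring|]. rewrite IH; ring. Qed.

Lemma Rsum_scal (c : R) (u : nat -> R) (n : nat) :
  Rsum (fun k => c * u k)%R n = (c * Rsum u n)%R.
Proof. elim: n => [|n IH] /=; [ring|]. rewrite IH; ring. Qed.

Lemma Rsum_le (u v : nat -> R) (n : nat) :
  (forall k, (k < n)%nat -> (u k <= v k)%R) -> (Rsum u n <= Rsum v n)%R.
Proof.
elim: n => [|n IH] H /=; [lra|].
apply: Rplus_le_compat; [apply: IH => k Hk; apply: H; lia | apply: H; lia].
Qed.

Lemma Csum_RtoC (u : nat -> R) (n : nat) :
  Csum (fun k => RtoC (u k)) n = RtoC (Rsum u n).
Proof. elim: n => [//|n IH] /=. by rewrite IH RtoC_plus. Qed.

Lemma Cmod_Csum (u : nat -> C) (n : nat) :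
  (Cmod (Csum u n) <= Rsum (fun k => Cmod (u k)) n)%R.
Proof.
elim: n => [|n IH] /=; first by rewrite Cmod_0; lra.
apply: Rle_trans; first exact: Cmod_triangle. lra.
Qed.

Lemma Cmod_Csum_le (u : nat -> C) (v : nat -> R) (n : nat) :
  (forall k, (k < n)%nat -> (Cmod (u k) <= v k)%R) -> (Cmod (Csum u n) <= Rsum v n)%R.
Proof.
move=> H. apply: Rle_trans; first exact: Cmod_Csum. exact: Rsum_le.
Qed.

Lemma Csum_S_l (u : nat -> C) (n : nat) :
  Csum u (S n) = u O + Csum (fun k => u (S k)) n.
Proof. elim: n => [|n IH]; [by rewrite /=; ring|]. rewrite [LHS]/= -/(Csum u (S n)) IH /=. ring. Qed.

Lemma Csum_sum_n (u : nat -> C) (n : nat) :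
  sum_n (G := C_AbelianMonoid) u n = Csum u (S n).
Proof.
elim: n => [|n IH]; first by rewrite sum_O /= Cplus_0_l.
by rewrite sum_Sn IH.
Qed.

Lemma Rsum_sum_n (u : nat -> R) (n : nat) : sum_n u n = Rsum u (S n).
Proof.
elim: n => [|n IH]; first by rewrite sum_O /= Rplus_0_l.
by rewrite sum_Sn IH.
Qed.

Lemma is_series_Rsum (u : nat -> R) (l : R) :
  is_series u l <-> is_lim_seq (Rsum u) l.
Proof.
rewrite (is_lim_seq_incr_1 (Rsum u)). rewrite /is_series.
split=> H; eapply filterlim_ext; try exact: H; move=> n /=; by rewrite Rsum_sum_n.
Qed.

Lemma is_series_Csum (u : nat -> C) (l : C) :
  is_series (K := C_AbsRing) (V := C_NormedModule) u l <-> Ctends (Csum u) l.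
Proof.
rewrite (Ctends_incr _ _ 1) Ctends_filterlim /is_series.
split=> H; eapply filterlim_ext; try exact: H; move=> n /=;
  rewrite Nat.add_comm /=; by rewrite Csum_sum_n.
Qed.

Lemma Cpow_pow_n (z : C) (n : nat) : pow_n (K := C_Ring) z n = z ^ n.
Proof. elim: n => [//|n IH] /=. by rewrite IH. Qed.

Lemma is_pseries_Csum (a : nat -> C) (w l : C) :
  is_pseries (K := C_AbsRing) (V := C_NormedModule) a w l <->
  Ctends (Csum (fun k => a k * w ^ k)) l.
Proof.
rewrite -is_series_Csum /is_pseries.
split; apply: is_series_ext => n; rewrite /scal /= /mult /= -Cpow_pow_n;
  exact: Cmult_comm.
Qed.

(** Completeness is available for [C] as a normed module over the reals; the partial sums are the
    same there. *)
Lemma Csum_cv_abs (u : nat -> C) (b : nat -> R) :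
  (forall k, (Cmod (u k) <= b k)%R) -> ex_series b ->
  exists l, Ctends (Csum u) l.
Proof.
move=> H Hb.
have [l Hl] : ex_series (V := C_R_CompleteNormedModule) u.
  apply: (ex_series_le _ b) => // n. rewrite -Cmod_norm. exact: H.
exists l. apply/(Ctends_incr _ _ 1)/Ctends_filterlim.
eapply filterlim_ext; last exact: Hl.
move=> n /=. rewrite Nat.add_comm /=.
exact: (Csum_sum_n u n).
Qed.

Lemma Rsum_le_Series (b : nat -> R) (n : nat) :
  (forall k, (0 <= b k)%R) -> ex_series b -> (Rsum b n <= Series b)%R.
Proof.
move=> H0 Hb. have := Series_correct _ Hb => /is_series_Rsum Hl.
apply: (is_lim_seq_incr_compare (Rsum b)) => // m /=. have := H0 m. lra.
Qed.

Lemma Rsum_nonneg (b : nat -> R) (n : nat) :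
  (forall k, (0 <= b k)%R) -> (0 <= Rsum b n)%R.
Proof. move=> H. elim: n => [|n IH] /=; [lra|]. have := H n; lra. Qed.

(** * Power series on a disc *)

(** The radius stays explicit because uniform limits and entire functions need one disc that serves
    a whole family of expansions. *)
Definition expands (a : nat -> C) (s : C) (r : R) (f : C -> C) : Prop :=
  forall z, (Cmod (z - s) < r)%R ->
    Ctends (Csum (fun k => a k * (z - s) ^ k)) (f z).

Lemma analytic_at_expands (f : C -> C) (s : C) :
  analytic_at f s <-> exists a r, (0 < r)%R /\ expands a s r f.
Proof.
split; move=> [a [r [Hr H]]]; exists a, r; split=> // z Hz;
  apply/is_pseries_Csum; exact: H.
Qed.

Lemma Csum_terms_bounded (u : nat -> C) (l : C) :
  Ctends (Csum u) l -> exists M, (0 < M)%R /\ forall k, (Cmod (u k) <= M)%R.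
Proof.
move=> /Ctends_bounded [M [HM H]]. exists (M + M)%R; split; first lra.
move=> k. replace (u k) with (Csum u (S k) - Csum u k) by (rewrite /=; ring).
apply: Rle_trans; first exact: Cmod_minus_le.
have := H k. have := H (S k). lra.
Qed.

Lemma coef_bound (a : nat -> C) (s : C) (r : R) (f : C -> C) (t : R) :
  expands a s r f -> (0 <= t < r)%R ->
  exists M, (0 < M)%R /\ forall k, (Cmod (a k) * t ^ k <= M)%R.
Proof.
move=> H [H0 H1].
have Hz : (Cmod (s + RtoC t - s) < r)%R.
  replace (s + RtoC t - s) with (RtoC t) by ring. by rewrite Cmod_R Rabs_pos_eq.
have [M [HM HM2]] := Csum_terms_bounded _ _ (H _ Hz).
exists M; split=> // k. apply: Rle_trans (HM2 k).
replace (s + RtoC t - s) with (RtoC t) by ring.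
rewrite Cmod_mult Cmod_pow Cmod_R Rabs_pos_eq //. lra.
Qed.

(** Bernoulli's inequality for [/ p = 1 + x] gives [1 + k x <= p^(-k)], hence [k p^k <= / x]. *)
Lemma linear_geom_bounded (p : R) : (0 <= p < 1)%R ->
  exists M, (0 < M)%R /\ forall k, ((INR k + 1) * p ^ k <= M)%R.
Proof.
move=> [H0 H1].
case: (Req_dec p 0) => [->|Hp].
  exists 1%R; split; first lra. move=> [|k]; first by rewrite /=; lra.
  rewrite /= Rmult_0_l Rmult_0_r. lra.
pose x := (/ p - 1)%R.
have Hx : (0 < x)%R.
  rewrite /x. have := Rinv_lt_contravar p 1. rewrite Rinv_1 Rmult_1_r. lra.
exists (1 + / x)%R; split; first by have := Rinv_0_lt_compat _ Hx; lra.
move=> k.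
have Hb : (1 + INR k * x <= (/ p) ^ k)%R.
  have -> : (/ p = 1 + x)%R by rewrite /x; ring.
  elim: k => [|k IH]; first by rewrite /=; lra.
  rewrite S_INR [((1 + x) ^ S k)%R]/=.
  have := pos_INR k. nra.
have Hpk : (0 < p ^ k)%R by apply: pow_lt; lra.
have Hpp : ((/ p) ^ k * p ^ k = 1)%R by rewrite -Rpow_mult_distr Rinv_l ?pow1.
have H2 : ((1 + INR k * x) * p ^ k <= 1)%R by rewrite -Hpp; apply: Rmult_le_compat_r; lra.
have Hp1 : (p ^ k <= 1)%R by rewrite -(pow1 k); apply: pow_incr; lra.
have H3 : (INR k * p ^ k <= / x)%R.
  apply: (Rmult_le_reg_r x) => //. rewrite Rinv_l; nra.
lra.
Qed.

(** The weight [(INR k + 1) ^ 2] is the one that second-order Taylor remainders need in term-by-term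
    differentiation. *)
Lemma coef_geom_bound (a : nat -> C) (s : C) (r : R) (f : C -> C) (t : R) :
  expands a s r f -> (0 <= t < r)%R ->
  exists M q, (0 < M)%R /\ (0 <= q < 1)%R /\
    forall k, (Cmod (a k) * (INR k + 1) ^ 2 * t ^ k <= M * q ^ k)%R.
Proof.
move=> H [H0 H1].
pose t' := ((t + r) / 2)%R.
have Ht' : (0 < t' < r)%R by rewrite /t'; lra.
have Htt : (t < t')%R by rewrite /t'; lra.
have [M1 [HM1 Hb1]] : exists M, (0 < M)%R /\ forall k, (Cmod (a k) * t' ^ k <= M)%R.
  apply: (coef_bound a s r f) => //. lra.
pose q := (t / t')%R.
have Hq : (0 <= q < 1)%R.
  rewrite /q; split; first (apply: Rdiv_le_0_compat; lra).
  apply/Rlt_div_l; lra.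
(* Here [q = p * p * p2]: the two factors [p ^ k] absorb the quadratic weight, and [p2 ^ k] is the
   geometric bound that is left. *)
pose p2 := sqrt q. pose p := sqrt p2.
have Hp2 : (0 <= p2 < 1)%R.
  rewrite /p2; split; first exact: sqrt_pos.
  rewrite -sqrt_1. apply: sqrt_lt_1_alt. lra.
have Hp : (0 <= p < 1)%R.
  rewrite /p; split; first exact: sqrt_pos.
  rewrite -sqrt_1. apply: sqrt_lt_1_alt. lra.
have Epp : (p * p = p2)%R by apply: sqrt_sqrt; lra.
have Eqq : (p2 * p2 = q)%R by apply: sqrt_sqrt; lra.
have [K [HK HbK]] := linear_geom_bounded p Hp.
exists (M1 * (K * K))%R, p2; split; first by apply: Rmult_lt_0_compat => //; exact: Rmult_lt_0_compat.
split; first exact: Hp2.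
move=> k.
have -> : (t ^ k = t' ^ k * (p ^ k * p ^ k * p2 ^ k))%R.
  rewrite -!Rpow_mult_distr Epp Eqq /q. f_equal. field. lra.
have h1 := Hb1 k. have h2 := HbK k.
have h3 : (0 <= p ^ k)%R by apply: pow_le; lra.
have h4 : (0 <= p2 ^ k)%R by apply: pow_le; lra.
have h5 : (0 <= Cmod (a k) * t' ^ k)%R.
  apply: Rmult_le_pos; [exact: Cmod_ge_0|apply: pow_le; lra].
have h6 : (0 <= (INR k + 1) * p ^ k)%R by apply: Rmult_le_pos => //; have := pos_INR k; lra.
have -> : (Cmod (a k) * (INR k + 1) ^ 2 * (t' ^ k * (p ^ k * p ^ k * p2 ^ k)) =
  (Cmod (a k) * t' ^ k) * (((INR k + 1) * p ^ k) * ((INR k + 1) * p ^ k)) * p2 ^ k)%R by ring.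
apply: Rmult_le_compat_r => //.
apply: Rmult_le_compat; [exact: h5|nra|exact: h1|nra].
Qed.

Lemma ex_series_geom_scal (M q : R) : (0 <= q < 1)%R -> ex_series (fun k => (M * q ^ k)%R).
Proof.
move=> Hq. apply: (ex_series_scal_l M (fun k => (q ^ k)%R)). apply: ex_series_geom.
rewrite Rabs_pos_eq; lra.
Qed.

Lemma coef_ex_series2 (a : nat -> C) (s : C) (r : R) (f : C -> C) (t : R) :
  expands a s r f -> (0 <= t < r)%R ->
  ex_series (fun k => Cmod (a k) * (INR k + 1) ^ 2 * t ^ k)%R.
Proof.
move=> H Ht. have [M [q [HM [Hq Hb]]]] := coef_geom_bound _ _ _ _ _ H Ht.
apply: (ex_series_le (V := R_CompleteNormedModule) _ (fun k => M * q ^ k)%R);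
  last exact: ex_series_geom_scal.
move=> k. rewrite /norm /= /abs /= Rabs_pos_eq //.
apply: Rmult_le_pos; last by apply: pow_le; lra.
apply: Rmult_le_pos; [exact: Cmod_ge_0|apply: pow2_ge_0].
Qed.

Lemma coef_ex_series (a : nat -> C) (s : C) (r : R) (f : C -> C) (t : R) :
  expands a s r f -> (0 <= t < r)%R -> ex_series (fun k => Cmod (a k) * t ^ k)%R.
Proof.
move=> H Ht. apply: (ex_series_le (V := R_CompleteNormedModule)); last exact: (coef_ex_series2 _ _ _ _ _ H Ht).
move=> k. rewrite /norm /= /abs /=.
have h1 : (0 <= Cmod (a k) * t ^ k)%R.
  apply: Rmult_le_pos; [exact: Cmod_ge_0|apply: pow_le; lra].
rewrite Rabs_pos_eq //.
have := pos_INR k. nra.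
Qed.

Lemma expands_ext (a : nat -> C) (s : C) (r : R) (f g : C -> C) :
  (forall z, (Cmod (z - s) < r)%R -> f z = g z) -> expands a s r f -> expands a s r g.
Proof. move=> H Hf z Hz. rewrite -H //. exact: Hf. Qed.

Lemma expands_plus (a b : nat -> C) (s : C) (r : R) (f g : C -> C) :
  expands a s r f -> expands b s r g ->
  expands (fun k => a k + b k) s r (fun z => f z + g z).
Proof.
move=> Hf Hg z Hz.
apply: (Ctends_ext (fun n => Csum (fun k => a k * (z - s) ^ k) n + Csum (fun k => b k * (z - s) ^ k) n)).
  move=> n. rewrite -Csum_plus. apply: Csum_ext => k _. ring.
apply: Ctends_plus; [exact: Hf|exact: Hg].
Qed.

Lemma expands_scal (a : nat -> C) (c s : C) (r : R) (f : C -> C) :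
  expands a s r f -> expands (fun k => c * a k) s r (fun z => c * f z).
Proof.
move=> Hf z Hz.
apply: (Ctends_ext (fun n => c * Csum (fun k => a k * (z - s) ^ k) n)).
  move=> n. rewrite -Csum_scal. apply: Csum_ext => k _. ring.
apply: Ctends_scal; exact: Hf.
Qed.

Lemma expands_const (c s : C) (r : R) :
  expands (fun k => match k with O => c | _ => 0 end) s r (fun _ => c).
Proof.
move=> z Hz. apply/(Ctends_incr _ _ 1).
apply: (Ctends_ext (fun _ => c)); last exact: Ctends_const.
move=> n. rewrite Nat.add_comm /=. elim: n => [|n IH] /=; first ring.
rewrite -IH. ring.
Qed.

Lemma expands_id (s : C) (r : R) :
  expands (fun k => match k with O => s | 1%nat => 1 | _ => 0 end) s r (fun z => z).
Proof.
move=> z Hz. apply/(Ctends_incr _ _ 2).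
apply: (Ctends_ext (fun _ => z)); last exact: Ctends_const.
move=> n. rewrite Nat.add_comm. elim: n => [|n IH]; first by rewrite /=; ring.
rewrite {1}IH /=. ring.
Qed.

Lemma expands_affine (a : nat -> C) (c d s : C) (r r' : R) (f : C -> C) :
  c <> 0 -> (Cmod c * r' <= r)%R ->
  expands a (c * s + d) r f ->
  expands (fun k => a k * c ^ k) s r' (fun z => f (c * z + d)).
Proof.
move=> hc Hc H z Hz.
have E : c * z + d - (c * s + d) = c * (z - s) by ring.
have Hz' : (Cmod (c * z + d - (c * s + d)) < r)%R.
  rewrite E Cmod_mult. apply: Rlt_le_trans Hc. apply: Rmult_lt_compat_l => //.
  by apply/Cmod_gt_0.
apply: Ctends_ext (H _ Hz') => n. apply: Csum_ext => k _.
rewrite E Cpow_mult_l. ring.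
Qed.

Lemma expands_shrink (a : nat -> C) (s : C) (r r' : R) (f : C -> C) :
  (r' <= r)%R -> expands a s r f -> expands a s r' f.
Proof. move=> Hr H z Hz. apply: H. lra. Qed.

(** Both sides run over the triangle of index pairs with [i + j < n]. *)
Lemma Csum_cauchy (u v : nat -> C) (n : nat) :
  Csum (fun m => Csum (fun k => u k * v (m - k)%nat) (S m)) n =
  Csum (fun i => u i * Csum v (n - i)) n.
Proof.
elim: n => [//|n IH]. rewrite [LHS]/= -/(Csum _ n) IH.
change (Csum (fun i => u i * Csum v (n - i)) n +
  Csum (fun k => u k * v (n - k)%nat) (S n) =
  Csum (fun i => u i * Csum v (S n - i)) n + u n * Csum v (S n - n)).
have -> : (S n - n = 1)%nat by lia.
rewrite (Csum_ext (fun i => u i * Csum v (S n - i))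
  (fun i => u i * Csum v (n - i) + u i * v (n - i)%nat)); last first.
  move=> k Hk. have -> : (S n - k = S (n - k))%nat by lia. rewrite /=. ring.
rewrite Csum_plus /= Nat.sub_diag. ring.
Qed.

Lemma Rsum_cauchy (u v : nat -> R) (n : nat) :
  Rsum (fun m => Rsum (fun k => u k * v (m - k)%nat)%R (S m)) n =
  Rsum (fun i => u i * Rsum v (n - i))%R n.
Proof.
apply: RtoC_inj. rewrite -!Csum_RtoC.
rewrite (Csum_ext _ (fun m => Csum (fun k => RtoC (u k) * RtoC (v (m - k)%nat)) (S m))); last first.
  move=> k _. rewrite -Csum_RtoC. apply: Csum_ext => j _. by rewrite RtoC_mult.
rewrite (Csum_cauchy (fun k => RtoC (u k)) (fun k => RtoC (v k))).
apply: Csum_ext => k _. by rewrite RtoC_mult Csum_RtoC.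
Qed.

Lemma Cmod_Csum_diff (v : nat -> C) (m n : nat) : (m <= n)%nat ->
  (Cmod (Csum v n - Csum v m) <= Rsum (fun k => Cmod (v k)) n - Rsum (fun k => Cmod (v k)) m)%R.
Proof.
elim: n => [|n IH] H.
  have -> : m = O by lia. rewrite /= Csub_diag Cmod_0. lra.
case: (Nat.eq_dec m (S n)) => [->|Hm].
  rewrite Csub_diag Cmod_0. lra.
rewrite /=. replace (Csum v n + v n - Csum v m) with (Csum v n - Csum v m + v n) by ring.
apply: Rle_trans; first exact: Cmod_triangle.
have := IH ltac:(lia). lra.
Qed.

(** The square of products minus the triangle is bounded by the same difference for the moduli. That
    difference tends to 0 by the theorem on products of nonnegative real series. *)
Lemma Csum_cauchy_product (u v : nat -> C) (A B : C) :
  Ctends (Csum u) A -> Ctends (Csum v) B ->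
  ex_series (fun k => Cmod (u k)) -> ex_series (fun k => Cmod (v k)) ->
  Ctends (Csum (fun m => Csum (fun k => u k * v (m - k)%nat) (S m))) (A * B).
Proof.
move=> Hu Hv [U HU] [V HV].
pose u' := fun k => Cmod (u k). pose v' := fun k => Cmod (v k).
have Hprod := is_series_mult_pos _ _ _ _ HU HV (fun k => Cmod_ge_0 _) (fun k => Cmod_ge_0 _).
have HC : is_lim_seq (Rsum (fun m => Rsum (fun k => u' k * v' (m - k)%nat)%R (S m))) (U * V)%R.
  apply/is_series_Rsum. apply: is_series_ext Hprod => n.
  by rewrite -Rsum_sum_n sum_n_Reals.
have HUV : is_lim_seq (fun n => Rsum u' n * Rsum v' n)%R (U * V)%R.
  apply: is_lim_seq_mult'; exact/is_series_Rsum.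
have HD := is_lim_seq_minus' _ _ _ _ HUV HC.
rewrite Rminus_diag in HD.
have HAB := Ctends_mult _ _ _ _ Hu Hv.
have HE : Ctends (fun n => Csum u n * Csum v n
    - Csum (fun m => Csum (fun k => u k * v (m - k)%nat) (S m)) n) 0.
  apply: Ctends_le HD => n.
  replace (_ - 0) with (Csum u n * Csum v n
    - Csum (fun m => Csum (fun k => u k * v (m - k)%nat) (S m)) n) by ring.
  rewrite Csum_cauchy Rsum_cauchy Cmult_comm -Csum_scal -Csum_minus Rmult_comm -Rsum_scal -Rsum_minus.
  apply: Cmod_Csum_le => k Hk.
  replace (Csum v n * u k - u k * Csum v (n - k)) with
    (u k * (Csum v n - Csum v (n - k))) by ring.
  rewrite Cmod_mult.
  have -> : (Rsum v' n * u' k - u' k * Rsum v' (n - k) = u' k * (Rsum v' n - Rsum v' (n - k)))%R by ring.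
  apply: Rmult_le_compat_l; first exact: Cmod_ge_0.
  apply: Cmod_Csum_diff. lia.
have := Ctends_minus _ _ _ _ HAB HE.
replace (A * B - 0) with (A * B) by ring.
apply: Ctends_ext => n. ring.
Qed.

Lemma expands_abs (a : nat -> C) (s : C) (r : R) (f : C -> C) (w : C) :
  expands a s r f -> (Cmod w < r)%R -> ex_series (fun k => Cmod (a k * w ^ k)).
Proof.
move=> H Hw.
have h := coef_ex_series _ _ _ _ (Cmod w) H (conj (Cmod_ge_0 _) Hw).
apply: ex_series_ext h => k. by rewrite Cmod_mult Cmod_pow.
Qed.

Lemma expands_mult (a b : nat -> C) (s : C) (r : R) (f g : C -> C) :
  expands a s r f -> expands b s r g ->
  expands (fun m => Csum (fun k => a k * b (m - k)%nat) (S m)) s r (fun z => f z * g z).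
Proof.
move=> Hf Hg z Hz.
have := Csum_cauchy_product _ _ _ _ (Hf z Hz) (Hg z Hz)
  (expands_abs _ _ _ _ _ Hf Hz) (expands_abs _ _ _ _ _ Hg Hz).
apply: Ctends_ext => n. apply: Csum_ext => m _.
rewrite Cmult_comm -Csum_scal. apply: Csum_ext => k Hk.
have -> : (z - s) ^ m = (z - s) ^ k * (z - s) ^ (m - k).
  rewrite -Cpow_add_r. f_equal. lia.
ring.
Qed.

(** * Complex derivatives and term-by-term differentiation *)

Notation is_Cderive := (is_derive (K := C_AbsRing) (V := C_NormedModule)).

Lemma is_Cderive_eps (f : C -> C) (z l : C) :
  is_Cderive f z l <->
  forall eps : R, (0 < eps)%R -> exists d, (0 < d)%R /\
    forall y, (Cmod (y - z) < d)%R ->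
      (Cmod (f y - f z - l * (y - z)) <= eps * Cmod (y - z))%R.
Proof.
split.
- move=> [_ H] eps He.
  have := H z (fun P HP => HP) (mkposreal eps He) => [[d Hd]].
  exists d; split; first exact: cond_pos.
  move=> y Hy. have := Hd y Hy.
  rewrite /minus /plus /opp /scal /mult /norm /= /mult /=.
  by rewrite (Cmult_comm l).
- move=> H. split.
    apply: is_linear_scal_l.
  move=> x Hx.
  have -> : x = z.
    apply: Logic.eq_sym.
    exact: (is_filter_lim_locally_unique (V := AbsRing_NormedModule C_AbsRing)).
  move=> eps. have [d [Hd HdP]] := H eps (cond_pos eps).
  exists (mkposreal d Hd) => y Hy. have := HdP y Hy.
  rewrite /minus /plus /opp /scal /mult /norm /= /mult /=.
  by rewrite (Cmult_comm l).
Qed.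

(** Second-order Taylor remainder of a power, with [t ^ 2] moved to the left to avoid the exponent
    [k - 2]. The remainders satisfy [E_(k+1) = (w + h) E_k + k w^(k-1) h^2], and
    [k^2 + k <= (k + 1)^2] closes the induction. *)
Lemma pow_taylor (w h : C) (t : R) (k : nat) : (Cmod w + Cmod h <= t)%R ->
  (t ^ 2 * Cmod ((w + h) ^ k - w ^ k - RtoC (INR k) * w ^ (pred k) * h)
    <= Cmod h ^ 2 * (INR k ^ 2 * t ^ k))%R.
Proof.
move=> Ht. have hw := Cmod_ge_0 w. have hh := Cmod_ge_0 h.
elim: k => [|k IH].
  rewrite /=. replace (1 - 1 - 0 * 1 * h) with (RtoC 0) by ring. rewrite Cmod_0. lra.
set E := (w + h) ^ k - w ^ k - RtoC (INR k) * w ^ (pred k) * h in IH.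
have EE : (w + h) ^ S k - w ^ S k - RtoC (INR (S k)) * w ^ (pred (S k)) * h =
   (w + h) * E + RtoC (INR k) * w ^ (pred k) * h ^ 2.
  rewrite /E S_INR RtoC_plus /=. case: k {IH E} => [|k] /=; ring.
rewrite EE.
have h1 : (Cmod ((w + h) * E) <= t * Cmod E)%R.
  rewrite Cmod_mult. apply: Rmult_le_compat_r; first exact: Cmod_ge_0.
  apply: Rle_trans Ht. exact: Cmod_triangle.
have h2 : (t ^ 2 * Cmod (RtoC (INR k) * w ^ (pred k) * h ^ 2) <= INR k * Cmod h ^ 2 * t ^ S k)%R.
  rewrite !Cmod_mult !Cmod_pow Cmod_R Rabs_pos_eq; last exact: pos_INR.
  case: k {IH E EE h1} => [|k]; first by rewrite /=; lra.
  apply: (Rle_trans _ (INR (S k) * Cmod h ^ 2 * (t ^ 2 * Cmod w ^ k))%R).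
    right. simpl pred. rewrite Cmod_1. ring.
  have -> : (t ^ S (S k) = t ^ 2 * t ^ k)%R by rewrite /=; ring.
  apply: Rmult_le_compat_l.
    apply: Rmult_le_pos; [exact: pos_INR | exact: pow2_ge_0].
  apply: Rmult_le_compat_l; first exact: pow2_ge_0.
  apply: pow_incr. lra.
have h3 := Cmod_triangle ((w + h) * E) (RtoC (INR k) * w ^ (pred k) * h ^ 2).
have h4 : (0 <= t ^ k)%R by apply: pow_le; lra.
have ht2 : (0 <= t ^ 2)%R by exact: pow2_ge_0.
apply: Rle_trans.
  apply: Rmult_le_compat_l; [exact: ht2|exact: h3].
rewrite Rmult_plus_distr_l.
apply: Rle_trans.
  apply: Rplus_le_compat; last exact: h2.
  apply: Rle_trans; first (apply: Rmult_le_compat_l; [exact: ht2|exact: h1]).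
  have -> : (t ^ 2 * (t * Cmod E) = t * (t ^ 2 * Cmod E))%R by ring.
  apply: Rmult_le_compat_l; [lra|exact: IH].
have -> : (t * (Cmod h ^ 2 * (INR k ^ 2 * t ^ k)) + INR k * Cmod h ^ 2 * t ^ S k =
  (Cmod h ^ 2 * t ^ S k) * (INR k ^ 2 + INR k))%R by rewrite /=; ring.
have -> : (Cmod h ^ 2 * (INR (S k) ^ 2 * t ^ S k) = (Cmod h ^ 2 * t ^ S k) * INR (S k) ^ 2)%R by ring.
apply: Rmult_le_compat_l.
  apply: Rmult_le_pos; first exact: pow2_ge_0. apply: pow_le; lra.
rewrite S_INR. have := pos_INR k. nra.
Qed.

Definition dcoef (a : nat -> C) (k : nat) : C := RtoC (INR (S k)) * a (S k).

Lemma Csum_dcoef (a : nat -> C) (w : C) (n : nat) :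
  Csum (fun k => a k * (RtoC (INR k) * w ^ (pred k))) (S n) =
  Csum (fun k => dcoef a k * w ^ k) n.
Proof.
rewrite Csum_S_l.
have -> : a O * (RtoC (INR 0) * w ^ (pred 0)) = 0 by rewrite /= Cmult_0_l Cmult_0_r.
rewrite Cplus_0_l. apply: Csum_ext => k _. rewrite /dcoef; simpl pred; ring.
Qed.

Lemma expands_derive (a : nat -> C) (s : C) (r : R) (f : C -> C) (z : C) :
  expands a s r f -> (Cmod (z - s) < r)%R ->
  exists l, Ctends (Csum (fun k => dcoef a k * (z - s) ^ k)) l /\ is_Cderive f z l.
Proof.
move=> H Hz.
set w := z - s. pose t := ((Cmod w + r) / 2)%R.
have hw := Cmod_ge_0 w. rewrite -/w in Hz.
have Ht : (0 < t < r)%R by rewrite /t; lra.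
have Htw : (Cmod w < t)%R by rewrite /t; lra.
have Hex := coef_ex_series2 _ _ _ _ t H ltac:(lra).
have [l Hl] : exists l, Ctends (Csum (fun k => a k * (RtoC (INR k) * w ^ (pred k)))) l.
  apply: (Csum_cv_abs _ (fun k => / t * (Cmod (a k) * (INR k + 1) ^ 2 * t ^ k))%R);
    last by apply: ex_series_scal_l.
  move=> k. rewrite !Cmod_mult Cmod_pow Cmod_R Rabs_pos_eq; last exact: pos_INR.
  have h0 := Cmod_ge_0 (a k).
  have -> : (/ t * (Cmod (a k) * (INR k + 1) ^ 2 * t ^ k) =
    Cmod (a k) * (/ t * ((INR k + 1) ^ 2 * t ^ k)))%R by ring.
  apply: Rmult_le_compat_l => //.
  case: k h0 => [|k] _.
    rewrite [INR 0]/= Rmult_0_l. apply: Rmult_le_pos.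
      left; apply: Rinv_0_lt_compat; lra. rewrite /=; lra.
  have -> : (/ t * ((INR (S k) + 1) ^ 2 * t ^ S k) = (INR (S k) + 1) ^ 2 * t ^ k)%R.
    rewrite /=. field. lra.
  apply: Rmult_le_compat; [exact: pos_INR|apply: pow_le; lra| |rewrite [pred _]/=; apply: pow_incr; lra].
  have := pos_INR (S k). nra.
exists l; split.
  apply/(Ctends_ext _ _ _ (Csum_dcoef a w)).
  move/(Ctends_incr _ _ 1): Hl. apply: Ctends_ext => n. by rewrite Nat.add_comm.
pose K := Series (fun k => Cmod (a k) * (INR k + 1) ^ 2 * t ^ k)%R.
have Hpos : forall k, (0 <= Cmod (a k) * (INR k + 1) ^ 2 * t ^ k)%R.
  move=> k. apply: Rmult_le_pos; last by apply: pow_le; lra.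
  apply: Rmult_le_pos; [exact: Cmod_ge_0|apply: pow2_ge_0].
have HK0 : (0 <= K)%R by have := Rsum_le_Series _ 0 Hpos Hex.
(* Summing [pow_taylor] against the coefficients gives a remainder quadratic in [h], which is
   stronger than differentiability. *)
have Hquad : forall h, (Cmod h < t - Cmod w)%R ->
    (t ^ 2 * Cmod (f (z + h)%C - f z - l * h) <= Cmod h ^ 2 * K)%R.
  move=> h Hh.
  have Hzh : (Cmod (z + h - s) < r)%R.
    replace (z + h - s) with (w + h) by (rewrite /w; ring).
    have := Cmod_triangle w h. lra.
  have L := Ctends_minus _ _ _ _ (Ctends_minus _ _ _ _ (H _ Hzh) (H z Hz)) (Ctends_scal h _ _ Hl).
  have L2 := Ctends_scal (RtoC (t ^ 2)) _ _ L.
  have := Ctends_le_bound _ _ 0 (Cmod h ^ 2 * K) _ L2.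
  rewrite Csub_0_r.
  rewrite Cmod_mult Cmod_R Rabs_pos_eq; last exact: pow2_ge_0.
  rewrite (Cmult_comm h l). apply=> n.
  rewrite Csub_0_r.
  rewrite -Csum_scal -!Csum_minus -Csum_scal.
  apply: Rle_trans.
    apply: (Cmod_Csum_le _ (fun k => Cmod h ^ 2 * (Cmod (a k) * (INR k + 1) ^ 2 * t ^ k))%R) => k _.
    replace (z + h - s) with (w + h) by (rewrite /w; ring). rewrite -/w.
    replace (RtoC (t ^ 2) * _) with
      (a k * (RtoC (t ^ 2) * ((w + h) ^ k - w ^ k - RtoC (INR k) * w ^ (pred k) * h))) by ring.
    rewrite Cmod_mult Cmod_mult Cmod_R Rabs_pos_eq; last exact: pow2_ge_0.
    have h1 := pow_taylor w h t k ltac:(lra).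
    have h2 := Cmod_ge_0 (a k).
    apply: Rle_trans; first (apply: Rmult_le_compat_l; [exact: h2|exact: h1]).
    have -> : (Cmod (a k) * (Cmod h ^ 2 * (INR k ^ 2 * t ^ k)) =
       Cmod h ^ 2 * Cmod (a k) * t ^ k * INR k ^ 2)%R by ring.
    have -> : (Cmod h ^ 2 * (Cmod (a k) * (INR k + 1) ^ 2 * t ^ k) =
       Cmod h ^ 2 * Cmod (a k) * t ^ k * (INR k + 1) ^ 2)%R by ring.
    apply: Rmult_le_compat_l.
      apply: Rmult_le_pos; last by apply: pow_le; lra.
      apply: Rmult_le_pos => //. exact: pow2_ge_0.
    have := pos_INR k. nra.
  rewrite Rsum_scal. apply: Rmult_le_compat_l; first exact: pow2_ge_0.
  exact: Rsum_le_Series.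
apply/is_Cderive_eps => eps He.
have Ht2 : (0 < t ^ 2)%R by apply: pow_lt; lra.
have Hd : (0 < Rmin (t - Cmod w) (eps * t ^ 2 / (K + 1)))%R.
  apply: Rmin_glb_lt; first lra.
  apply: Rdiv_lt_0_compat; [nra|lra].
exists (Rmin (t - Cmod w) (eps * t ^ 2 / (K + 1)))%R; split=> // y Hy.
have Hy1 := Rlt_le_trans _ _ _ Hy (Rmin_l _ _).
have Hy2 := Rlt_le_trans _ _ _ Hy (Rmin_r _ _).
have := Hquad (y - z) Hy1. replace (z + (y - z)) with y by ring.
move=> Hq. have hy0 := Cmod_ge_0 (y - z).
move: Hy2 => /Rlt_div_r Hy2. have {}Hy2 := Hy2 ltac:(lra).
apply: (Rmult_le_reg_l (t ^ 2)) => //. apply: Rle_trans Hq _.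
nra.
Qed.

Lemma expands_C_derive (a : nat -> C) (s : C) (r : R) (f : C -> C) :
  expands a s r f -> expands (dcoef a) s r (C_derive f).
Proof.
move=> H z Hz. have [l [Hl Hd]] := expands_derive _ _ _ _ _ H Hz.
by rewrite (is_C_derive_unique _ _ _ Hd).
Qed.

(** * The complex exponential, roots of unity and Cauchy's estimate *)

Lemma Cexp_plus (x y : C) : Cexp (x + y) = Cexp x * Cexp y.
Proof.
rewrite /Cexp /Re /Im /= exp_plus cos_plus sin_plus /RtoC /Cmult /=.
apply: injective_projections => /=; ring.
Qed.

Lemma Cexp_0 : Cexp 0 = 1.
Proof.
rewrite /Cexp /= exp_0 cos_0 sin_0. apply: injective_projections => /=; ring.
Qed.

Lemma Cexp_opp (x : C) : Cexp x * Cexp (- x) = 1.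
Proof. rewrite -Cexp_plus Cplus_opp_r. exact: Cexp_0. Qed.

Lemma Cexp_neq_0 (x : C) : Cexp x <> 0.
Proof.
move=> H. have := Cexp_opp x. rewrite H Cmult_0_l => h. exact: C1_nz (eq_sym h).
Qed.

Lemma Cexp_opp_inv (x : C) : Cexp (- x) = / Cexp x.
Proof.
have h := Cexp_neq_0 x. have E := Cexp_opp x.
replace (Cexp (- x)) with (Cexp x * Cexp (- x) / Cexp x) by (field; exact: h).
rewrite E. field; exact: h.
Qed.

Lemma Cmod_Cexp (x : C) : Cmod (Cexp x) = exp (Re x).
Proof.
rewrite /Cexp Cmod_mult Cmod_R Rabs_pos_eq; last by left; exact: exp_pos.
rewrite /Cmod /=. have -> : (cos (Im x) * (cos (Im x) * 1) + sin (Im x) * (sin (Im x) * 1) = 1)%R.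
  have := sin2_cos2 (Im x). rewrite /Rsqr. lra.
rewrite sqrt_1. ring.
Qed.

Lemma Cexp_pow (x : C) (n : nat) : Cexp x ^ n = Cexp (RtoC (INR n) * x).
Proof.
elim: n => [|n IH]; first by rewrite /= Cmult_0_l Cexp_0.
rewrite Cpow_S IH -Cexp_plus S_INR RtoC_plus. f_equal. ring.
Qed.

Lemma Cexp_RtoC (x : R) : Cexp (RtoC x) = RtoC (exp x).
Proof. rewrite /Cexp /= cos_0 sin_0. apply: injective_projections => /=; ring. Qed.

Lemma Csum_geom (x : C) (n : nat) : (x - 1) * Csum (fun j => x ^ j) n = x ^ n - 1.
Proof.
elim: n => [|n IH] /=; first ring. rewrite Cmult_plus_distr_l IH. ring.
Qed.

Lemma Cexp_2PI : Cexp (2 * PI * Ci) = 1.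
Proof.
rewrite /Cexp /=.
have -> : ((2 * PI - 0 * 0) * 0 - (2 * 0 + 0 * PI) * 1 = 0)%R by ring.
have -> : ((2 * PI - 0 * 0) * 1 + (2 * 0 + 0 * PI) * 0 = 2 * PI)%R by ring.
rewrite exp_0 cos_2PI sin_2PI. apply: injective_projections => /=; ring.
Qed.

Lemma Cexp_Ci_eq_1 (x : R) : (- (2 * PI) < x < 2 * PI)%R -> Cexp (RtoC x * Ci) = 1 -> x = 0%R.
Proof.
move=> Hx. rewrite /Cexp /=.
have -> : (x * 0 - 0 * 1 = 0)%R by ring.
have -> : (x * 1 + 0 * 0 = x)%R by ring.
rewrite exp_0 => E. have := f_equal fst E. rewrite /= => E1.
have {E1} E1 : cos x = 1%R by lra.
have h : (sin (x / 2) = 0)%R.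
  have := cos_2a_sin (x / 2). replace (2 * (x / 2))%R with x by field. rewrite E1. nra.
case: (Rtotal_order x 0) => [h0|[//|h0]].
- have := sin_lt_0_var (x / 2). lra.
- have := sin_gt_0 (x / 2). lra.
Qed.

(** A geometric sum whose ratio is an [N]-th root of unity. The ratio is 1 only for [k = l], since
    its angle [2 PI (l - k) / N] is less than a full turn. *)
Lemma roots_of_unity_orthogonality (N k l : nat) : (k < N)%nat -> (l < N)%nat ->
  Csum (fun j => (Cexp (2 * PI * Ci / RtoC (INR N)) ^ l * Cexp (- (2 * PI * Ci / RtoC (INR N))) ^ k) ^ j) N =
  if Nat.eqb k l then RtoC (INR N) else 0.
Proof.
move=> Hk Hl.
have HN : RtoC (INR N) <> 0 by move=> /RtoC_inj; apply: not_0_INR; lia.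
set x := _ ^ l * _.
have Ex : x = Cexp (RtoC (2 * PI * (INR l - INR k) / INR N) * Ci).
  rewrite /x !Cexp_pow -Cexp_plus. f_equal.
  rewrite RtoC_div; last by move=> h; apply: HN; rewrite h.
  rewrite (RtoC_mult (2 * PI)) (RtoC_mult 2 PI) RtoC_minus. field. exact: HN.
have ExN : x ^ N = 1.
  have E : forall j, (Cexp (2 * PI * Ci / RtoC (INR N)) ^ j) ^ N = 1.
    move=> j. rewrite -Cpow_mult_r Nat.mul_comm Cpow_mult_r Cexp_pow.
    replace (RtoC (INR N) * (2 * PI * Ci / RtoC (INR N))) with (2 * PI * Ci) by (field; exact: HN).
    by rewrite Cexp_2PI Cpow_1_l.
  rewrite /x Cpow_mult_l E Cexp_opp_inv Cpow_inv; last exact: Cexp_neq_0.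
  rewrite Cpow_inv ?E; first by field.
  apply: Cpow_nz. exact: Cexp_neq_0.
case: (Nat.eqb_spec k l) => [Hkl|Hkl].
- have Ex1 : x = 1.
    rewrite Ex Hkl. replace (2 * PI * (INR l - INR l) / INR N)%R with 0%R.
      by rewrite Cmult_0_l Cexp_0.
    rewrite Rminus_diag Rmult_0_r /Rdiv. ring.
  rewrite Ex1. rewrite (Csum_ext _ (fun _ => RtoC 1)); last by move=> j _; rewrite Cpow_1_l.
  elim: (N) => [//|n IH]. rewrite [LHS]/= IH S_INR RtoC_plus. ring.
- have Hx1 : x - 1 <> 0.
    move=> Hx. have {}Hx : x = 1 by replace x with (x - 1 + 1) by ring; rewrite Hx; ring.
    rewrite Ex in Hx. apply Cexp_Ci_eq_1 in Hx.
      have hN : (0 < INR N)%R by apply: lt_0_INR; lia.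
      have : (INR l - INR k = 0)%R.
        have hp := PI_RGT_0.
        replace (INR l - INR k)%R with ((2 * PI * (INR l - INR k) / INR N) * INR N / (2 * PI))%R by (field; lra).
        rewrite Hx. field. lra.
      move=> h. apply: Hkl. apply: INR_eq. lra.
    have hN : (0 < INR N)%R by apply: lt_0_INR; lia.
    have h1 := lt_INR _ _ Hk. have h2 := lt_INR _ _ Hl.
    have h3 := pos_INR k. have h4 := pos_INR l. have hp := PI_RGT_0.
    split.
      apply/Rlt_div_r => //. nra.
    apply/Rlt_div_l => //. nra.
  have := Csum_geom x N. rewrite ExN.
  replace (1 - 1) with (RtoC 0) by ring. move=> E.
  case: (Ceq_dec (Csum (fun j => x ^ j) N) 0) => // hn.
  by have := Cmult_neq_0 _ _ Hx1 hn.
Qed.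

Lemma Csum_switch (u : nat -> nat -> C) (m n : nat) :
  Csum (fun i => Csum (u i) n) m = Csum (fun j => Csum (fun i => u i j) m) n.
Proof.
elim: m => [|m IH] /=.
  elim: n => [//|n IHn] /=. rewrite -IHn. ring.
by rewrite IH -Csum_plus.
Qed.

Lemma Csum_delta (u : nat -> C) (k n : nat) : (k < n)%nat ->
  Csum (fun j => if Nat.eqb k j then u j else 0) n = u k.
Proof.
elim: n => [|n IH] H; first lia. rewrite /=.
case: (Nat.eqb_spec k n) => [->|Hk].
  rewrite (Csum_ext _ (fun _ => RtoC 0 * 0)); last first.
    move=> j Hj. case: (Nat.eqb_spec n j) => [h|_]; [lia|ring].
  rewrite Csum_scal. ring.
rewrite IH; [ring|lia].
Qed.

(** Averaging over the [N]-th roots of unity extracts one coefficient of a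
    polynomial of degree less than [N]. *)
Lemma Cauchy_estimate (a : nat -> C) (s : C) (r t M : R) (f : C -> C) (k : nat) :
  expands a s r f -> (0 <= t < r)%R ->
  (forall z, (Cmod (z - s) = t)%R -> (Cmod (f z) <= M)%R) ->
  (Cmod (a k) * t ^ k <= M)%R.
Proof.
move=> H Ht HM. apply: le_epsilon => eps He.
have Hex := coef_ex_series _ _ _ _ t H Ht.
have Hpos : forall j, (0 <= Cmod (a j) * t ^ j)%R.
  move=> j. apply: Rmult_le_pos; [exact: Cmod_ge_0 | apply: pow_le; lra].
have /is_series_Rsum /is_lim_seq_Reals /(_ eps He) [L0 HL0] := Series_correct _ Hex.
(* [L] exceeds [k], so that coefficient survives the truncation, and it leaves a tail below [eps],
   so that the polynomial [P] stays within [eps] of [f] on the circle. *)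
pose L := (L0 + S k)%nat.
have HL : (Series (fun j => Cmod (a j) * t ^ j) - Rsum (fun j => Cmod (a j) * t ^ j) L < eps)%R.
  have := HL0 L ltac:(rewrite /L; lia). rewrite /Rdist => /Rabs_def2. lra.
pose P z := Csum (fun j => a j * (z - s) ^ j) L.
have HP : forall z, (Cmod (z - s) = t)%R -> (Cmod (P z) <= M + eps)%R.
  move=> z Hz.
  have h : (Cmod (f z - P z) <= eps)%R.
    apply: Rle_trans; last (left; exact: HL).
    have Hz' : (Cmod (z - s) < r)%R by rewrite Hz; lra.
    apply: (Ctends_le_bound_loc _ _ _ _ L _ (H z Hz')) => n Hn.
    apply: Rle_trans; first exact: Cmod_Csum_diff.
    rewrite !(Rsum_ext (fun k0 => Cmod (a k0 * (z - s) ^ k0)) (fun j => Cmod (a j) * t ^ j)%R);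
      try by move=> j _; rewrite Cmod_mult Cmod_pow Hz.
    have := Rsum_le_Series _ n Hpos Hex. lra.
  have := HM z Hz. have := Cmod_minus_le (f z) (f z - P z).
  replace (f z - (f z - P z)) with (P z) by ring. lra.
pose N := L. have HN : (0 < N)%nat by rewrite /N /L; lia.
have hN : (0 < INR N)%R by exact: lt_0_INR.
have HNC : RtoC (INR N) <> 0 by move=> /RtoC_inj; lra.
set u := Cexp (2 * PI * Ci / RtoC (INR N)).
set v := Cexp (- (2 * PI * Ci / RtoC (INR N))).
have Cu : Cmod u = 1%R.
  rewrite /u Cmod_Cexp -exp_0. f_equal.
  replace (2 * PI * Ci / RtoC (INR N)) with (RtoC (2 * PI / INR N) * Ci).
    by rewrite /=; ring.
  rewrite RtoC_div; last lra. rewrite (RtoC_mult 2 PI). field. exact: HNC.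
have Cv : Cmod v = 1%R.
  rewrite /v Cexp_opp_inv Cmod_inv; last exact: Cexp_neq_0. rewrite -/u Cu. field.
have E : Csum (fun j => P (s + RtoC t * u ^ j) * v ^ (j * k)) N = RtoC (INR N) * (a k * RtoC t ^ k).
  rewrite (Csum_ext _ (fun j => Csum (fun l => a l * RtoC t ^ l * (u ^ l * v ^ k) ^ j) L)); last first.
    move=> j _. rewrite /P Cmult_comm -Csum_scal. apply: Csum_ext => l _.
    replace (s + RtoC t * u ^ j - s) with (RtoC t * u ^ j) by ring.
    rewrite !Cpow_mult_l -!Cpow_mult_r (Nat.mul_comm l j) (Nat.mul_comm k j). ring.
  rewrite Csum_switch.
  rewrite (Csum_ext _ (fun l => if Nat.eqb k l then RtoC (INR N) * (a l * RtoC t ^ l) else 0)); last first.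
    move=> l Hl. rewrite Csum_scal roots_of_unity_orthogonality; [|rewrite /N /L; lia|exact: Hl].
    case: (Nat.eqb_spec k l) => _; ring.
  rewrite (Csum_delta (fun l => RtoC (INR N) * (a l * RtoC t ^ l))) //. rewrite /L. lia.
have h : (Cmod (RtoC (INR N) * (a k * RtoC t ^ k)) <= INR N * (M + eps))%R.
  rewrite -E. apply: Rle_trans.
    apply: (Cmod_Csum_le _ (fun _ => M + eps)%R) => j _.
    rewrite Cmod_mult Cmod_pow Cv pow1 Rmult_1_r. apply: HP.
    replace (s + RtoC t * u ^ j - s) with (RtoC t * u ^ j) by ring.
    rewrite Cmod_mult Cmod_pow Cu pow1 Cmod_R Rabs_pos_eq; lra.
  right. elim: (N) => [|n IH]; first by rewrite /=; ring.
  rewrite [LHS]/= IH S_INR. ring.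
move: h. rewrite !Cmod_mult Cmod_pow !Cmod_R !Rabs_pos_eq; try lra.
move=> h. exact: (Rmult_le_reg_l (INR N)).
Qed.

(** * Limits and zeros of analytic functions *)

Lemma Ctends_Cauchy (u : nat -> C) :
  (forall eps : R, (0 < eps)%R -> exists N, forall n m, (N <= n)%nat -> (N <= m)%nat ->
     (Cmod (u n - u m) <= eps)%R) -> exists l, Ctends u l.
Proof.
move=> H.
have Hre : ex_finite_lim_seq (fun n => Re (u n)).
  apply/ex_lim_seq_cauchy_corr => eps.
  have [N HN] := H (eps / 2)%R (is_pos_div_2 eps). exists N => n m Hn Hm.
  apply: Rle_lt_trans; last apply: (Rle_lt_trans _ _ _ (HN n m Hn Hm)).
    apply: Rle_trans; last exact: Rmax_Cmod. exact: Rmax_l.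
  have := cond_pos eps. lra.
have Him : ex_finite_lim_seq (fun n => Im (u n)).
  apply/ex_lim_seq_cauchy_corr => eps.
  have [N HN] := H (eps / 2)%R (is_pos_div_2 eps). exists N => n m Hn Hm.
  apply: Rle_lt_trans; last apply: (Rle_lt_trans _ _ _ (HN n m Hn Hm)).
    apply: Rle_trans; last exact: Rmax_Cmod. exact: Rmax_r.
  have := cond_pos eps. lra.
case: Hre => a /Ctends_RtoC Ha. case: Him => b /Ctends_RtoC Hb.
exists (RtoC a + RtoC b * Ci).
apply: (Ctends_ext (fun n => RtoC (Re (u n)) + RtoC (Im (u n)) * Ci)).
  move=> n. apply: injective_projections => /=; rewrite /Re /Im; ring.
apply: Ctends_plus => //. apply: Ctends_mult => //. exact: Ctends_const.
Qed.

(** Weierstrass' theorem: the coefficients converge by Cauchy's estimate. *)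
Lemma expands_uniform_limit (a : nat -> nat -> C) (s : C) (r : R)
  (F : nat -> C -> C) (f : C -> C) : (0 < r)%R ->
  (forall n, expands (a n) s r (F n)) ->
  (forall eps : R, (0 < eps)%R -> exists N, forall n z, (N <= n)%nat ->
     (Cmod (z - s) < r)%R -> (Cmod (F n z - f z) <= eps)%R) ->
  exists b, expands b s r f.
Proof.
move=> Hr HF Hu.
(* Cauchy's estimate for the difference of [F n] and [F m], uniformly in [k] and in the radius
   [t < r]. *)
have Hest : forall eps : R, (0 < eps)%R -> exists N, forall n m k t,
    (N <= n)%nat -> (N <= m)%nat -> (0 <= t < r)%R ->
    (Cmod (a n k - a m k) * t ^ k <= eps)%R.
  move=> eps He. have [N HN] := Hu (eps / 2)%R ltac:(lra).
  exists N => n m k t Hn Hm Ht.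
  have HD := expands_plus _ _ _ _ _ _ (HF n) (expands_scal _ (- (1)) _ _ _ (HF m)).
  have := Cauchy_estimate _ _ _ t eps _ k HD Ht.
  replace (a n k + - (1) * a m k) with (a n k - a m k) by ring.
  apply=> z Hz.
  have Hz' : (Cmod (z - s) < r)%R by lra.
  replace (F n z + - (1) * F m z) with ((F n z - f z) - (F m z - f z)) by ring.
  apply: Rle_trans; first exact: Cmod_minus_le.
  have := HN n z Hn Hz'. have := HN m z Hm Hz'. lra.
have Hlim : forall k, exists l, Ctends (fun n => a n k) l.
  move=> k. apply: Ctends_Cauchy => eps He.
  have hp : (0 < (r / 2) ^ k)%R by apply: pow_lt; lra.
  have [N HN] := Hest (eps * (r / 2) ^ k)%R ltac:(nra).
  exists N => n m Hn Hm. have := HN n m k (r / 2)%R Hn Hm ltac:(lra).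
  move=> h. exact: (Rmult_le_reg_r ((r / 2) ^ k)).
have [b Hb] := functional_choice _ Hlim.
exists b => z Hz. set w := z - s.
pose t := ((Cmod w + r) / 2)%R. have hw := Cmod_ge_0 w. rewrite -/w in Hz.
have Ht : (0 < t < r)%R by rewrite /t; lra.
have Htw : (Cmod w < t)%R by rewrite /t; lra.
pose q := (Cmod w / t)%R.
have Hq : (0 <= q < 1)%R.
  rewrite /q; split; first (apply: Rdiv_le_0_compat; lra). apply/Rlt_div_l; lra.
have Hqw : (q * t = Cmod w)%R by rewrite /q; field; lra.
apply/Ctends_eps => eps He.
(* The factor [1 - q] cancels the sum of the geometric series of ratio [q]. *)
pose e1 := (eps / 4 * (1 - q))%R.
have He1 : (0 < e1)%R by rewrite /e1; apply: Rmult_lt_0_compat; lra.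
have [N1 HN1] := Hest e1 He1.
have [N2 HN2] := Hu (eps / 4)%R ltac:(lra).
pose n := (N1 + N2)%nat.
have Hz' : (Cmod (z - s) < r)%R by exact: Hz.
have [K HK] := proj1 (Ctends_eps _ _) (HF n z Hz') (eps / 4)%R ltac:(lra).
exists K => m Hm.
have hb : forall k, (Cmod (b k - a n k) * t ^ k <= e1)%R.
  move=> k.
  have h1 : (0 < t ^ k)%R by apply: pow_lt; lra.
  apply/Rle_div_r => //.
  apply: (Ctends_le_bound_loc _ _ _ _ n _ (Hb k)) => j Hj.
  apply/Rle_div_r => //. apply: HN1; [rewrite /n in Hj; lia|rewrite /n; lia|lra].
have h1 : (Cmod (Csum (fun k => b k * w ^ k)%C m - Csum (fun k => a n k * w ^ k)%C m) <= eps / 4)%R.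
  rewrite -Csum_minus. apply: Rle_trans.
    apply: (Cmod_Csum_le _ (fun k => e1 * q ^ k)%R) => k _.
    replace (b k * w ^ k - a n k * w ^ k) with ((b k - a n k) * w ^ k) by ring.
    rewrite Cmod_mult Cmod_pow -Hqw Rpow_mult_distr.
    have := hb k. have : (0 <= q ^ k)%R by apply: pow_le; lra. nra.
  rewrite Rsum_scal.
  have hg : ((1 - q) * Rsum (pow q) m <= 1)%R.
    have : ((1 - q) * Rsum (pow q) m = 1 - q ^ m)%R.
      elim: (m) => [|j IH]; first by rewrite /=; ring.
      rewrite [Rsum _ _]/= Rmult_plus_distr_l IH /=. ring.
    have : (0 <= q ^ m)%R by apply: pow_le; lra. lra.
  have := Rmult_le_compat_l (eps / 4) _ _ ltac:(lra) hg. rewrite /e1. lra.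
have h2 := HK m Hm. rewrite -/w in h2.
have h3 := HN2 n z ltac:(rewrite /n; lia) Hz'.
replace (Csum (fun k => b k * w ^ k) m - f z) with
  ((Csum (fun k => b k * w ^ k) m - Csum (fun k => a n k * w ^ k) m) +
   ((Csum (fun k => a n k * w ^ k) m - F n z) + (F n z - f z))) by ring.
apply: Rle_lt_trans; first exact: Cmod_triangle.
have := Cmod_triangle (Csum (fun k => a n k * w ^ k) m - F n z) (F n z - f z).
lra.
Qed.

(** The lowest nonzero coefficient dominates near the centre: a zero [z] of [f] would give
    [|a k| t^(k+1) <= |z - s| * SS], which fails once [z] is close enough to [s]. *)
Lemma expands_zero_coefs (a : nat -> C) (s : C) (r : R) (f : C -> C) :
  (0 < r)%R -> expands a s r f ->
  (forall eps, (0 < eps)%R -> exists z, z <> s /\ (Cmod (z - s) < eps)%R /\ f z = 0) ->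
  forall k, a k = 0.
Proof.
move=> Hr H Hz k. induction k as [k IH] using lt_wf_ind.
case: (Ceq_dec (a k) 0) => // hk. exfalso.
pose t := (r / 2)%R. have Ht : (0 < t < r)%R by rewrite /t; lra.
have Hex := coef_ex_series _ _ _ _ t H ltac:(lra).
have Hpos : forall j, (0 <= Cmod (a j) * t ^ j)%R.
  move=> j. apply: Rmult_le_pos; [exact: Cmod_ge_0 | apply: pow_le; lra].
set SS := Series (fun j => Cmod (a j) * t ^ j)%R in Hex.
have HS : (0 <= SS)%R by have := Rsum_le_Series _ 0 Hpos Hex.
have hak : (0 < Cmod (a k))%R by apply/Cmod_gt_0.
have htk : (0 < t ^ (S k))%R by apply: pow_lt; lra.
have He : (0 < Rmin t (t ^ (S k) * Cmod (a k) / (SS + 1)))%R.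
  apply: Rmin_glb_lt; first lra. apply: Rdiv_lt_0_compat; [nra|lra].
have [z [Hzs [Hz1 Hz2]]] := Hz _ He.
have Hz3 := Rlt_le_trans _ _ _ Hz1 (Rmin_l _ _).
have Hz4 := Rlt_le_trans _ _ _ Hz1 (Rmin_r _ _).
set w := z - s in Hz1 Hz3 Hz4.
have hw : (0 < Cmod w)%R by apply/Cmod_gt_0; exact: Csub_neq_0.
have L := H z ltac:(rewrite -/w; lra). rewrite Hz2 -/w in L.
have L2 := Ctends_scal (RtoC (t ^ (S k))) _ _ (Ctends_minus _ _ _ _ L (Ctends_const (a k * w ^ k))).
have := Ctends_le_bound_loc _ _ 0 (Cmod w ^ (S k) * SS) (S k) _ L2.
rewrite Csub_0_r. case.
  move=> n Hn. rewrite Csub_0_r.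
  rewrite -(Csum_delta (fun j => a j * w ^ j) k n) // -Csum_minus -Csum_scal.
  apply: Rle_trans.
    apply: (Cmod_Csum_le _ (fun j => Cmod w ^ (S k) * (Cmod (a j) * t ^ j))%R) => j _.
    have hr : (0 <= Cmod w ^ S k * (Cmod (a j) * t ^ j))%R.
      apply: Rmult_le_pos => //. apply: pow_le; lra.
    case: (Nat.eqb_spec k j) => [_|hkj].
      replace (_ * _) with (RtoC 0) by ring. by rewrite Cmod_0.
    case: (Nat.lt_ge_cases j k) => hj.
      have -> : RtoC (t ^ S k) * (a j * w ^ j - 0) = 0 by rewrite (IH j hj); ring.
      by rewrite Cmod_0.
    replace (RtoC (t ^ S k) * (a j * w ^ j - 0)) with (RtoC (t ^ S k) * (a j * w ^ j)) by ring.
    rewrite !Cmod_mult Cmod_pow Cmod_R Rabs_pos_eq; last by left.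
    have [i ->] : exists i, j = (S k + i)%nat by exists (j - S k)%nat; lia.
    rewrite !pow_add.
    have hp : (Cmod w ^ i <= t ^ i)%R by apply: pow_incr; lra.
    have hwk : (0 < Cmod w ^ S k)%R by apply: pow_lt.
    have ha := Cmod_ge_0 (a (S k + i)%nat).
    apply: (Rle_trans _ ((t ^ S k * Cmod (a (S k + i)%nat) * Cmod w ^ S k) * Cmod w ^ i)%R).
      right; ring.
    apply: (Rle_trans _ ((t ^ S k * Cmod (a (S k + i)%nat) * Cmod w ^ S k) * t ^ i)%R).
      apply: Rmult_le_compat_l => //. apply: Rmult_le_pos; last lra. apply: Rmult_le_pos => //; lra.
    right; ring.
  rewrite Rsum_scal. apply: Rmult_le_compat_l; first by apply: pow_le; lra.
  exact: Rsum_le_Series.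
all: replace (0 - a k * w ^ k) with (- (a k * w ^ k)) by ring;
  rewrite Cmod_mult Cmod_opp Cmod_mult Cmod_pow Cmod_R Rabs_pos_eq; last by left.
all: have hwk : (0 < Cmod w ^ k)%R by apply: pow_lt.
all: move: Hz4 => /Rlt_div_r Hz4; have {}Hz4 := Hz4 ltac:(lra).
all: move=> h; rewrite [(Cmod w ^ S k)%R]/= in h; nra.
Qed.

Lemma expands_zero (a : nat -> C) (s : C) (r : R) (f : C -> C) :
  expands a s r f -> (forall k, a k = 0) -> forall z, (Cmod (z - s) < r)%R -> f z = 0.
Proof.
move=> H Ha z Hz. apply: (Ctends_unique _ _ _ (H z Hz)).
apply: (Ctends_ext (fun _ => 0)); last exact: Ctends_const.
elim=> [//|n IH] /=. rewrite -IH Ha. ring.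
Qed.

Definition vanishes_near (f : C -> C) (s : C) : Prop :=
  exists d, (0 < d)%R /\ forall z, (Cmod (z - s) < d)%R -> f z = 0.

Lemma analytic_vanishes_near (f : C -> C) (s : C) : analytic_at f s ->
  (forall eps, (0 < eps)%R -> exists z, z <> s /\ (Cmod (z - s) < eps)%R /\ f z = 0) ->
  vanishes_near f s.
Proof.
move=> /analytic_at_expands [a [r [Hr H]]] Hz.
exists r; split=> // z Hzr.
apply: (expands_zero a s r f H _ z Hzr). exact: expands_zero_coefs H Hz.
Qed.

Lemma identity_on_segment (f : C -> C) (p q : C) :
  (forall t : R, (0 <= t <= 1)%R -> analytic_at f (p + RtoC t * (q - p))) ->
  vanishes_near f p -> vanishes_near f q.
Proof.
move=> Han Hp.
case: (Ceq_dec p q) => [<-//|Hpq].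
have hqp : (0 < Cmod (q - p))%R.
  apply/Cmod_gt_0. apply: Csub_neq_0 => h. exact: Hpq.
pose g := fun t : R => p + RtoC t * (q - p).
have Eg : forall t u, (Cmod (g t - g u) = Rabs (t - u) * Cmod (q - p))%R.
  move=> t u. rewrite /g.
  replace (p + RtoC t * (q - p) - (p + RtoC u * (q - p))) with (RtoC (t - u) * (q - p)).
    by rewrite Cmod_mult Cmod_R. rewrite RtoC_minus. ring.
pose S := fun t => (0 <= t <= 1)%R /\ forall u, (0 <= u <= t)%R -> vanishes_near f (g u).
have g0 : g 0%R = p by rewrite /g; ring.
have g1 : g 1%R = q by rewrite /g; ring.
have S0 : S 0%R.
  split; first lra. move=> u Hu. have -> : u = 0%R by lra. by rewrite g0.
have [T [HT1 HT2]] : {m : R | is_lub S m}.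
  apply: completeness; [|by exists 0%R]. exists 1%R => t [Ht _]. lra.
have HT0 : (0 <= T)%R by apply: HT1.
have HT3 : (T <= 1)%R by apply: HT2 => t [Ht _]; lra.
have near_lub : forall e, (0 < e)%R -> exists u, S u /\ (T - e < u <= T)%R.
  move=> e He. apply: Classical_Prop.NNPP => h.
  have : (T <= T - e)%R.
    apply: HT2 => u Hu. have := HT1 u Hu => Hu2.
    case: (Rle_lt_dec u (T - e)) => // h2. case: h. exists u. by split.
  lra.
have HV : vanishes_near f (g T).
  apply: Classical_Prop.NNPP => hV. apply: hV.
  case: (Classical_Prop.classic (S T)) => [[_ h]|hS]; first by apply: h; lra.
  apply: analytic_vanishes_near; first by apply: Han.
  move=> eps He.
  have [u [Hu1 Hu2]] := near_lub (eps / Cmod (q - p))%R ltac:(exact: Rdiv_lt_0_compat).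
  have HuT : (u < T)%R.
    case: (Rle_lt_or_eq_dec u T) => // [|h]; first lra. by rewrite h in Hu1.
  exists (g u). split.
    move=> h. have := Eg u T. rewrite h Csub_diag Cmod_0.
    rewrite Rabs_left; last lra.
    have := Rmult_lt_0_compat (T - u) (Cmod (q - p)) ltac:(lra) hqp. lra.
  split.
    rewrite Eg Rabs_left; last lra.
    apply/Rlt_div_r => //. lra.
  have [_ h] := Hu1. have [d [Hd h2]] := h u ltac:(have := proj1 Hu1; lra).
  apply: h2. by rewrite Csub_diag Cmod_0.
have [d [Hd HdV]] := HV.
have Hnear : forall u, (Rabs (u - T) * Cmod (q - p) < d)%R -> vanishes_near f (g u).
  move=> u Hu. exists (d - Rabs (u - T) * Cmod (q - p))%R; split; first lra.
  move=> z Hz. apply: HdV.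
  have := Cmod_dist_triangle z (g u) (g T). rewrite (Eg u T). lra.
have [u0 [Hu01 Hu02]] := near_lub (d / Cmod (q - p))%R ltac:(exact: Rdiv_lt_0_compat).
(* Half of the parameter radius beyond [T], capped at 1. Parameters up to [u0] are covered by
   [S u0], and those between [u0] and [e] are near [T]. *)
pose e := (Rmin 1 (T + d / Cmod (q - p) / 2))%R.
have Hde : (0 < d / Cmod (q - p))%R by exact: Rdiv_lt_0_compat.
have HSe : S e.
  split.
    split; last exact: Rmin_l. apply: Rmin_glb; lra.
  move=> u Hu.
  case: (Rle_lt_dec u u0) => hu; first by apply: (proj2 Hu01); lra.
  apply: Hnear. apply/Rlt_div_r => //.
  have := Rmin_r 1 (T + d / Cmod (q - p) / 2). rewrite -/e => h. 
  apply: Rabs_def1; lra.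
have h := HT1 _ HSe.
have h1 : (T = 1)%R.
  move: h. rewrite /e /Rmin. case: Rle_dec => _ h; lra.
by rewrite -g1 -h1.
Qed.

(** Difference quotients along sequences reduce the rules of differentiation to the algebra of
    [Ctends]. *)
Lemma is_Cderive_seq (f : C -> C) (z l : C) :
  is_Cderive f z l <->
  forall y : nat -> C, (forall n, y n <> z) -> Ctends y z ->
    Ctends (fun n => (f (y n) - f z) / (y n - z)) l.
Proof.
have Hq : forall y : C, y <> z ->
   (Cmod ((f y - f z) / (y - z) - l) * Cmod (y - z))%R = Cmod (f y - f z - l * (y - z)).
  move=> y Hy. rewrite -Cmod_mult. f_equal. field. exact: Csub_neq_0.
have Hy0 : forall y : C, y <> z -> (0 < Cmod (y - z))%R.
  move=> y Hy. apply/Cmod_gt_0. exact: Csub_neq_0.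
rewrite is_Cderive_eps. split.
- move=> H y Hy1 Hy2. apply/Ctends_eps => eps He.
  have [d [Hd H2]] := H (eps / 2)%R ltac:(lra).
  have [N HN] := proj1 (Ctends_eps _ _) Hy2 d Hd. exists N => n Hn.
  have := H2 _ (HN n Hn). rewrite -Hq; last exact: Hy1.
  move=> h. have := Rmult_le_reg_r _ _ _ (Hy0 _ (Hy1 n)) h. lra.
(* By contraposition: counterexamples at distance less than [1 / (n + 1)], chosen for every [n],
   form a sequence that contradicts the hypothesis. *)
- move=> H eps He. apply: Classical_Prop.NNPP => hn.
  have Hc : forall n : nat, exists y, (Cmod (y - z) < / (INR n + 1))%R /\
     (eps * Cmod (y - z) < Cmod (f y - f z - l * (y - z)))%R.
    move=> n. apply: Classical_Prop.NNPP => hy. apply: hn.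
    exists (/ (INR n + 1))%R. split.
      apply: Rinv_0_lt_compat. have := pos_INR n; lra.
    move=> y Hy. case: (Rle_lt_dec (Cmod (f y - f z - l * (y - z))) (eps * Cmod (y - z))) => // h.
    case: hy. by exists y.
  have [y Hy] := functional_choice _ Hc.
  have Hy1 : forall n, y n <> z.
    move=> n h. have [_] := Hy n. rewrite h.
    rewrite Csub_diag Cmod_0 Cmult_0_r.
    have -> : f z - f z - 0 = 0 by ring. rewrite Cmod_0. lra.
  have Hy2 : Ctends y z.
    apply: (Ctends_le _ (fun n => / (INR n + 1))%R); first by move=> n; left; exact: (proj1 (Hy n)).
    apply: (is_lim_seq_ext (fun n => / INR (S n))%R); first by move=> n; rewrite S_INR.
    apply/(is_lim_seq_incr_1 (fun n => / INR n)%R).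
    have := is_lim_seq_inv _ _ is_lim_seq_INR. by apply.
  have [N HN] := proj1 (Ctends_eps _ _) (H y Hy1 Hy2) eps He.
  have := HN N (le_n _). have [_] := Hy N. rewrite -Hq //.
  move=> h1 h2. have := Hy0 _ (Hy1 N). nra.
Qed.

Lemma is_Cderive_continuous (f : C -> C) (z l : C) (y : nat -> C) :
  is_Cderive f z l -> (forall n, y n <> z) -> Ctends y z -> Ctends (fun n => f (y n)) (f z).
Proof.
move=> /is_Cderive_seq H Hy1 Hy2.
have := Ctends_plus _ _ _ _ (Ctends_const (f z))
  (Ctends_mult _ _ _ _ (H y Hy1 Hy2) (Ctends_minus _ _ _ _ Hy2 (Ctends_const z))).
replace (f z + l * (z - z)) with (f z) by ring.
apply: Ctends_ext => n. field.
exact: Csub_neq_0.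
Qed.

Lemma is_Cderive_mult (f g : C -> C) (z l m : C) :
  is_Cderive f z l -> is_Cderive g z m ->
  is_Cderive (fun y => f y * g y) z (l * g z + f z * m).
Proof.
move=> Hf Hg. apply/is_Cderive_seq => y Hy1 Hy2.
have h1 := Ctends_mult _ _ _ _ (proj1 (is_Cderive_seq _ _ _) Hf y Hy1 Hy2) (Ctends_const (g z)).
have h2 := Ctends_mult _ _ _ _ (is_Cderive_continuous _ _ _ y Hf Hy1 Hy2)
    (proj1 (is_Cderive_seq _ _ _) Hg y Hy1 Hy2).
apply: Ctends_ext (Ctends_plus _ _ _ _ h1 h2) => n. field.
exact: Csub_neq_0.
Qed.

Lemma is_Cderive_plus (f g : C -> C) (z l m : C) :
  is_Cderive f z l -> is_Cderive g z m ->
  is_Cderive (fun y => f y + g y) z (l + m).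
Proof.
move=> Hf Hg. apply/is_Cderive_seq => y Hy1 Hy2.
have h1 := proj1 (is_Cderive_seq _ _ _) Hf y Hy1 Hy2.
have h2 := proj1 (is_Cderive_seq _ _ _) Hg y Hy1 Hy2.
apply: Ctends_ext (Ctends_plus _ _ _ _ h1 h2) => n. field.
exact: Csub_neq_0.
Qed.

Lemma is_Cderive_const (c z : C) : is_Cderive (fun _ => c) z (RtoC 0).
Proof.
apply/is_Cderive_seq => y Hy1 Hy2. apply: (Ctends_ext (fun _ => 0)); last exact: Ctends_const.
move=> n. field.
exact: Csub_neq_0.
Qed.

Lemma is_Cderive_affine (f : C -> C) (c d z l : C) : c <> 0 ->
  is_Cderive f (c * z + d) l -> is_Cderive (fun y => f (c * y + d)) z (c * l).
Proof.
move=> Hc Hf. apply/is_Cderive_seq => y Hy1 Hy2.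
have h0 : forall n, y n - z <> 0 by move=> n; exact: Csub_neq_0.
have h1 : forall n, c * y n + d <> c * z + d.
  move=> n h. apply: (Cmult_neq_0 _ _ Hc (h0 n)).
  replace (c * (y n - z)) with (c * y n + d - (c * z + d)) by ring. rewrite h; ring.
have h2 : Ctends (fun n => c * y n + d) (c * z + d).
  apply: Ctends_plus; [exact: Ctends_scal|exact: Ctends_const].
have := Ctends_scal c _ _ (proj1 (is_Cderive_seq _ _ _) Hf _ h1 h2).
apply: Ctends_ext => n. field. split => //.
replace (c * y n + d - (c * z + d)) with (c * (y n - z)) by ring. exact: Cmult_neq_0.
Qed.

Lemma is_Cderive_ext (f g : C -> C) (z l : C) (d : R) : (0 < d)%R ->
  (forall y, (Cmod (y - z) < d)%R -> f y = g y) -> is_Cderive f z l -> is_Cderive g z l.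
Proof.
move=> Hd H /is_Cderive_eps Hf. apply/is_Cderive_eps => eps He.
have [d' [Hd' H2]] := Hf eps He. exists (Rmin d d'); split; first exact: Rmin_glb_lt.
move=> y Hy. rewrite -!H.
- apply: H2. apply: Rlt_le_trans Hy (Rmin_r _ _).
- rewrite Csub_diag Cmod_0. exact: Hd.
- apply: Rlt_le_trans Hy (Rmin_l _ _).
Qed.

Lemma is_Cderive_inv (f : C -> C) (z l : C) (d : R) : (0 < d)%R ->
  (forall y, (Cmod (y - z) < d)%R -> f y <> 0) ->
  is_Cderive f z l -> is_Cderive (fun y => / f y) z (- l * / f z * / f z).
Proof.
move=> Hd Hf0 Hf. apply/is_Cderive_seq => y Hy1 Hy2.
have hfz : f z <> 0 by apply: Hf0; rewrite Csub_diag Cmod_0.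
have h1 := proj1 (is_Cderive_seq _ _ _) Hf y Hy1 Hy2.
have h2 := Ctends_inv _ _ hfz (is_Cderive_continuous _ _ _ y Hf Hy1 Hy2).
have := Ctends_mult _ _ _ _ (Ctends_mult _ _ _ _ (Ctends_opp _ _ h1) h2) (Ctends_const (/ f z)).
have [N HN] := proj1 (Ctends_eps _ _) Hy2 d Hd.
apply: (Ctends_ext_loc _ _ _ N) => n Hn. field.
have hn : f (y n) <> 0 by apply: Hf0; exact: HN.
repeat split => //.
exact: Csub_neq_0.
Qed.

Definition Copen (U : C -> Prop) : Prop :=
  forall z, U z -> exists d, (0 < d)%R /\ forall y, (Cmod (y - z) < d)%R -> U y.

(** Finitely many complex derivatives are all that the recursion for [Zk] consumes. The notion is
    closed under inverses by the quotient rule, so no power series of a reciprocal has to be built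
    for [chi] and [omega]. *)
Fixpoint smooth (U : C -> Prop) (n : nat) (f : C -> C) : Prop :=
  match n with
  | O => True
  | S m => (forall z, U z -> exists l, is_Cderive f z l) /\ smooth U m (C_derive f)
  end.

Lemma smooth_ext (U : C -> Prop) (n : nat) (f g : C -> C) : Copen U ->
  (forall z, U z -> f z = g z) -> smooth U n f -> smooth U n g.
Proof.
move=> HU. elim: n f g => [//|n IH] f g H [H1 H2].
have H3 : forall z l, U z -> is_Cderive f z l -> is_Cderive g z l.
  move=> z l Hz. have [d [Hd HdU]] := HU z Hz.
  apply: (is_Cderive_ext _ _ _ _ d Hd) => y Hy. exact: H (HdU y Hy).
split.
- move=> z Hz. have [l Hl] := H1 z Hz. exists l. exact: H3.
- apply: IH H2 => z Hz. have [l Hl] := H1 z Hz.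
  by rewrite (is_C_derive_unique _ _ _ Hl) (is_C_derive_unique _ _ _ (H3 _ _ Hz Hl)).
Qed.

Lemma smooth_pred (U : C -> Prop) (n : nat) (f : C -> C) : smooth U (S n) f -> smooth U n f.
Proof.
elim: n f => [//|n IH] f [H1 H2]. split=> //. exact: IH.
Qed.

Lemma smooth_const (U : C -> Prop) (n : nat) (c : C) : Copen U -> smooth U n (fun _ => c).
Proof.
move=> HU. elim: n c => [//|n IH] c. split.
- move=> z _. exists (RtoC 0). exact: is_Cderive_const.
- apply: (smooth_ext _ _ (fun _ => RtoC 0)) => // z _.
  by rewrite (is_C_derive_unique _ _ _ (is_Cderive_const c z)).
Qed.

Lemma smooth_plus (U : C -> Prop) (n : nat) (f g : C -> C) : Copen U ->
  smooth U n f -> smooth U n g -> smooth U n (fun z => f z + g z).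
Proof.
move=> HU. elim: n f g => [//|n IH] f g [Hf1 Hf2] [Hg1 Hg2]. split.
- move=> z Hz. have [l Hl] := Hf1 z Hz. have [m Hm] := Hg1 z Hz.
  exists (l + m). exact: is_Cderive_plus.
- apply: (smooth_ext _ _ (fun z => C_derive f z + C_derive g z)) => //; last exact: IH.
  move=> z Hz. have [l Hl] := Hf1 z Hz. have [m Hm] := Hg1 z Hz.
  by rewrite (is_C_derive_unique _ _ _ Hl) (is_C_derive_unique _ _ _ Hm)
    (is_C_derive_unique _ _ _ (is_Cderive_plus _ _ _ _ _ Hl Hm)).
Qed.

Lemma smooth_mult (U : C -> Prop) (n : nat) (f g : C -> C) : Copen U ->
  smooth U n f -> smooth U n g -> smooth U n (fun z => f z * g z).
Proof.
move=> HU. elim: n f g => [//|n IH] f g Hf Hg.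
have [Hf1 Hf2] := Hf. have [Hg1 Hg2] := Hg. split.
- move=> z Hz. have [l Hl] := Hf1 z Hz. have [m Hm] := Hg1 z Hz.
  exists (l * g z + f z * m). exact: is_Cderive_mult.
- apply: (smooth_ext _ _ (fun z => C_derive f z * g z + f z * C_derive g z)) => //.
    move=> z Hz. have [l Hl] := Hf1 z Hz. have [m Hm] := Hg1 z Hz.
    by rewrite (is_C_derive_unique _ _ _ Hl) (is_C_derive_unique _ _ _ Hm)
      (is_C_derive_unique _ _ _ (is_Cderive_mult _ _ _ _ _ Hl Hm)).
  apply: smooth_plus => //; apply: IH => //; exact: smooth_pred.
Qed.

Lemma smooth_inv (U : C -> Prop) (n : nat) (f : C -> C) : Copen U ->
  (forall z, U z -> f z <> 0) -> smooth U n f -> smooth U n (fun z => / f z).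
Proof.
move=> HU H0. elim: n => [//|n IH] Hf. have [Hf1 Hf2] := Hf.
have Hd : forall z l, U z -> is_Cderive f z l ->
    is_Cderive (fun y => / f y) z (- l * / f z * / f z).
  move=> z l Hz. have [d [Hd HdU]] := HU z Hz.
  apply: (is_Cderive_inv _ _ _ d Hd) => y Hy. apply: H0. exact: HdU.
split.
- move=> z Hz. have [l Hl] := Hf1 z Hz. eexists. exact: Hd Hl.
- apply: (smooth_ext _ _ (fun z => - (1) * C_derive f z * / f z * / f z)) => //.
    move=> z Hz. have [l Hl] := Hf1 z Hz.
    rewrite (is_C_derive_unique _ _ _ Hl) (is_C_derive_unique _ _ _ (Hd _ _ Hz Hl)). ring.
  have Hi : smooth U n (fun z => / f z) by apply: IH; exact: smooth_pred.
  apply: smooth_mult => //. apply: smooth_mult => //. apply: smooth_mult => //.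
  exact: smooth_const.
Qed.

Lemma analytic_smooth (U : C -> Prop) (n : nat) (f : C -> C) :
  (forall z, U z -> analytic_at f z) -> smooth U n f.
Proof.
elim: n f => [//|n IH] f H. split.
- move=> z Hz. have /analytic_at_expands [a [r [Hr Ha]]] := H z Hz.
  have := expands_derive _ _ _ _ z Ha. rewrite Csub_diag Cmod_0.
  move=> h. have [l [_ Hl]] := h Hr. by exists l.
- apply: IH => z Hz. have /analytic_at_expands [a [r [Hr Ha]]] := H z Hz.
  apply/analytic_at_expands. exists (dcoef a), r. split=> //. exact: expands_C_derive.
Qed.

(** * Closure properties of analytic functions *)

Lemma analytic_ext (f g : C -> C) (s : C) (d : R) : (0 < d)%R ->
  (forall z, (Cmod (z - s) < d)%R -> f z = g z) -> analytic_at f s -> analytic_at g s.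
Proof.
move=> Hd H /analytic_at_expands [a [r [Hr Ha]]]. apply/analytic_at_expands.
exists a, (Rmin d r). split; first exact: Rmin_glb_lt.
apply: (expands_ext _ _ _ f).
  move=> z Hz. apply: H. apply: Rlt_le_trans Hz (Rmin_l _ _).
apply: expands_shrink Ha. exact: Rmin_r.
Qed.

Lemma analytic_plus (f g : C -> C) (s : C) :
  analytic_at f s -> analytic_at g s -> analytic_at (fun z => f z + g z) s.
Proof.
move=> /analytic_at_expands [a [r [Hr Ha]]] /analytic_at_expands [b [r' [Hr' Hb]]].
apply/analytic_at_expands. exists (fun k => a k + b k), (Rmin r r').
split; first exact: Rmin_glb_lt. apply: expands_plus.
- apply: expands_shrink Ha. exact: Rmin_l.
- apply: expands_shrink Hb. exact: Rmin_r.
Qed.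

Lemma analytic_mult (f g : C -> C) (s : C) :
  analytic_at f s -> analytic_at g s -> analytic_at (fun z => f z * g z) s.
Proof.
move=> /analytic_at_expands [a [r [Hr Ha]]] /analytic_at_expands [b [r' [Hr' Hb]]].
apply/analytic_at_expands. eexists _, (Rmin r r').
split; first exact: Rmin_glb_lt. apply: expands_mult.
- apply: expands_shrink Ha. exact: Rmin_l.
- apply: expands_shrink Hb. exact: Rmin_r.
Qed.

Lemma analytic_const (c s : C) : analytic_at (fun _ => c) s.
Proof. apply/analytic_at_expands. eexists _, 1%R. split; [lra|exact: expands_const]. Qed.

Lemma analytic_id (s : C) : analytic_at (fun z => z) s.
Proof. apply/analytic_at_expands. eexists _, 1%R. split; [lra|exact: expands_id]. Qed.

Lemma analytic_minus (f g : C -> C) (s : C) :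
  analytic_at f s -> analytic_at g s -> analytic_at (fun z => f z - g z) s.
Proof.
move=> Hf Hg. apply: (analytic_ext (fun z => f z + - (1) * g z) _ _ 1 Rlt_0_1).
  move=> z _. ring.
apply: analytic_plus => //. apply: analytic_mult => //. exact: analytic_const.
Qed.

Lemma analytic_affine (f : C -> C) (c d s : C) : c <> 0 ->
  analytic_at f (c * s + d) -> analytic_at (fun z => f (c * z + d)) s.
Proof.
move=> Hc /analytic_at_expands [a [r [Hr Ha]]]. apply/analytic_at_expands.
have hc : (0 < Cmod c)%R by apply/Cmod_gt_0.
exists (fun k => a k * c ^ k), (r / Cmod c)%R. split; first exact: Rdiv_lt_0_compat.
apply: expands_affine Ha => //. right. field. lra.
Qed.

(** * The exponential and entire functions *)

Definition expcoef (k : nat) : C := RtoC (/ INR (fact k)).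

Lemma is_Cderive_Cexp_0 (eps : R) : (0 < eps)%R -> exists d, (0 < d)%R /\
  forall h, (Cmod h < d)%R -> (Cmod (Cexp h - 1 - h) <= eps * Cmod h)%R.
Proof.
move=> He.
have lin : forall (f : R -> R) (l e : R), derivable_pt_lim f 0 l -> (0 < e)%R ->
    exists d, (0 < d)%R /\ forall x, (Rabs x < d)%R -> (Rabs (f x - f 0 - l * x) <= e * Rabs x)%R.
  move=> f l e Hf He'. have [d Hd] := Hf e He'. exists d; split; first exact: cond_pos.
  move=> x Hx. case: (Req_dec x 0) => [->|Hx0].
    rewrite Rabs_R0 !Rmult_0_r Rminus_0_r Rminus_diag Rabs_R0; lra.
  have := Hd x Hx0 Hx. rewrite Rplus_0_l => h.
  have hx : (0 < Rabs x)%R by exact: Rabs_pos_lt.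
  have -> : (f x - f 0 - l * x = ((f x - f 0) / x - l) * x)%R by field.
  rewrite Rabs_mult. apply: Rmult_le_compat_r; lra.
(* The real and imaginary parts cost [4 * e] and [5 * e], so a tenth of [eps] is enough; [e <= 1]
   keeps [exp a] below 3. *)
have He1 : (0 < Rmin 1 (eps / 10))%R by apply: Rmin_glb_lt; lra.
set e := Rmin 1 (eps / 10) in He1.
have he1 : (e <= 1)%R by exact: Rmin_l.
have he2 : (e <= eps / 10)%R by exact: Rmin_r.
have Dc : derivable_pt_lim cos 0 0.
  have := derivable_pt_lim_cos 0. by rewrite sin_0 Ropp_0.
have Ds : derivable_pt_lim sin 0 1.
  have := derivable_pt_lim_sin 0. by rewrite cos_0.
have De : derivable_pt_lim exp 0 1 by exact: derivable_pt_lim_exp_0.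
have [d1 [Hd1 H1]] := lin _ _ e De He1.
have [d2 [Hd2 H2]] := lin _ _ e Ds He1.
have [d3 [Hd3 H3]] := lin _ _ e Dc He1.
exists (Rmin e (Rmin d1 (Rmin d2 d3))); split.
  by do 3 (apply: Rmin_glb_lt => //).
move=> h Hh. pose a := Re h. pose b := Im h.
have ha : (Rabs a <= Cmod h)%R by apply: Rle_trans (Rmax_Cmod h); exact: Rmax_l.
have hb : (Rabs b <= Cmod h)%R by apply: Rle_trans (Rmax_Cmod h); exact: Rmax_r.
have Hh0 := Rlt_le_trans _ _ _ Hh (Rmin_l _ _).
have Hh' := Rlt_le_trans _ _ _ Hh (Rmin_r _ _).
have Hh1 := Rlt_le_trans _ _ _ Hh' (Rmin_l _ _).
have Hh'' := Rlt_le_trans _ _ _ Hh' (Rmin_r _ _).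
have Hh2 := Rlt_le_trans _ _ _ Hh'' (Rmin_l _ _).
have Hh3 := Rlt_le_trans _ _ _ Hh'' (Rmin_r _ _).
have E1 := H1 a ltac:(lra). rewrite exp_0 in E1.
have E2 := H2 b ltac:(lra). rewrite sin_0 in E2.
have E3 := H3 b ltac:(lra). rewrite cos_0 in E3.
have Ea0 := Rabs_pos a. have Eb0 := Rabs_pos b.
have Bexp : (0 <= exp a <= 3)%R.
  split; first by left; exact: exp_pos.
  have := Rle_abs (exp a - 1 - 1 * a). have := Rle_abs a. nra.
have Bexp1 : (Rabs (exp a - 1) <= 2 * Cmod h)%R.
  have -> : (exp a - 1 = (exp a - 1 - 1 * a) + a)%R by ring.
  apply: Rle_trans; first exact: Rabs_triang. nra.
have R1 : (Rabs (exp a * cos b - 1 - a) <= 4 * e * Cmod h)%R.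
  have -> : (exp a * cos b - 1 - a = (exp a - 1 - 1 * a) + exp a * (cos b - 1 - 0 * b))%R by ring.
  apply: Rle_trans; first exact: Rabs_triang.
  rewrite Rabs_mult (Rabs_pos_eq (exp a)); last lra. have := Rabs_pos (cos b - 1 - 0 * b). nra.
have R2 : (Rabs (exp a * sin b - b) <= 5 * e * Cmod h)%R.
  have -> : (exp a * sin b - b = exp a * (sin b - 0 - 1 * b) + (exp a - 1) * b)%R by ring.
  apply: Rle_trans; first exact: Rabs_triang.
  rewrite !Rabs_mult (Rabs_pos_eq (exp a)); last lra.
  have := Rabs_pos (sin b - 0 - 1 * b). have := Rabs_pos (exp a - 1). have := Cmod_ge_0 h. nra.
have -> : Cexp h - 1 - h = RtoC (exp a * cos b - 1 - a) + RtoC (exp a * sin b - b) * Ci.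
  rewrite /Cexp -/a -/b. apply: injective_projections => /=; rewrite /a /b /Re /Im; ring.
apply: Rle_trans; first exact: Cmod_triangle.
rewrite Cmod_mult Cmod_Ci !Cmod_R. have := Cmod_ge_0 h. nra.
Qed.

Lemma is_Cderive_Cexp (z : C) : is_Cderive Cexp z (Cexp z).
Proof.
apply/is_Cderive_eps => eps He.
have hz : (0 < Cmod (Cexp z))%R by apply/Cmod_gt_0; exact: Cexp_neq_0.
have [d [Hd H]] := is_Cderive_Cexp_0 (eps / Cmod (Cexp z))%R ltac:(exact: Rdiv_lt_0_compat).
exists d; split=> // y Hy.
have -> : Cexp y - Cexp z - Cexp z * (y - z) = Cexp z * (Cexp (y - z) - 1 - (y - z)).
  have -> : Cexp y = Cexp z * Cexp (y - z) by rewrite -Cexp_plus; f_equal; ring.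
  ring.
rewrite Cmod_mult. have := H _ Hy => h.
have := Rmult_le_compat_l _ _ _ (Rlt_le _ _ hz) h.
have -> : (Cmod (Cexp z) * (eps / Cmod (Cexp z) * Cmod (y - z)) = eps * Cmod (y - z))%R by field; lra.
done.
Qed.

(** Restricted to the segment from [p] to [q], [f] becomes a function of a real variable with zero
    derivative. *)
Lemma Cderive_zero_const (f : C -> C) (p q : C) :
  (forall z, is_Cderive f z (RtoC 0)) -> f p = f q.
Proof.
move=> H.
have h : forall t, is_derive (K := R_AbsRing) (V := C_R_NormedModule)
    (fun t : R => f (p + RtoC t * (q - p))) t zero.
  move=> t. split; first exact: is_linear_scal_l.
  move=> x Hx. have -> : x = t.
    apply: Logic.eq_sym. exact: (is_filter_lim_locally_unique (V := R_NormedModule)).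
  move=> eps {x Hx}.
  set M := (Cmod (q - p) + 1)%R. have hM := Cmod_ge_0 (q - p).
  have hM0 : (0 < M)%R by rewrite /M; lra.
  have [d [Hd Hd2]] := proj1 (is_Cderive_eps _ _ _) (H (p + RtoC t * (q - p))) (eps / M)%R
    ltac:(apply: Rdiv_lt_0_compat; [exact: cond_pos|lra]).
  have hdM : (0 < d / M)%R by exact: Rdiv_lt_0_compat.
  exists (mkposreal _ hdM) => u Hu.
  have Hu' : (Rabs (u - t) < d / M)%R by exact: Hu.
  have Eu : p + RtoC u * (q - p) - (p + RtoC t * (q - p)) = RtoC (u - t) * (q - p).
    rewrite RtoC_minus. ring.
  have Cu : (Cmod (p + RtoC u * (q - p) - (p + RtoC t * (q - p))) <= Rabs (u - t) * M)%R.
    rewrite Eu Cmod_mult Cmod_R. apply: Rmult_le_compat_l; [exact: Rabs_pos|rewrite /M; lra].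
  have Cu' : (Cmod (p + RtoC u * (q - p) - (p + RtoC t * (q - p))) < d)%R.
    apply: Rle_lt_trans Cu _. by apply/Rlt_div_r.
  have := Hd2 _ Cu'. rewrite Cmult_0_l => h.
  rewrite scal_zero_r minus_zero_r -Cmod_norm.
  rewrite Csub_0_r in h. apply: Rle_trans h _.
  apply: Rle_trans.
    apply: Rmult_le_compat_l; last exact: Cu. left. apply: Rdiv_lt_0_compat; [exact: cond_pos|lra].
  right. rewrite /norm /= /abs /= /minus /plus /opp /= /Rminus. field. lra.
have := eq_is_derive (V := C_R_NormedModule) (fun t : R => f (p + RtoC t * (q - p))) 0 1 (fun t _ => h t) Rlt_0_1.
replace (p + 0 * (q - p)) with p by ring. by replace (p + 1 * (q - p)) with q by ring.
Qed.

Lemma exp_coef_series (x : R) : is_series (fun k => / INR (fact k) * x ^ k)%R (exp x).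
Proof.
have := is_exp_Reals x. rewrite /is_pseries. apply: is_series_ext => n.
rewrite /scal /= /mult /= pow_n_pow. ring.
Qed.

(** [Cexp] is defined by real functions, so its series has to be identified. The sum [E] of the
    exponential series satisfies [E' = E], hence [E z * Cexp (- z)] has zero derivative and equals
    its value 1 at 0. *)
Lemma Cexp_expands_0 (r : R) : expands expcoef 0 r Cexp.
Proof.
have Habs : forall w : C, (fun k => Cmod (expcoef k * w ^ k)) =
    (fun k => / INR (fact k) * Cmod w ^ k)%R.
  move=> w. apply: functional_extensionality => k.
  rewrite /expcoef Cmod_mult Cmod_R Cmod_pow Rabs_pos_eq //.
  left. exact: Rinv_0_lt_compat (INR_fact_lt_0 k).
have Hex : forall w : C, exists l, Ctends (Csum (fun k => expcoef k * (w - 0) ^ k)) l.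
  move=> w. apply: (Csum_cv_abs _ (fun k => Cmod (expcoef k * (w - 0) ^ k))) => [k|]; first exact: Rle_refl.
  rewrite Habs. eexists. exact: exp_coef_series.
have [E HE] := functional_choice _ Hex.
have HEr : forall r, expands expcoef 0 r E by move=> r' z _; exact: HE.
have Hder : forall z, is_Cderive E z (E z).
  move=> z. have [l [Hl Hd]] := expands_derive _ _ _ _ z (HEr (Cmod (z - 0) + 1)%R) ltac:(lra).
  have <- : l = E z.
    apply: (Ctends_unique _ _ _ Hl). apply: Ctends_ext (HE z) => n.
    apply: Csum_ext => k _. rewrite /dcoef /expcoef fact_simpl mult_INR Rinv_mult RtoC_mult.
    rewrite (RtoC_inv (INR (S k))); last by apply: not_0_INR.
    field.
    move=> /RtoC_inj. by apply: not_0_INR.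
  exact: Hd.
have Hone : forall z, E z * Cexp (- z) = 1.
  move=> z.
  have E0 : E 0 = 1.
    apply: (Ctends_unique _ _ _ (HE 0)). apply/(Ctends_incr _ _ 1).
    apply: (Ctends_ext (fun _ => 1)); last exact: Ctends_const.
    move=> n. rewrite Nat.add_comm Csum_S_l Csub_diag /expcoef /=.
    rewrite (Csum_ext _ (fun _ => RtoC 0 * 0)); last by move=> k _; ring.
    rewrite Csum_scal Rinv_1. ring.
  have := Cderive_zero_const (fun z => E z * Cexp (- (1) * z + 0)) z 0.
  replace (- (1) * 0 + 0) with (RtoC 0) by ring. rewrite Cexp_0 E0.
  replace (- (1) * z + 0) with (- z) by ring. move=> h. rewrite h; [ring|].
  move=> y. have h1 := is_Cderive_mult _ _ _ _ _ (Hder y)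
    (is_Cderive_affine Cexp (- (1)) 0 y _ ltac:(by move=> /(f_equal fst) /=; lra) (is_Cderive_Cexp _)).
  move: h1. by have -> : E y * Cexp (- (1) * y + 0) + E y * (- (1) * Cexp (- (1) * y + 0)) = 0 by ring.
move=> z Hz. have -> : Cexp z = E z; last exact: HE.
have h := Hone z. rewrite Cexp_opp_inv in h. have hn := Cexp_neq_0 z.
replace (E z) with (E z * / Cexp z * Cexp z) by (field; exact: hn). rewrite h. ring.
Qed.

Lemma Cexp_expands (s : C) (r : R) : expands (fun k => Cexp s * expcoef k) s r Cexp.
Proof.
move=> z Hz. have H := Cexp_expands_0 r (z - s).
rewrite Csub_0_r in H.
have := Ctends_scal (Cexp s) _ _ (H Hz). rewrite -Cexp_plus.
replace (s + (z - s)) with z by ring.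
apply: Ctends_ext => n. rewrite -Csum_scal. apply: Csum_ext => k _. ring.
Qed.

(** The tail is compared with the whole series through [1 / (k + 2)! <= 1 / k!]. This second-order
    bound drives the convergence of both [rgamma_n] and [zeta_n]. *)
Lemma Cexp_quadratic (w : C) : (Cmod (Cexp w - 1 - w) <= Cmod w ^ 2 * exp (Cmod w))%R.
Proof.
have H := Cexp_expands_0 (Cmod (w - 0) + 1) w ltac:(lra).
rewrite Csub_0_r in H.
replace (Cexp w - 1 - w) with (Cexp w - (1 + w)) by ring.
apply: (Ctends_le_bound_loc _ _ _ _ 2 _ H) => n Hn.
have [m ->] : exists m, n = S (S m) by exists (n - 2)%nat; lia.
rewrite !Csum_S_l.
have -> : expcoef 0 * w ^ 0 = 1 by rewrite /expcoef /= Rinv_1; ring.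
have -> : expcoef 1 * w ^ 1 = w by rewrite /expcoef /= Rinv_1; ring.
replace (_ - (1 + w)) with (Csum (fun k => expcoef (S (S k)) * w ^ S (S k)) m) by ring.
apply: Rle_trans.
  apply: (Cmod_Csum_le _ (fun k => Cmod w ^ 2 * (/ INR (fact k) * Cmod w ^ k))%R) => k _.
  rewrite Cmod_mult Cmod_pow /expcoef Cmod_R Rabs_pos_eq; last first.
    left. exact: Rinv_0_lt_compat (INR_fact_lt_0 _).
  have -> : (Cmod w ^ S (S k) = Cmod w ^ 2 * Cmod w ^ k)%R by rewrite /=; ring.
  have h : (/ INR (fact (S (S k))) <= / INR (fact k))%R.
    apply: Rinv_le_contravar; first exact: INR_fact_lt_0.
    apply: le_INR. apply: fact_le. lia.
  have := pow2_ge_0 (Cmod w). have := pow_le _ k (Cmod_ge_0 w) => h1 h2.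
  have h3 := Rmult_le_pos _ _ h2 h1. nra.
rewrite Rsum_scal. apply: Rmult_le_compat_l; first exact: pow2_ge_0.
rewrite -(is_series_unique _ _ (exp_coef_series (Cmod w))).
apply: Rsum_le_Series; last by eexists; exact: exp_coef_series.
move=> k. apply: Rmult_le_pos; last exact: pow_le (Cmod_ge_0 w).
left. exact: Rinv_0_lt_compat (INR_fact_lt_0 _).
Qed.

(** Asking for every centre and every radius at once avoids any theorem on radii of convergence;
    sums, products and locally uniform limits keep this form. *)
Definition entire (f : C -> C) : Prop :=
  forall s r, (0 < r)%R -> exists a, expands a s r f.

Lemma entire_analytic (f : C -> C) (s : C) : entire f -> analytic_at f s.
Proof.
move=> H. apply/analytic_at_expands. have [a Ha] := H s 1%R Rlt_0_1. by exists a, 1%R; split; [lra|].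
Qed.

Lemma entire_ext (f g : C -> C) : (forall z, f z = g z) -> entire f -> entire g.
Proof.
move=> H Hf s r Hr. have [a Ha] := Hf s r Hr. exists a. apply: expands_ext Ha => z _. exact: H.
Qed.

Lemma entire_plus (f g : C -> C) : entire f -> entire g -> entire (fun z => f z + g z).
Proof.
move=> Hf Hg s r Hr. have [a Ha] := Hf s r Hr. have [b Hb] := Hg s r Hr.
eexists. exact: expands_plus Ha Hb.
Qed.

Lemma entire_mult (f g : C -> C) : entire f -> entire g -> entire (fun z => f z * g z).
Proof.
move=> Hf Hg s r Hr. have [a Ha] := Hf s r Hr. have [b Hb] := Hg s r Hr.
eexists. exact: expands_mult Ha Hb.
Qed.

Lemma entire_const (c : C) : entire (fun _ => c).
Proof. move=> s r Hr. eexists. exact: expands_const. Qed.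

Lemma entire_id : entire (fun z => z).
Proof. move=> s r Hr. eexists. exact: expands_id. Qed.

Lemma entire_minus (f g : C -> C) : entire f -> entire g -> entire (fun z => f z - g z).
Proof.
move=> Hf Hg. apply: (entire_ext (fun z => f z + - (1) * g z)); first by move=> z; ring.
apply: entire_plus => //. apply: entire_mult => //. exact: entire_const.
Qed.

Lemma entire_affine (f : C -> C) (c d : C) : entire f -> entire (fun z => f (c * z + d)).
Proof.
move=> Hf. case: (Ceq_dec c 0) => [->|Hc].
  apply: (entire_ext (fun _ => f d)); last exact: entire_const.
  move=> z. f_equal. ring.
move=> s r Hr. have hc : (0 < Cmod c)%R by apply/Cmod_gt_0.
have [a Ha] := Hf (c * s + d) (Cmod c * r)%R ltac:(exact: Rmult_lt_0_compat).
eexists. apply: expands_affine Ha => //. lra.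
Qed.

Lemma entire_Cexp : entire Cexp.
Proof. move=> s r Hr. eexists. exact: Cexp_expands. Qed.

Lemma entire_rising (n : nat) : entire (fun z => rising z n).
Proof.
elim: n => [|n IH] /=; first exact: entire_id.
apply: entire_mult => //. apply: entire_plus; [exact: entire_id|exact: entire_const].
Qed.

Lemma entire_identity (f : C -> C) (p q : C) : entire f ->
  (forall eps, (0 < eps)%R -> exists z, z <> p /\ (Cmod (z - p) < eps)%R /\ f z = 0) ->
  f q = 0.
Proof.
move=> Hf Hz.
have [d [Hd H]] : vanishes_near f q.
  apply: (identity_on_segment f p q).
    move=> t _. exact: entire_analytic.
  apply: analytic_vanishes_near => //. exact: entire_analytic.
apply: H. by rewrite Csub_diag Cmod_0.
Qed.

(** * The reciprocal Gamma function *)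

Definition rgamma_n (n : nat) (z : C) : C :=
  Cexp (- RtoC (ln (INR n)) * z) * (rising z n * RtoC (/ INR (fact n))).

Definition rgamma (z : C) : C := Clim eventually (fun n => rgamma_n n z).

Lemma Clim_eventually (u : nat -> C) (l : C) : Ctends u l -> Clim eventually u = l.
Proof.
move=> /Ctends_filterlim H.
exact: (iota_filterlim_locally (V := C_R_CompleteNormedModule) u l H).
Qed.

Lemma RtoC_neq_0 (x : R) : x <> 0%R -> RtoC x <> 0.
Proof. by move=> h /RtoC_inj. Qed.

Lemma rgamma_n_S (n : nat) (z : C) : (1 <= n)%nat ->
  rgamma_n (S n) z = rgamma_n n z *
    (Cexp (- RtoC (ln (INR (S n)) - ln (INR n)) * z) * (1 + z * RtoC (/ INR (S n)))).
Proof.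
move=> Hn. rewrite /rgamma_n.
have -> : Cexp (- RtoC (ln (INR (S n))) * z) =
   Cexp (- RtoC (ln (INR n)) * z) * Cexp (- RtoC (ln (INR (S n)) - ln (INR n)) * z).
  rewrite -Cexp_plus RtoC_minus. f_equal. ring.
have -> : rising z (S n) = rising z n * (z + RtoC (INR (S n))) by [].
rewrite fact_simpl mult_INR Rinv_mult RtoC_mult.
have h : RtoC (/ INR (S n)) * RtoC (INR (S n)) = 1.
  rewrite -RtoC_mult Rinv_l //. by apply: not_0_INR.
replace (1 + z * RtoC (/ INR (S n))) with
  (RtoC (/ INR (S n)) * RtoC (INR (S n)) + z * RtoC (/ INR (S n))) by (rewrite h; ring).
ring.
Qed.

Lemma ln_succ_bounds (n : nat) : (1 <= n)%nat ->
  (/ INR (S n) <= ln (INR (S n)) - ln (INR n) <= / INR n)%R.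
Proof.
move=> Hn.
have h0 : (0 < INR n)%R by apply: lt_0_INR; lia.
have h1 : (0 < INR (S n))%R by apply: lt_0_INR; lia.
have lnle : forall x : R, (0 < x)%R -> (ln x <= x - 1)%R.
  move=> x Hx. have := exp_ineq1_le (ln x). rewrite exp_ln //. lra.
split.
- have := lnle (INR n / INR (S n))%R ltac:(exact: Rdiv_lt_0_compat).
  rewrite ln_div //.
  have -> : (INR n / INR (S n) - 1 = - / INR (S n))%R by rewrite S_INR; field; rewrite -S_INR; lra.
  lra.
- have := lnle (INR (S n) / INR n)%R ltac:(exact: Rdiv_lt_0_compat).
  rewrite ln_div //.
  have -> : (INR (S n) / INR n - 1 = / INR n)%R by rewrite S_INR; field; lra.
  lra.
Qed.

(** The factor is [1 + O(1 / n^2)] on a disc. The bound is written with [/ INR n - / INR (S n)] in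
    place of [1 / n^2] so that it telescopes. *)
Lemma rgamma_factor_bound (n : nat) (z : C) (B : R) : (1 <= n)%nat -> (Cmod z <= B)%R ->
  (Cmod (Cexp (- RtoC (ln (INR (S n)) - ln (INR n)) * z) * (1 + z * RtoC (/ INR (S n))) - 1)
   <= 2 * (B + B ^ 2 + B ^ 2 * exp B * (1 + B)) * (/ INR n - / INR (S n)))%R.
Proof.
move=> Hn HB.
have [l1 l2] := ln_succ_bounds n Hn. set l := (ln (INR (S n)) - ln (INR n))%R in l1 l2 *.
have h0 : (1 <= INR n)%R by apply: (le_INR 1).
have h1 : (INR (S n) = INR n + 1)%R by exact: S_INR.
set x := (/ INR n)%R. set y := (/ INR (S n))%R. rewrite -/x -/y in l1 l2.
have hx : (0 < x)%R by apply: Rinv_0_lt_compat; lra.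
have hy : (0 < y)%R by apply: Rinv_0_lt_compat; lra.
have hx1 : (x <= 1)%R by rewrite -Rinv_1; apply: Rinv_le_contravar; lra.
have hxy : (x - y = x * y)%R by rewrite /x /y h1; field; lra.
have hx2 : (x ^ 2 <= 2 * (x - y))%R.
  rewrite hxy. have -> : (x ^ 2 = x * x)%R by ring.
  have : (x <= 2 * y)%R; last nra.
  rewrite /x /y h1. apply: (Rmult_le_reg_r (INR n * (INR n + 1))); first nra.
  field_simplify; lra.
have hz := Cmod_ge_0 z.
set e := Cexp (- RtoC l * z) - 1 - (- RtoC l * z).
have hlz : (Cmod (- RtoC l * z) = l * Cmod z)%R.
  rewrite Cmod_mult Cmod_opp Cmod_R Rabs_pos_eq //; lra.
have he : (Cmod e <= B ^ 2 * exp B * x ^ 2)%R.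
  apply: Rle_trans; first exact: Cexp_quadratic. rewrite hlz Rpow_mult_distr.
  have e1 : (exp (l * Cmod z) <= exp B)%R.
    have h : (l * Cmod z <= B)%R by nra.
    case: h => [h|->]; [left; exact: exp_increasing|lra].
  have e2 : (l ^ 2 * Cmod z ^ 2 <= B ^ 2 * x ^ 2)%R.
    rewrite (Rmult_comm (B ^ 2)). apply: Rmult_le_compat; try exact: pow2_ge_0; apply: pow_incr; lra.
  have e3 := exp_pos (l * Cmod z).
  have e4 : (0 <= l ^ 2 * Cmod z ^ 2)%R by apply: Rmult_le_pos; exact: pow2_ge_0.
  apply: (Rle_trans _ (B ^ 2 * x ^ 2 * exp B)); last by right; ring.
  apply: Rmult_le_compat; lra.
(* The first-order terms almost cancel, because [l] lies between [y] and [x]; the other two terms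
   are of second order in [x]. *)
have -> : Cexp (- RtoC l * z) * (1 + z * RtoC y) - 1 =
  z * RtoC (y - l) + (- (z * z) * RtoC (l * y)) + e * (1 + z * RtoC y).
  rewrite /e RtoC_minus RtoC_mult. ring.
have t1 : (Cmod (z * RtoC (y - l)) <= B * (x - y))%R.
  rewrite Cmod_mult Cmod_R. apply: Rmult_le_compat; [exact: hz|exact: Rabs_pos|done|].
  apply: Rabs_le. lra.
have t2 : (Cmod (- (z * z) * RtoC (l * y)) <= B ^ 2 * x ^ 2)%R.
  rewrite Cmod_mult Cmod_opp Cmod_mult Cmod_R Rabs_pos_eq; last by apply: Rmult_le_pos; lra.
  have -> : (B ^ 2 * x ^ 2 = (B * B) * (x * x))%R by ring.
  apply: Rmult_le_compat; [nra|nra|nra|]. apply: Rmult_le_compat; nra.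
have t3 : (Cmod (e * (1 + z * RtoC y)) <= (B ^ 2 * exp B * x ^ 2) * (1 + B))%R.
  rewrite Cmod_mult. apply: Rmult_le_compat; try exact: Cmod_ge_0; first done.
  apply: Rle_trans; first exact: Cmod_triangle.
  rewrite Cmod_1 Cmod_mult Cmod_R Rabs_pos_eq; last lra. nra.
have hB : (0 <= B)%R by lra.
have hEB := exp_pos B.
apply: Rle_trans; first exact: Cmod_triangle.
have := Cmod_triangle (z * RtoC (y - l)) (- (z * z) * RtoC (l * y)).
have p1 : (B ^ 2 * x ^ 2 <= B ^ 2 * (2 * (x - y)))%R.
  apply: Rmult_le_compat_l => //. exact: pow2_ge_0.
have p2 : (B ^ 2 * exp B * x ^ 2 * (1 + B) <= B ^ 2 * exp B * (1 + B) * (2 * (x - y)))%R.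
  have -> : (B ^ 2 * exp B * x ^ 2 * (1 + B) = B ^ 2 * exp B * (1 + B) * x ^ 2)%R by ring.
  apply: Rmult_le_compat_l => //. apply: Rmult_le_pos; last lra.
  apply: Rmult_le_pos; [exact: pow2_ge_0|lra].
have p3 : (0 <= B * (x - y))%R by apply: Rmult_le_pos; nra.
move=> h. nra.
Qed.

(** From [1 + x <= e^x] the relative increments give [|u n| <= |u 1| e^K] for all [n]. With this
    bound the absolute increments telescope. *)
Lemma telescoping_product_bound (u : nat -> C) (K : R) : (0 <= K)%R ->
  (forall n, (1 <= n)%nat -> (Cmod (u (S n) - u n) <= Cmod (u n) * (K * (/ INR n - / INR (S n))))%R) ->
  forall n m, (1 <= n)%nat -> (n <= m)%nat ->
    (Cmod (u m - u n) <= Cmod (u 1%nat) * exp K * K * / INR n)%R.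
Proof.
move=> HK H.
have hinv : forall n, (1 <= n)%nat -> (0 < / INR n <= 1)%R.
  move=> n Hn. have h0 : (1 <= INR n)%R by apply: (le_INR 1).
  split; first by apply: Rinv_0_lt_compat; lra.
  rewrite -Rinv_1; apply: Rinv_le_contravar; lra.
have hdec : forall n, (1 <= n)%nat -> (0 <= / INR n - / INR (S n))%R.
  move=> n Hn. have h0 : (1 <= INR n)%R by apply: (le_INR 1).
  have : (/ INR (S n) <= / INR n)%R; last lra.
  apply: Rinv_le_contravar; first lra. rewrite S_INR; lra.
have Hb : forall n, (1 <= n)%nat -> (Cmod (u n) <= Cmod (u 1%nat) * exp (K * (1 - / INR n)))%R.
  move=> n. elim: n => [|n IH] Hn; first lia.
  case: (Nat.eq_dec n 0) => [->|Hn0].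
    rewrite [INR 1]/= Rinv_1 Rminus_diag Rmult_0_r exp_0. lra.
  have Hn1 : (1 <= n)%nat by lia.
  have h1 : (Cmod (u (S n)) <= Cmod (u n) * (1 + K * (/ INR n - / INR (S n))))%R.
    have := Cmod_triangle (u (S n) - u n) (u n).
    replace (u (S n) - u n + u n) with (u (S n)) by ring. have := H n Hn1. lra.
  have hp : (0 <= K * (/ INR n - / INR (S n)))%R by apply: Rmult_le_pos => //; exact: hdec.
  have he := exp_ineq1_le (K * (/ INR n - / INR (S n))).
  have hI := IH Hn1. have hc := Cmod_ge_0 (u n).
  apply: Rle_trans h1 _.
  have -> : (K * (1 - / INR (S n)) = K * (1 - / INR n) + K * (/ INR n - / INR (S n)))%R by ring.
  rewrite exp_plus -Rmult_assoc. apply: Rmult_le_compat; lra.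
have Hb2 : forall n, (1 <= n)%nat -> (Cmod (u n) <= Cmod (u 1%nat) * exp K)%R.
  move=> n Hn. apply: Rle_trans; first exact: Hb. apply: Rmult_le_compat_l; first exact: Cmod_ge_0.
  have [h2 h3] := hinv n Hn.
  have h : (K * (1 - / INR n) <= K)%R by nra.
  case: h => [h|->]; [left; exact: exp_increasing|lra].
have Ht : forall n m, (1 <= n)%nat -> (n <= m)%nat ->
    (Cmod (u m - u n) <= Cmod (u 1%nat) * exp K * K * (/ INR n - / INR m))%R.
  move=> n m Hn. elim: m => [|m IH] Hm; first lia.
  case: (Nat.eq_dec n (S m)) => [->|Hne].
    rewrite Csub_diag Cmod_0 Rminus_diag; lra.
  have := IH ltac:(lia). have := H m ltac:(lia).
  have := Cmod_dist_triangle (u (S m)) (u m) (u n).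
  have := Rmult_le_compat_r (K * (/ INR m - / INR (S m))) _ _
     ltac:(apply: Rmult_le_pos => //; apply: hdec; lia) (Hb2 m ltac:(lia)).
  lra.
move=> n m Hn Hm. apply: Rle_trans; first exact: Ht.
apply: Rmult_le_compat_l.
  apply: Rmult_le_pos => //. apply: Rmult_le_pos; [exact: Cmod_ge_0|left; exact: exp_pos].
have := hinv m ltac:(lia). lra.
Qed.

Lemma inv_INR_lim : is_lim_seq (fun n => / INR n)%R 0%R.
Proof. have := is_lim_seq_inv _ _ is_lim_seq_INR. by apply. Qed.

Lemma Rinv_INR_lt (eps : R) : (0 < eps)%R ->
  exists N, (1 <= N)%nat /\ forall n, (N <= n)%nat -> (/ INR n < eps)%R.
Proof.
move=> He. have /is_lim_seq_Reals /(_ eps He) [N HN] := inv_INR_lim.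
exists (S N). split; first lia. move=> n Hn. have := HN n ltac:(lia).
rewrite /Rdist Rminus_0_r => /Rabs_def2. lra.
Qed.

Lemma rgamma_n_uniform (B : R) : (0 <= B)%R -> exists K, (0 <= K)%R /\
  forall z n m, (Cmod z <= B)%R -> (1 <= n)%nat -> (n <= m)%nat ->
    (Cmod (rgamma_n m z - rgamma_n n z) <= K * / INR n)%R.
Proof.
move=> HB. pose K := (2 * (B + B ^ 2 + B ^ 2 * exp B * (1 + B)))%R.
have hK : (0 <= K)%R.
  rewrite /K. have := exp_pos B. have h := pow2_ge_0 B => h2.
  have : (0 <= B ^ 2 * exp B * (1 + B))%R; last lra.
  apply: Rmult_le_pos; [apply: Rmult_le_pos|]; lra.
exists (B * (B + 1) * exp K * K)%R. split.
  apply: Rmult_le_pos => //. apply: Rmult_le_pos; [nra|left; exact: exp_pos].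
move=> z n m Hz Hn Hm.
have h := telescoping_product_bound (fun n => rgamma_n n z) K hK _ n m Hn Hm.
apply: Rle_trans; first apply: h.
  move=> j Hj. rewrite rgamma_n_S //.
  replace (_ * _ - rgamma_n j z) with (rgamma_n j z *
   (Cexp (- RtoC (ln (INR (S j)) - ln (INR j)) * z) * (1 + z * RtoC (/ INR (S j))) - 1)) by ring.
  rewrite Cmod_mult. apply: Rmult_le_compat_l; first exact: Cmod_ge_0.
  exact: rgamma_factor_bound.
have h1 : (Cmod (rgamma_n 1 z) <= B * (B + 1))%R.
  have -> : rgamma_n 1 z = z * (z + 1).
    rewrite /rgamma_n /= ln_1 Rinv_1. replace (- 0 * z) with (RtoC 0) by ring. rewrite Cexp_0. ring.
  rewrite Cmod_mult. apply: Rmult_le_compat; try exact: Cmod_ge_0; first done.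
  apply: Rle_trans; first exact: Cmod_triangle. rewrite Cmod_1. lra.
have hn : (0 < / INR n)%R by apply: Rinv_0_lt_compat; apply: lt_0_INR; lia.
apply: Rmult_le_compat_r; first lra. apply: Rmult_le_compat_r => //.
apply: Rmult_le_compat_r => //. left; exact: exp_pos.
Qed.

Lemma rgamma_lim (z : C) : Ctends (fun n => rgamma_n n z) (rgamma z).
Proof.
have [l Hl] : exists l, Ctends (fun n => rgamma_n n z) l; last first.
  by rewrite /rgamma (Clim_eventually _ _ Hl).
have [K [HK H]] := rgamma_n_uniform (Cmod z) (Cmod_ge_0 z).
apply: Ctends_Cauchy => eps He.
have [N [HN1 HN]] := Rinv_INR_lt (eps / (2 * (K + 1)))%R ltac:(apply: Rdiv_lt_0_compat; lra).
exists N => n m Hn Hm.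
have hN := HN N (le_n _).
have h1 := H z N n (Rle_refl _) HN1 Hn. have h2 := H z N m (Rle_refl _) HN1 Hm.
rewrite Cmod_sub_sym in h2.
apply: Rle_trans; first exact: (Cmod_dist_triangle _ (rgamma_n N z)).
have : (K * / INR N <= eps / 2)%R; last lra.
move: hN => /Rlt_div_r hN. have {}hN := hN ltac:(lra).
have : (0 < / INR N)%R by apply: Rinv_0_lt_compat; apply: lt_0_INR; lia. nra.
Qed.

Lemma entire_rgamma : entire rgamma.
Proof.
move=> s r Hr.
pose B := (Cmod s + r)%R. have hB : (0 <= B)%R by rewrite /B; have := Cmod_ge_0 s; lra.
have [K [HK H]] := rgamma_n_uniform B hB.
have [a Ha] : exists a : nat -> nat -> C, forall n, expands (a n) s r (rgamma_n n).
  have h : forall n, exists a, expands a s r (rgamma_n n).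
    move=> n. have he : entire (rgamma_n n); last exact: he.
    apply: entire_mult; last by apply: entire_mult; [exact: entire_rising|exact: entire_const].
    apply: (entire_ext (fun z => Cexp (- RtoC (ln (INR n)) * z + 0))); first by move=> z; f_equal; ring.
    exact: entire_affine entire_Cexp.
  exact: functional_choice h.
apply: (expands_uniform_limit a s r rgamma_n rgamma Hr Ha) => eps He.
have [N [HN1 HN]] := Rinv_INR_lt (eps / (K + 1))%R ltac:(apply: Rdiv_lt_0_compat; lra).
exists N => n z Hn Hz.
have hz : (Cmod z <= B)%R.
  have := Cmod_triangle (z - s) s. replace (z - s + s) with z by ring. rewrite /B. lra.
rewrite Cmod_sub_sym. apply: (Ctends_le_bound_loc _ _ _ _ n _ (rgamma_lim z)) => m Hm.
apply: Rle_trans; first by apply: H => //; lia.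
have hN := HN n Hn. move: hN => /Rlt_div_r hN. have {}hN := hN ltac:(lra).
have : (0 < / INR n)%R by apply: Rinv_0_lt_compat; apply: lt_0_INR; lia. nra.
Qed.

Lemma Gamma_rgamma (z : C) : rgamma z <> 0 -> Gamma z = / rgamma z.
Proof.
move=> Hz. rewrite /Gamma. apply: Clim_eventually.
have := Ctends_inv _ _ Hz (rgamma_lim z).
have hz : (0 < Cmod (rgamma z))%R by apply/Cmod_gt_0.
have [N HN] := proj1 (Ctends_eps _ _) (rgamma_lim z) _ hz.
apply: (Ctends_ext_loc _ _ _ N) => n Hn.
have hn : rgamma_n n z <> 0.
  move=> h. have := HN n Hn. rewrite h. replace (0 - rgamma z) with (- rgamma z) by ring.
  rewrite Cmod_opp. lra.
have hr : rising z n <> 0.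
  move=> h. apply: hn. rewrite /rgamma_n h. ring.
have hf : RtoC (INR (fact n)) <> 0 by apply: RtoC_neq_0; exact: INR_fact_neq_0.
rewrite /rgamma_n /Rcpow RtoC_inv; last exact: INR_fact_neq_0.
replace (- RtoC (ln (INR n)) * z) with (- (z * RtoC (ln (INR n)))) by ring.
rewrite Cexp_opp_inv. have hE := Cexp_neq_0 (z * RtoC (ln (INR n))). field. by repeat split.
Qed.

(** * Partial fractions of coth and the product for sinh *)

Open Scope R_scope.

Definition coth (x : R) : R := cosh x / sinh x.

(** [coth (a + i b) + coth (a - i b)] *)
Definition coth_pair (a b : R) : R := sinh (2 * a) / (sinh a ^ 2 + sin b ^ 2).

Lemma exp_mul_opp (x : R) : exp x * exp (- x) = 1.
Proof. by rewrite -exp_plus Rplus_opp_r exp_0. Qed.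

Lemma sinh_2a (a : R) : sinh (2 * a) = 2 * sinh a * cosh a.
Proof.
rewrite /sinh /cosh. have -> : 2 * a = a + a by ring. rewrite Ropp_plus_distr !exp_plus. field.
Qed.

Lemma cosh2_sinh2 (a : R) : cosh a ^ 2 = 1 + sinh a ^ 2.
Proof. rewrite /sinh /cosh. have := exp_mul_opp a. nra. Qed.

Lemma cosh_2a (a : R) : cosh (2 * a) = 1 + 2 * sinh a ^ 2.
Proof.
rewrite /sinh /cosh. have -> : 2 * a = a + a by ring. rewrite Ropp_plus_distr !exp_plus.
have := exp_mul_opp a. nra.
Qed.

Lemma cosh_pos (x : R) : 0 < cosh x.
Proof. rewrite /cosh. have := exp_pos x. have := exp_pos (- x). lra. Qed.

Lemma sinh_pos (x : R) : 0 < x -> 0 < sinh x.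
Proof. move=> H. rewrite /sinh. have := exp_increasing (- x) x. lra. Qed.

Lemma coth_double (a : R) : 0 < a -> coth (2 * a) = (coth a + sinh a / cosh a) / 2.
Proof.
move=> Ha. have h1 := sinh_pos a Ha. have h2 := cosh_pos a.
rewrite /coth cosh_2a sinh_2a.
have h3 := cosh2_sinh2 a.
have -> : 1 + 2 * sinh a ^ 2 = cosh a ^ 2 + sinh a ^ 2 by rewrite h3; ring.
field. lra.
Qed.

(** The [tanh] term supplies the middle term of the doubled sum, at the angle [PI / 4] that is its
    own mirror image under [b -> PI / 2 - b]. *)
Lemma tanh_double (a : R) : 0 < a -> sinh (2 * a) / cosh (2 * a) = coth_pair a (PI / 4) / 2.
Proof.
move=> Ha. rewrite /coth_pair sin_PI4 cosh_2a.
have h := pow2_ge_0 (sinh a).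
have h2 : sqrt 2 * sqrt 2 = 2 by apply: sqrt_sqrt; lra.
have h3 : sqrt 2 <> 0 by have := sqrt_lt_R0 2; lra.
have -> : (1 / sqrt 2) ^ 2 = / 2.
  have -> : (1 / sqrt 2) ^ 2 = / (sqrt 2 * sqrt 2) by field.
  by rewrite h2.
field. lra.
Qed.

(** The doubling formula of [coth] at [a + i b] added to its conjugate; there [tanh] is [coth]
    shifted by [i PI / 2]. The pairing keeps everything real. *)
Lemma coth_pair_double (a b : R) : 0 < a ->
  coth_pair (2 * a) (2 * b) = (coth_pair a b + coth_pair a (PI / 2 - b)) / 2.
Proof.
move=> Ha. rewrite /coth_pair.
have E1 : sin (PI / 2 - b) = cos b by rewrite sin_shift.
rewrite E1 (sinh_2a (2 * a)) cosh_2a (sin_2a b) (sinh_2a a).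
set S := sinh a. set s := sin b. set c := cos b.
have hS : 0 < S by exact: sinh_pos.
have hC := cosh2_sinh2 a. rewrite -/S in hC.
have hsc : c ^ 2 = 1 - s ^ 2 by have := sin2_cos2 b; rewrite /Rsqr -/s -/c; lra.
have hd1 : 0 < S ^ 2 + s ^ 2 by have := pow2_ge_0 s; have := pow_lt S 2 hS; lra.
have hd2 : 0 < S ^ 2 + c ^ 2 by have := pow2_ge_0 c; have := pow_lt S 2 hS; lra.
have -> : (2 * S * cosh a) ^ 2 + (2 * s * c) ^ 2 = 4 * ((S ^ 2 + s ^ 2) * (S ^ 2 + c ^ 2)).
  have -> : (2 * S * cosh a) ^ 2 = 4 * S ^ 2 * cosh a ^ 2 by ring.
  have -> : (2 * s * c) ^ 2 = 4 * s ^ 2 * c ^ 2 by ring.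
  rewrite hC hsc. ring.
have -> : 1 + 2 * S ^ 2 = (S ^ 2 + s ^ 2) + (S ^ 2 + c ^ 2) by rewrite hsc; ring.
field. lra.
Qed.

Lemma Rsum_S (u : nat -> R) (n : nat) : Rsum u (S n) = Rsum u n + u n.
Proof. by []. Qed.

Lemma Rsum_app (u : nat -> R) (n m : nat) :
  Rsum u (n + m) = Rsum u n + Rsum (fun k => u (n + k)%nat) m.
Proof.
elim: m => [|m IH]; first by rewrite Nat.add_0_r /=; ring.
rewrite Nat.add_succ_r /= IH. ring.
Qed.

Lemma Rsum_S_l (u : nat -> R) (n : nat) : Rsum u (S n) = u O + Rsum (fun k => u (S k)) n.
Proof. elim: n => [|n IH]; [by rewrite /=; ring|]. rewrite [LHS]/= -/(Rsum u (S n)) IH /=. ring. Qed.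

Lemma Rsum_rev (u : nat -> R) (n : nat) : Rsum u n = Rsum (fun k => u (n - S k)%nat) n.
Proof.
elim: n => [//|n IH]. rewrite (Rsum_S_l (fun k => u (S n - S k)%nat)).
have -> : (S n - 1 = n)%nat by lia. rewrite /= IH Rplus_comm. f_equal.
Qed.

(** Euler's expansion of [coth y] over the halved arguments; iterated, its terms
    tend to the partial fractions. *)
Definition coth_sum (M : nat) (y : R) : R :=
  / (2 * INR M) * (coth (y / (2 * INR M)) + sinh (y / (2 * INR M)) / cosh (y / (2 * INR M))
     + Rsum (fun j => coth_pair (y / (2 * INR M)) (INR (S j) * PI / (2 * INR M))) (M - 1)).

Lemma coth_sum_double (M : nat) (y : R) : (1 <= M)%nat -> 0 < y ->
  coth_sum (2 * M) y = coth_sum M y.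
Proof.
move=> HM Hy. rewrite /coth_sum.
have hM : 0 < INR M by apply: lt_0_INR; lia.
have -> : INR (2 * M) = 2 * INR M by rewrite mult_INR.
set a := y / (2 * (2 * INR M)).
have Ea : y / (2 * INR M) = 2 * a by rewrite /a; field; lra.
have ha : 0 < a by apply: Rdiv_lt_0_compat; lra.
rewrite Ea coth_double // tanh_double //.
have -> : (2 * M - 1 = (M - 1) + S (M - 1))%nat by lia.
rewrite Rsum_app Rsum_S_l Nat.add_0_r.
have -> : INR (S (M - 1)) * PI / (2 * (2 * INR M)) = PI / 4.
  have -> : S (M - 1) = M by lia. field. lra.
(* Read backwards, the upper half of the doubled sum consists of the mirror images [PI / 2 - b] of
   the angles in the lower half. *)
rewrite (Rsum_rev (fun k => coth_pair a (INR (S (M - 1 + S k)) * PI / (2 * (2 * INR M))))).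
rewrite (Rsum_ext (fun j => coth_pair (2 * a) (INR (S j) * PI / (2 * INR M)))
  (fun j => / 2 * (coth_pair a (INR (S j) * PI / (2 * (2 * INR M))) +
     coth_pair a (INR (S (M - 1 + S (M - 1 - S j))) * PI / (2 * (2 * INR M)))))); last first.
  move=> j Hj.
  have -> : INR (S j) * PI / (2 * INR M) = 2 * (INR (S j) * PI / (2 * (2 * INR M))) by field; lra.
  rewrite coth_pair_double //.
  have -> : INR (S (M - 1 + S (M - 1 - S j))) * PI / (2 * (2 * INR M)) =
    PI / 2 - INR (S j) * PI / (2 * (2 * INR M)).
    have -> : (S (M - 1 + S (M - 1 - S j)) = 2 * M - S j)%nat by lia.
    rewrite minus_INR; last lia. rewrite mult_INR [INR 2]/=. field. lra.
  field.
rewrite Rsum_scal Rsum_plus. have hc := cosh_pos a. field. lra.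
Qed.

Lemma coth_sum_pow2 (p : nat) (y : R) : 0 < y -> coth_sum (2 ^ p) y = coth y.
Proof.
move=> Hy. elim: p => [|p IH].
- rewrite /coth_sum /=.
  have E : y / (2 * 1) = y / 2 by field. rewrite E.
  have -> : coth y = coth (2 * (y / 2)) by f_equal; field.
  rewrite coth_double; last lra. have hc := cosh_pos (y / 2). field. lra.
- have -> : (2 ^ S p = 2 * 2 ^ p)%nat by []. rewrite coth_sum_double //.
  have : (2 ^ p <> 0)%nat by apply: Nat.pow_nonzero. lia.
Qed.

Lemma lim_scaled_derive (f : R -> R) (l c : R) :
  derivable_pt_lim f 0 l -> f 0 = 0 ->
  is_lim_seq (fun p => 2 ^ p * f (c / 2 ^ p)) (l * c).
Proof.
move=> Hf Hf0. apply/is_lim_seq_Reals => eps He.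
have hc : 0 < Rabs c + 1 by have := Rabs_pos c; lra.
have [d Hd] := Hf (eps / (Rabs c + 1)) ltac:(exact: Rdiv_lt_0_compat).
have [N HN] : exists N, forall n, (N <= n)%nat -> Rabs c / 2 ^ n < d.
  have h : is_lim_seq (fun n => Rabs c * (/ 2) ^ n) (Rabs c * 0).
    apply: is_lim_seq_mult'; first exact: is_lim_seq_const.
    apply: is_lim_seq_geom. rewrite Rabs_pos_eq; lra.
  have /is_lim_seq_Reals /(_ d (cond_pos d)) [N HN] := h.
  exists N => n Hn. have := HN n Hn. rewrite /Rdist Rmult_0_r Rminus_0_r => /Rabs_def2.
  rewrite pow_inv. rewrite /Rdiv. lra.
exists N => n Hn. rewrite /Rdist.
have h2 : 0 < 2 ^ n by apply: pow_lt; lra.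
case: (Req_dec c 0) => [->|Hc].
  rewrite /Rdiv Rmult_0_l Hf0 !Rmult_0_r Rminus_diag Rabs_R0. lra.
have hne : c / 2 ^ n <> 0 by apply: Rmult_integral_contrapositive; split=> //; apply: Rinv_neq_0_compat; lra.
have habs : Rabs (c / 2 ^ n) = Rabs c / 2 ^ n.
  rewrite /Rdiv Rabs_mult (Rabs_pos_eq (/ 2 ^ n)) //. left. exact: Rinv_0_lt_compat.
have := Hd _ hne. rewrite habs Rplus_0_l Hf0 Rminus_0_r => h. have {}h := h (HN n Hn).
have -> : 2 ^ n * f (c / 2 ^ n) - l * c = (f (c / 2 ^ n) / (c / 2 ^ n) - l) * c.
  field. split=> //. lra.
rewrite Rabs_mult. move: h => /Rlt_div_r h. have {}h := h hc.
have := Rabs_pos c. have := Rabs_pos (f (c / 2 ^ n) / (c / 2 ^ n) - l). nra.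
Qed.

Lemma is_lim_seq_inv0 (u : nat -> R) (l : R) : l <> 0 -> is_lim_seq u l -> is_lim_seq (fun n => / u n) (/ l).
Proof. move=> hl H. apply: (is_lim_seq_inv u l H). by move=> [h]. Qed.

Lemma lim_sinh (y : R) : is_lim_seq (fun p => 2 ^ p * sinh (y / 2 ^ p)) y.
Proof.
have H : is_lim_seq (fun p => 2 ^ p * sinh (y / 2 ^ p)) (1 * y); last by rewrite Rmult_1_l in H.
apply: lim_scaled_derive; last exact: sinh_0.
have := derivable_pt_lim_sinh 0. by rewrite cosh_0.
Qed.

Lemma lim_sin (y : R) : is_lim_seq (fun p => 2 ^ p * sin (y / 2 ^ p)) y.
Proof.
have H : is_lim_seq (fun p => 2 ^ p * sin (y / 2 ^ p)) (1 * y); last by rewrite Rmult_1_l in H.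
apply: lim_scaled_derive; last exact: sin_0.
have := derivable_pt_lim_sin 0. by rewrite cos_0.
Qed.

Lemma lim_cosh (y : R) : is_lim_seq (fun p => cosh (y / 2 ^ p)) 1.
Proof.
rewrite -cosh_0. apply: is_lim_seq_continuous.
  apply: derivable_continuous_pt. exists (sinh 0). exact: derivable_pt_lim_cosh.
apply: (is_lim_seq_ext (fun n => y * (/ 2) ^ n)).
  by move=> n; rewrite pow_inv.
have H : is_lim_seq (fun n => y * (/ 2) ^ n) (y * 0); last by rewrite Rmult_0_r in H.
apply: is_lim_seq_mult'; first exact: is_lim_seq_const.
apply: is_lim_seq_geom. rewrite Rabs_pos_eq; lra.
Qed.

(** Since [x cos x <= sin x], one has [sin b = 2 sin (b/2) cos (b/2) >= b cos (b/2)^2], and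
    [cos (b/2)^2 >= 1/2] because [cos b >= 0]. *)
Lemma sin_ge_half (b : R) : 0 <= b <= PI / 2 -> b / 2 <= sin b.
Proof.
move=> Hb. have hpi := PI_RGT_0.
have tan_ge : forall x, 0 <= x <= PI / 4 -> x * cos x <= sin x.
  move=> x Hx. case: (Req_dec x 0) => [->|Hx0]; first by rewrite sin_0; lra.
  have [c [Hc1 Hc2]] := MVT_cor2 (fun t => sin t - t * cos t) (fun t => t * sin t) 0 x ltac:(lra)
    ltac:(move=> t _; apply/is_derive_Reals; auto_derive => //; ring).
  have : 0 <= c * sin c * x.
    apply: Rmult_le_pos; last lra. apply: Rmult_le_pos; first lra. apply: sin_ge_0; lra.
  move: Hc1. rewrite sin_0 Rmult_0_l. lra.
have h := tan_ge (b / 2) ltac:(lra).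
have -> : b = 2 * (b / 2) by field. rewrite sin_2a.
have h1 : 0 <= cos (2 * (b / 2)) by apply: cos_ge_0; lra.
rewrite cos_2a_cos in h1.
have h2 : 0 <= cos (b / 2) by apply: cos_ge_0; lra.
nra.
Qed.

(** The two polar terms of [coth] at [i (k + 1) PI] and [- i (k + 1) PI], added up. *)
Definition phi (y : R) (k : nat) : R := 2 * y / (y ^ 2 + (INR (S k) * PI) ^ 2).

Lemma Rsum_inv_sq (N n : nat) : (1 <= N)%nat ->
  Rsum (fun k => / INR (S (N + k)) ^ 2) n <= / INR N.
Proof.
move=> HN. have h0 : 0 < INR N by apply: lt_0_INR; lia.
have h : Rsum (fun k => / INR (S (N + k)) ^ 2) n <= / INR N - / INR (N + n).
  elim: n => [|n IH]; first by rewrite Nat.add_0_r /=; lra.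
  rewrite Nat.add_succ_r Rsum_S.
  have h1 : 0 < INR (N + n) by apply: lt_0_INR; lia.
  have : / INR (S (N + n)) ^ 2 <= / INR (N + n) - / INR (S (N + n)).
    rewrite S_INR. set x := INR (N + n) in h1 *.
    have -> : / x - / (x + 1) = / (x * (x + 1)) by field; lra.
    apply: Rinv_le_contravar; nra.
  lra.
have : 0 < / INR (N + n); last lra. apply: Rinv_0_lt_compat. apply: lt_0_INR; lia.
Qed.

(** A dominated passage to the limit in [coth_sum_pow2]: the first [N] terms converge one by one to
    those of [phi], and the remaining ones are nonnegative with sum at most [2 * y / N], uniformly
    in [p]. *)
Lemma coth_partial_fractions (y : R) (N : nat) : 0 < y -> (1 <= N)%nat ->
  0 <= coth y - / y - Rsum (phi y) N <= 2 * y / INR N.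
Proof.
move=> Hy HN. have hpi := PI_RGT_0.
pose s := fun p : nat => 2 ^ S p.
have Es : forall p, 2 * INR (2 ^ p) = s p by move=> p; rewrite pow_INR.
have hs : forall p, 0 < s p by move=> p; apply: pow_lt; lra.
have Lsh : is_lim_seq (fun p => s p * sinh (y / s p)) y.
  exact: (proj1 (is_lim_seq_incr_1 (fun p => 2 ^ p * sinh (y / 2 ^ p)) y) (lim_sinh y)).
have Lch : is_lim_seq (fun p => cosh (y / s p)) 1.
  exact: (proj1 (is_lim_seq_incr_1 (fun p => cosh (y / 2 ^ p)) 1) (lim_cosh y)).
have Lsn : forall b, is_lim_seq (fun p => s p * sin (b / s p)) b.
  move=> b. exact: (proj1 (is_lim_seq_incr_1 (fun p => 2 ^ p * sin (b / 2 ^ p)) b) (lim_sin b)).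
have Ls : is_lim_seq (fun p => / s p) 0.
  apply: (is_lim_seq_ext (fun p => (/ 2) ^ S p)); first by move=> p; rewrite pow_inv.
  apply/(is_lim_seq_incr_1 (fun p => (/ 2) ^ p)). apply: is_lim_seq_geom. rewrite Rabs_pos_eq; lra.
pose T := fun p j => / s p * coth_pair (y / s p) (INR (S j) * PI / s p).
have Tform : forall p j, T p j = 2 * (s p * sinh (y / s p)) * cosh (y / s p) /
    ((s p * sinh (y / s p)) ^ 2 + (s p * sin (INR (S j) * PI / s p)) ^ 2).
  move=> p j. rewrite /T /coth_pair sinh_2a. have h := hs p.
  have h2 : 0 < sinh (y / s p) by apply: sinh_pos; exact: Rdiv_lt_0_compat.
  have h3 := pow_lt _ 2 h2. have h4 := pow2_ge_0 (sin (INR (S j) * PI / s p)).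
  have h5 : 0 < sinh (y / s p) ^ 2 + sin (INR (S j) * PI / s p) ^ 2 by lra.
  have h6 := Rmult_lt_0_compat _ _ (pow_lt _ 2 h) h5.
  field. repeat split; lra.
have LT : forall j, is_lim_seq (fun p => T p j) (phi y j).
  move=> j. apply: is_lim_seq_ext; first by move=> p; rewrite Tform.
  rewrite /phi. have -> : 2 * y = 2 * y * 1 by ring.
  have hne : y ^ 2 + (INR (S j) * PI) ^ 2 <> 0.
    have := pow_lt y 2 Hy. have := pow2_ge_0 (INR (S j) * PI). lra.
  apply: is_lim_seq_mult'.
    apply: is_lim_seq_mult' => //. apply: is_lim_seq_mult' => //. exact: is_lim_seq_const.
  apply: is_lim_seq_inv0 => //.
  apply: is_lim_seq_plus'.
    have -> : y ^ 2 = y * y by ring.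
    apply: (is_lim_seq_ext (fun p => (s p * sinh (y / s p)) * (s p * sinh (y / s p)))); first by move=> p; ring.
    exact: is_lim_seq_mult'.
  have -> : (INR (S j) * PI) ^ 2 = (INR (S j) * PI) * (INR (S j) * PI) by ring.
  apply: (is_lim_seq_ext (fun p => (s p * sin (INR (S j) * PI / s p)) * (s p * sin (INR (S j) * PI / s p))));
    first by move=> p; ring.
  exact: is_lim_seq_mult'.
have LS : is_lim_seq (fun p => Rsum (T p) N) (Rsum (phi y) N).
  elim: (N) => [|n IH] /=; first exact: is_lim_seq_const. exact: is_lim_seq_plus'.
have Lcoth : is_lim_seq (fun p => / s p * coth (y / s p)) (/ y).
  apply: (is_lim_seq_ext (fun p => cosh (y / s p) * / (s p * sinh (y / s p)))).
    move=> p. rewrite /coth. have h := hs p.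
    have h2 : 0 < sinh (y / s p) by apply: sinh_pos; exact: Rdiv_lt_0_compat. field. lra.
  have H : is_lim_seq (fun p => cosh (y / s p) * / (s p * sinh (y / s p))) (1 * / y);
    last by rewrite Rmult_1_l in H.
  apply: is_lim_seq_mult' => //. apply: is_lim_seq_inv0 => //. lra.
have Ltanh : is_lim_seq (fun p => / s p * (sinh (y / s p) / cosh (y / s p))) 0.
  apply: (is_lim_seq_ext (fun p => (/ s p * / s p) * (s p * sinh (y / s p)) * / cosh (y / s p))).
    move=> p. have h := hs p. have h2 := cosh_pos (y / s p). field. lra.
  have H : forall u, is_lim_seq u (0 * 0 * y * / 1) -> is_lim_seq u 0 by move=> u; rewrite !Rmult_0_l.
  apply: H. apply: is_lim_seq_mult'; last by apply: is_lim_seq_inv0 => //; lra.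
  apply: is_lim_seq_mult' => //. exact: is_lim_seq_mult'.
pose A := fun p => / s p * coth (y / s p) + / s p * (sinh (y / s p) / cosh (y / s p)) + Rsum (T p) N.
have LA : is_lim_seq A (/ y + 0 + Rsum (phi y) N).
  apply: is_lim_seq_plus' => //. exact: is_lim_seq_plus'.
have Tpos : forall p j, 0 <= T p j.
  move=> p j. rewrite Tform.
  have h2 : 0 < s p * sinh (y / s p).
    apply: Rmult_lt_0_compat; first exact: hs. apply: sinh_pos. exact: Rdiv_lt_0_compat.
  have h3 := cosh_pos (y / s p).
  apply: Rlt_le. apply: Rdiv_lt_0_compat; first nra.
  have := pow_lt _ 2 h2. have := pow2_ge_0 (s p * sin (INR (S j) * PI / s p)). lra.
have Ecoth : forall p, (N <= 2 ^ p - 1)%nat ->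
    coth y - A p = Rsum (fun k => T p (N + k)%nat) (2 ^ p - 1 - N).
  move=> p Hp. rewrite -{1}(coth_sum_pow2 p y Hy) /coth_sum Es /A.
  have -> : (2 ^ p - 1 = N + (2 ^ p - 1 - N))%nat by lia.
  rewrite Rsum_app.
  have -> : (N + (2 ^ p - 1 - N) - N = 2 ^ p - 1 - N)%nat by lia.
  rewrite /T !Rsum_scal. ring.
(* The numerator in [Tform] tends to [2 * y]; from some rank on it is below twice that. *)
have Hev : exists P, forall p, (P <= p)%nat ->
    (N <= 2 ^ p - 1)%nat /\ 2 * (s p * sinh (y / s p)) * cosh (y / s p) <= 4 * y.
  have L : is_lim_seq (fun p => 2 * (s p * sinh (y / s p)) * cosh (y / s p)) (2 * y * 1).
    apply: is_lim_seq_mult' => //. apply: is_lim_seq_mult' => //. exact: is_lim_seq_const.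
  have /is_lim_seq_Reals /(_ (2 * y) ltac:(lra)) [P HP] := L.
  exists (P + N)%nat => p Hp. split.
    have h1 : (p < 2 ^ p)%nat by apply: Nat.pow_gt_lin_r; lia. lia.
  have := HP p ltac:(lia). rewrite /Rdist => /Rabs_def2. lra.
have [P HP] := Hev.
have Hbd : forall p, (P <= p)%nat -> 0 <= coth y - A p <= 2 * y / INR N.
  move=> p Hp. have [Hp1 Hp2] := HP p Hp. rewrite (Ecoth p Hp1). split.
    by apply: Rsum_nonneg.
  (* The angle is at most [PI / 2] because [2 * K <= s p], so [sin_ge_half] applies. With [PI > 3]
     the denominator is at least [2 * K^2], and [4 y / (2 K^2) = 2 y / K^2]. *)
  have Tb : forall k, (k < 2 ^ p - 1 - N)%nat -> T p (N + k)%nat <= 2 * y * / INR (S (N + k)) ^ 2.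
    move=> k Hk. rewrite Tform.
    set K := S (N + k). have hK : 1 <= INR K by apply: (le_INR 1); rewrite /K; lia.
    have hKs : 2 * INR K <= s p.
      rewrite -Es. have := le_INR K (2 ^ p) ltac:(rewrite /K; lia). lra.
    have hb : INR K * PI / s p / 2 <= sin (INR K * PI / s p).
      apply: sin_ge_half. have h := hs p. split.
        apply: Rdiv_le_0_compat => //. nra.
      apply/Rle_div_l => //. nra.
    have hb2 : INR K * PI / 2 <= s p * sin (INR K * PI / s p).
      have h := hs p. have := Rmult_le_compat_l _ _ _ (Rlt_le _ _ h) hb.
      have -> : s p * (INR K * PI / s p / 2) = INR K * PI / 2 by field; lra. done.
    have hpi3 : 3 < PI by have := PI2_3_2; lra.
    have hb3 : 2 * INR K ^ 2 <= (s p * sinh (y / s p)) ^ 2 + (s p * sin (INR K * PI / s p)) ^ 2.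
      have := pow2_ge_0 (s p * sinh (y / s p)).
      have : (INR K * PI / 2) ^ 2 <= (s p * sin (INR K * PI / s p)) ^ 2 by apply: pow_incr; nra.
      have : 2 * INR K ^ 2 <= (INR K * PI / 2) ^ 2; last lra.
      have -> : (INR K * PI / 2) ^ 2 = INR K ^ 2 * (PI ^ 2 / 4) by field.
      rewrite (Rmult_comm 2). apply: Rmult_le_compat_l; first exact: pow2_ge_0. nra.
    have hK2 : 0 < INR K ^ 2 by apply: pow_lt; lra.
    apply: (Rle_trans _ (4 * y * / (2 * INR K ^ 2))); last by right; field; lra.
    apply: Rmult_le_compat => //.
      have h2 : 0 < s p * sinh (y / s p).
        apply: Rmult_lt_0_compat; first exact: hs. apply: sinh_pos. exact: Rdiv_lt_0_compat.
      have h3 := cosh_pos (y / s p). nra.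
      left. apply: Rinv_0_lt_compat. lra.
    apply: Rinv_le_contravar; lra.
  apply: Rle_trans; first exact: Rsum_le Tb.
  rewrite Rsum_scal. apply: Rmult_le_compat_l; first lra. exact: Rsum_inv_sq.
have LcA : is_lim_seq (fun p => coth y - A p) (coth y - (/ y + 0 + Rsum (phi y) N)).
  apply: is_lim_seq_minus' => //. exact: is_lim_seq_const.
have -> : coth y - / y - Rsum (phi y) N = coth y - (/ y + 0 + Rsum (phi y) N) by ring.
split.
- apply: (is_lim_seq_le_loc (fun _ => 0) _ 0 _ _ (is_lim_seq_const 0) LcA).
  exists P => p Hp. exact: (proj1 (Hbd p Hp)).
- apply: (is_lim_seq_le_loc _ (fun _ => 2 * y / INR N) _ (2 * y / INR N) _ LcA (is_lim_seq_const _)).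
  exists P => p Hp. exact: (proj2 (Hbd p Hp)).
Qed.

Fixpoint Rprod (u : nat -> R) (n : nat) : R :=
  match n with O => 1 | S m => Rprod u m * u m end.

Lemma Rprod_exp (u : nat -> R) (n : nat) : (forall k, 0 < u k) ->
  Rprod u n = exp (Rsum (fun k => ln (u k)) n).
Proof.
move=> H. elim: n => [|n IH] /=; first by rewrite exp_0.
by rewrite exp_plus exp_ln // IH.
Qed.

Definition sinh_log (N : nat) (y : R) : R :=
  Rsum (fun k => ln (1 + y ^ 2 / (INR (S k) * PI) ^ 2)) N.

Lemma Sk_PI_pos (k : nat) : 0 < (INR (S k) * PI) ^ 2.
Proof. apply: pow_lt. apply: Rmult_lt_0_compat; [apply: lt_0_INR; lia|exact: PI_RGT_0]. Qed.

Lemma sinh_log_derive (N : nat) (y : R) : is_derive (sinh_log N) y (Rsum (phi y) N).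
Proof.
elim: N => [|N IH].
  apply: (is_derive_const (K := R_AbsRing) (V := R_NormedModule) 0).
apply: (is_derive_plus (K := R_AbsRing) (V := R_NormedModule)); first exact: IH.
have h := Sk_PI_pos N. set c := (INR (S N) * PI) ^ 2 in h *.
have hy := pow2_ge_0 y.
have hc : 0 < 1 + y ^ 2 / c.
  have : 0 <= y ^ 2 / c by apply: Rdiv_le_0_compat. lra.
auto_derive; first exact: hc. rewrite /phi -/c. field.
repeat split; lra.
Qed.

(** The bounds of [coth_partial_fractions] are integrated from 0 to [y] by the mean value theorem:
    [F] has that remainder as its derivative and tends to 0 along [y / 2 ^ n]. *)
Lemma sinh_log_bound (N : nat) (y : R) : 0 < y -> (1 <= N)%nat ->
  0 <= ln (sinh y / y) - sinh_log N y <= 2 * y ^ 2 / INR N.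
Proof.
move=> Hy HN. have hN : 0 < INR N by apply: lt_0_INR; lia.
pose F := fun x => ln (sinh x) - ln x - sinh_log N x.
have HF : forall x, 0 < x -> is_derive F x (coth x - / x - Rsum (phi x) N).
  move=> x Hx. have hs := sinh_pos x Hx.
  apply: (is_derive_minus (K := R_AbsRing) (V := R_NormedModule)); last exact: sinh_log_derive.
  apply: (is_derive_minus (K := R_AbsRing) (V := R_NormedModule)); last first.
    apply/is_derive_Reals. exact: derivable_pt_lim_ln.
  rewrite /coth /Rdiv.
  apply: (is_derive_comp (K := R_AbsRing) (V := R_NormedModule) ln sinh).
    apply/is_derive_Reals. exact: derivable_pt_lim_ln.
  apply/is_derive_Reals. exact: derivable_pt_lim_sinh.
have Hinc : forall e, 0 < e < y -> 0 <= F y - F e <= 2 * y ^ 2 / INR N.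
  move=> e He.
  have [c [Hc1 Hc2]] := MVT_cor2 F (fun x => coth x - / x - Rsum (phi x) N) e y ltac:(lra)
    ltac:(move=> x Hx; apply/is_derive_Reals; apply: HF; lra).
  rewrite Hc1. have [h1 h2] := coth_partial_fractions c N ltac:(lra) HN.
  split; first by apply: Rmult_le_pos; lra.
  have h3 : 2 * c / INR N <= 2 * y / INR N.
    apply: Rmult_le_compat_r; [left; exact: Rinv_0_lt_compat|lra].
  have -> : 2 * y ^ 2 / INR N = 2 * y / INR N * y by field; lra.
  apply: Rmult_le_compat; lra.
have Lip : is_lim_seq (fun n => y / 2 ^ n) 0.
  apply: (is_lim_seq_ext (fun n => y * (/ 2) ^ n)); first by move=> n; rewrite pow_inv.
  have H : is_lim_seq (fun n => y * (/ 2) ^ n) (y * 0); last by rewrite Rmult_0_r in H.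
  apply: is_lim_seq_mult'; first exact: is_lim_seq_const.
  apply: is_lim_seq_geom. rewrite Rabs_pos_eq; lra.
have LF : is_lim_seq (fun n => F (y / 2 ^ n)) 0.
  have L1 : is_lim_seq (fun n => sinh (y / 2 ^ n) / (y / 2 ^ n)) 1.
    apply: (is_lim_seq_ext (fun n => / y * (2 ^ n * sinh (y / 2 ^ n)))).
      move=> n. have : 0 < 2 ^ n by apply: pow_lt; lra. move=> h. field. lra.
    have H : is_lim_seq (fun n => / y * (2 ^ n * sinh (y / 2 ^ n))) (/ y * y); last by (rewrite Rinv_l in H; [exact: H|lra]).
    apply: is_lim_seq_mult'; [exact: is_lim_seq_const|exact: lim_sinh].
  have L2 : is_lim_seq (fun n => ln (sinh (y / 2 ^ n) / (y / 2 ^ n))) 0.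
    rewrite -ln_1. apply: is_lim_seq_continuous => //.
    apply: derivable_continuous_pt. exists (/ 1). apply: derivable_pt_lim_ln. lra.
  have L3 : is_lim_seq (fun n => sinh_log N (y / 2 ^ n)) 0.
    have -> : 0 = sinh_log N 0.
      rewrite /sinh_log. elim: (N) => [//|m IH] /=. rewrite -IH.
      have -> : 1 + 0 * (0 * 1) / (INR (S m) * PI * (INR (S m) * PI * 1)) = 1 by rewrite /Rdiv !Rmult_0_l Rplus_0_r.
      rewrite ln_1. ring.
    apply: is_lim_seq_continuous => //.
    apply: derivable_continuous_pt. exists (Rsum (phi 0) N). apply/is_derive_Reals. exact: sinh_log_derive.
  apply: (is_lim_seq_ext (fun n => ln (sinh (y / 2 ^ n) / (y / 2 ^ n)) - sinh_log N (y / 2 ^ n))).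
    move=> n. rewrite /F ln_div //; last by apply: Rdiv_lt_0_compat => //; apply: pow_lt; lra.
    apply: sinh_pos. apply: Rdiv_lt_0_compat => //; apply: pow_lt; lra.
  have H := is_lim_seq_minus' _ _ _ _ L2 L3. by rewrite Rminus_0_r in H.
have LD : is_lim_seq (fun n => F y - F (y / 2 ^ n)) (F y - 0).
  apply: is_lim_seq_minus' => //. exact: is_lim_seq_const.
have EF : ln (sinh y / y) - sinh_log N y = F y - 0.
  rewrite /F ln_div //; [ring|exact: sinh_pos].
rewrite EF.
have Hb : forall n, (1 <= n)%nat -> 0 <= F y - F (y / 2 ^ n) <= 2 * y ^ 2 / INR N.
  move=> n Hn. apply: Hinc.
  have h : 1 < 2 ^ n by apply: Rlt_pow_R1; [lra|lia].
  split; first by apply: Rdiv_lt_0_compat; lra.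
  apply/Rlt_div_l; nra.
split.
- apply: (is_lim_seq_le_loc (fun _ => 0) _ 0 _ _ (is_lim_seq_const 0) LD).
  exists 1%nat => n Hn. exact: (proj1 (Hb n Hn)).
- apply: (is_lim_seq_le_loc _ (fun _ => 2 * y ^ 2 / INR N) _ (2 * y ^ 2 / INR N) _ LD (is_lim_seq_const _)).
  exists 1%nat => n Hn. exact: (proj2 (Hb n Hn)).
Qed.

Lemma sinh_product (y : R) : 0 < y ->
  is_lim_seq (Rprod (fun k => 1 + y ^ 2 / (INR (S k) * PI) ^ 2)) (sinh y / y).
Proof.
move=> Hy.
have hpos : forall k, 0 < 1 + y ^ 2 / (INR (S k) * PI) ^ 2.
  move=> k. have := Sk_PI_pos k => h.
  have : 0 <= y ^ 2 / (INR (S k) * PI) ^ 2 by apply: Rdiv_le_0_compat => //; exact: pow2_ge_0. lra.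
apply: (is_lim_seq_ext (fun n => exp (sinh_log n y))).
  move=> n. by rewrite Rprod_exp.
have hs : 0 < sinh y / y by apply: Rdiv_lt_0_compat => //; exact: sinh_pos.
rewrite -(exp_ln _ hs). apply: is_lim_seq_continuous.
  apply: derivable_continuous_pt. exact: derivable_pt_exp.
have L0 : is_lim_seq (fun n => ln (sinh y / y) - sinh_log n y) 0.
  apply: (is_lim_seq_le_le_loc (fun _ => 0) _ (fun n => 2 * y ^ 2 * / INR n)).
  - exists 1%nat => n Hn. exact: sinh_log_bound.
  - exact: is_lim_seq_const.
  - have H : is_lim_seq (fun n => 2 * y ^ 2 * / INR n) (2 * y ^ 2 * 0); last by rewrite Rmult_0_r in H.
    apply: is_lim_seq_mult'; first exact: is_lim_seq_const.
    have := is_lim_seq_inv _ _ is_lim_seq_INR. by apply.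
have := is_lim_seq_minus' _ _ _ _ (is_lim_seq_const (ln (sinh y / y))) L0.
rewrite Rminus_0_r. apply: is_lim_seq_ext => n. ring.
Qed.

(** The function [q] of the overview: the Bose-Einstein kernel without its pole at 0. Up to the
    constant [1 / 2] it is [coth (x / 2) / 2 - 1 / x], whence its partial fractions. *)
Definition bose (x : R) : R := / (exp x - 1) - / x.

Definition bose_term (x : R) (k : nat) : R := 2 * x / (x ^ 2 + (2 * PI * INR (S k)) ^ 2).

Lemma bose_partial_fractions (x : R) : 0 < x -> is_lim_seq (Rsum (bose_term x)) (bose x + / 2).
Proof.
move=> Hx.
have E1 : bose x + / 2 = (coth (x / 2) - / (x / 2)) / 2.
  rewrite /bose /coth /cosh /sinh.
  have Ee : exp x = exp (x / 2) * exp (x / 2) by rewrite -exp_plus; f_equal; field.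
  have h := exp_mul_opp (x / 2). have h1 : 1 < exp (x / 2) by rewrite -exp_0; apply: exp_increasing; lra.
  have -> : exp (- (x / 2)) = / exp (x / 2) by rewrite exp_Ropp.
  rewrite Ee. set t := exp (x / 2) in h1 *. have h2 : 1 < t * t by nra.
  field. repeat split; try lra; nra.
have E2 : forall n, Rsum (bose_term x) n = Rsum (phi (x / 2)) n / 2.
  move=> n. rewrite /Rdiv Rmult_comm -Rsum_scal. apply: Rsum_ext => k _.
  rewrite /bose_term /phi. have h := Sk_PI_pos k. have h1 := pow_lt x 2 Hx.
  have -> : (2 * PI * INR (S k)) ^ 2 = 4 * (INR (S k) * PI) ^ 2 by ring.
  field. lra.
rewrite E1. apply: (is_lim_seq_ext (fun n => (coth (x / 2) - / (x / 2)) / 2 - (coth (x / 2) - / (x / 2) - Rsum (phi (x / 2)) n) / 2)).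
  move=> n. rewrite E2. field. lra.
have L0 : is_lim_seq (fun n => (coth (x / 2) - / (x / 2) - Rsum (phi (x / 2)) n) / 2) 0.
  apply: (is_lim_seq_le_le_loc (fun _ => 0) _ (fun n => x * / INR n)).
  - exists 1%nat => n Hn. have := coth_partial_fractions (x / 2) n ltac:(lra) Hn.
    have h : 0 < / INR n by apply: Rinv_0_lt_compat; apply: lt_0_INR; lia.
    have -> : 2 * (x / 2) / INR n = x * / INR n by field; apply: not_0_INR; lia.
    have := Rmult_lt_0_compat _ _ Hx h. lra.
  - exact: is_lim_seq_const.
  - have H : is_lim_seq (fun n => x * / INR n) (x * 0); last by rewrite Rmult_0_r in H.
    apply: is_lim_seq_mult'; first exact: is_lim_seq_const.
    have := is_lim_seq_inv _ _ is_lim_seq_INR. by apply.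
have := is_lim_seq_minus' _ _ _ _ (is_lim_seq_const ((coth (x / 2) - / (x / 2)) / 2)) L0.
by rewrite Rminus_0_r.
Qed.

(** * Reflection and duplication *)

Open Scope C_scope.

Lemma Ctends_rgamma_mult (z w : C) :
  Ctends (fun n => rgamma_n n z * rgamma_n n w) (rgamma z * rgamma w).
Proof. apply: Ctends_mult; exact: rgamma_lim. Qed.

(** For [z = i t] the factors pair up as [(k + z) (k - z) = k^2 + t^2]. The shift from [- z] to
    [1 - z] leaves [z] and [n + 1 - z] unpaired. *)
Lemma rising_reflect (t : R) (n : nat) :
  rising (RtoC t * Ci) n * rising (1 - RtoC t * Ci) n =
  RtoC t * Ci * (RtoC (INR (S n)) - RtoC t * Ci) * RtoC (INR (fact n)) ^ 2 *
  RtoC (Rprod (fun k => 1 + t ^ 2 / INR (S k) ^ 2)%R n).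
Proof.
set z := RtoC t * Ci.
have Hz : z * z = - RtoC (t ^ 2).
  rewrite /z RtoC_pow. replace (RtoC t * Ci * (RtoC t * Ci)) with (RtoC t ^ 2 * (Ci * Ci)) by ring.
  have -> : Ci * Ci = - (1) by apply: injective_projections => /=; ring. ring.
elim: n => [|n IH]; first by rewrite /=; ring.
have -> : rising z (S n) = rising z n * (z + RtoC (INR (S n))) by [].
have -> : rising (1 - z) (S n) = rising (1 - z) n * (1 - z + RtoC (INR (S n))) by [].
have -> : rising z n * (z + RtoC (INR (S n))) * (rising (1 - z) n * (1 - z + RtoC (INR (S n)))) =
  (rising z n * rising (1 - z) n) * ((z + RtoC (INR (S n))) * (1 - z + RtoC (INR (S n)))) by ring.
rewrite IH fact_simpl mult_INR.
have -> : Rprod (fun k => 1 + t ^ 2 / INR (S k) ^ 2)%R (S n) =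
  (Rprod (fun k => 1 + t ^ 2 / INR (S k) ^ 2) n * (1 + t ^ 2 / INR (S n) ^ 2))%R by [].
rewrite RtoC_mult (RtoC_mult (Rprod _ _)).
rewrite (S_INR (S n)).
set N := INR (S n). have hN : N <> 0%R by apply: not_0_INR.
have -> : RtoC (1 + t ^ 2 / N ^ 2) = (RtoC N ^ 2 - z * z) / RtoC N ^ 2.
  rewrite Hz RtoC_plus RtoC_div; last by apply: pow_nonzero.
  rewrite (RtoC_pow N). field. exact: RtoC_neq_0.
rewrite RtoC_plus.
set P := RtoC (Rprod _ _). set F := RtoC (INR (fact n)). field. exact: RtoC_neq_0.
Qed.

Lemma rgamma_reflect_imag (y : R) : (0 < y)%R ->
  rgamma (RtoC (y / PI) * Ci) * rgamma (1 - RtoC (y / PI) * Ci) = RtoC (sinh y / PI) * Ci.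
Proof.
move=> Hy. set t := (y / PI)%R. set z := RtoC t * Ci. have hpi := PI_RGT_0.
apply: (Ctends_unique _ _ _ (Ctends_rgamma_mult _ _)).
have L1 : Ctends (fun n => RtoC (Rprod (fun k => 1 + t ^ 2 / INR (S k) ^ 2)%R n)) (RtoC (sinh y / y)).
  apply: (proj1 (Ctends_RtoC _ _)). apply: (is_lim_seq_ext (Rprod (fun k => 1 + y ^ 2 / (INR (S k) * PI) ^ 2)%R)); last exact: (sinh_product y Hy). move=> n.
  elim: n => [//|n IH]. rewrite [LHS]/= [RHS]/= IH. f_equal. f_equal. rewrite /t.
  have h : (0 < INR (S n))%R by apply: lt_0_INR; lia.
  rewrite -/(INR (S n)). field. lra.
(* This is the unpaired factor [n + 1 - z] divided by [n]; the two powers of [n] multiply to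
   [1 / n]. *)
have L2 : Ctends (fun n => 1 + (1 - z) * RtoC (/ INR n)) (1 + (1 - z) * RtoC 0).
  apply: Ctends_plus; first exact: Ctends_const. apply: Ctends_scal. apply: (proj1 (Ctends_RtoC _ _)). exact: inv_INR_lim.
have L3 := Ctends_mult _ _ _ _ (Ctends_scal z _ _ L2) L1.
have E : z * (1 + (1 - z) * 0) * RtoC (sinh y / y) = RtoC (sinh y / PI) * Ci.
  rewrite /z /t !RtoC_div; try lra. field. split; apply: RtoC_neq_0; lra.
rewrite E in L3. apply: (Ctends_ext_loc _ _ _ 1 _ L3) => n Hn.
have hn : (0 < INR n)%R by apply: lt_0_INR; lia.
rewrite /rgamma_n.
have hE : Cexp (- RtoC (ln (INR n)) * z) * Cexp (- RtoC (ln (INR n)) * (1 - z)) = RtoC (/ INR n).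
  rewrite -Cexp_plus. replace (_ + _) with (RtoC (- ln (INR n))) by (rewrite RtoC_opp; ring).
  by rewrite Cexp_RtoC exp_Ropp exp_ln.
replace (Cexp (- RtoC (ln (INR n)) * z) * (rising z n * RtoC (/ INR (fact n))) *
   (Cexp (- RtoC (ln (INR n)) * (1 - z)) * (rising (1 - z) n * RtoC (/ INR (fact n))))) with
   ((Cexp (- RtoC (ln (INR n)) * z) * Cexp (- RtoC (ln (INR n)) * (1 - z))) *
    (rising z n * rising (1 - z) n) * RtoC (/ INR (fact n)) ^ 2) by ring.
rewrite hE (rising_reflect t n) -/z S_INR RtoC_plus.
have hf : INR (fact n) <> 0%R by exact: INR_fact_neq_0.
rewrite !RtoC_inv //; try lra.
set P := RtoC (Rprod _ _). field. split; apply: RtoC_neq_0 => //; lra.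
Qed.

Lemma Csin_imag (y : R) : Csin (RtoC y * Ci) = RtoC (sinh y) * Ci.
Proof.
rewrite /Csin.
replace (Ci * (RtoC y * Ci)) with (RtoC (- y)).
  replace (- RtoC (- y)) with (RtoC y) by (rewrite RtoC_opp; ring).
  rewrite !Cexp_RtoC /sinh. apply: injective_projections => /=; field.
rewrite RtoC_opp. apply: injective_projections => /=; ring.
Qed.

Lemma entire_Csin : entire Csin.
Proof.
apply: (entire_ext (fun z => (Cexp (Ci * z + 0) - Cexp (- Ci * z + 0)) * (/ (2 * Ci)))).
  move=> z. rewrite /Csin /Cdiv. f_equal. f_equal; [f_equal; ring|f_equal; f_equal; ring].
apply: entire_mult; last exact: entire_const.
apply: entire_minus; exact: entire_affine entire_Cexp.
Qed.

Lemma rgamma_reflection (z : C) : rgamma z * rgamma (1 - z) = Csin (RtoC PI * z) / RtoC PI.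
Proof.
have hpi := PI_RGT_0. have hpiC : RtoC PI <> 0 by apply: RtoC_neq_0; lra.
pose f := fun z => rgamma z * rgamma (- (1) * z + 1) - Csin (RtoC PI * z + 0) * (/ RtoC PI).
have Ef : f z = 0.
  apply: (entire_identity f 0 z).
    apply: entire_minus; apply: entire_mult; [exact: entire_rgamma|exact: entire_affine entire_rgamma|exact: entire_affine entire_Csin|exact: entire_const].
  move=> eps He. pose y := (eps * PI / 2)%R.
  have Hy : (0 < y)%R by rewrite /y; nra.
  have Ey : (y / PI = eps / 2)%R by rewrite /y; field; lra.
  exists (RtoC (y / PI) * Ci). split.
    apply: Cmult_neq_0; first by apply: RtoC_neq_0; lra. move=> /(f_equal snd) /=; lra.
  split.
    replace (RtoC (y / PI) * Ci - 0) with (RtoC (y / PI) * Ci) by ring.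
    rewrite Cmod_mult Cmod_Ci Cmod_R Rabs_pos_eq; lra.
  rewrite /f. replace (- (1) * (RtoC (y / PI) * Ci) + 1) with (1 - RtoC (y / PI) * Ci) by ring.
  rewrite rgamma_reflect_imag //.
  replace (RtoC PI * (RtoC (y / PI) * Ci) + 0) with (RtoC y * Ci); last first.
    rewrite RtoC_div; last lra. field. done.
  rewrite Csin_imag RtoC_div; last lra. field. done.
move: Ef. rewrite /f. replace (- (1) * z + 1) with (1 - z) by ring.
replace (RtoC PI * z + 0) with (RtoC PI * z) by ring. move=> h.
replace (rgamma z * rgamma (1 - z)) with
  (rgamma z * rgamma (1 - z) - Csin (RtoC PI * z) * / RtoC PI + Csin (RtoC PI * z) * / RtoC PI) by ring.
rewrite h. rewrite /Cdiv. ring.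
Qed.

(** Off the integers the Gamma factors and [chi] have neither zeros nor poles. The condition is open
    and passes from [s] to [1 - s] and to [s / 2]. *)
Definition nonint (z : C) : Prop := forall k : Z, z <> RtoC (IZR k).

Lemma Csin_PI_neq_0 (z : C) : nonint z -> Csin (RtoC PI * z) <> 0.
Proof.
move=> Hz H. have hpi := PI_RGT_0.
have h2i : 2 * Ci <> 0 by apply: Cmult_neq_0; [apply: RtoC_neq_0; lra|move=> /(f_equal snd) /=; lra].
have H1 : Cexp (Ci * (RtoC PI * z)) = Cexp (- (Ci * (RtoC PI * z))).
  have E : Cexp (Ci * (RtoC PI * z)) - Cexp (- (Ci * (RtoC PI * z))) = 0.
    replace (Cexp (Ci * (RtoC PI * z)) - Cexp (- (Ci * (RtoC PI * z)))) with
      (Csin (RtoC PI * z) * (2 * Ci)) by (rewrite /Csin /Cdiv -Cmult_assoc Cinv_l; [ring|exact: h2i]).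
    rewrite H. ring.
  replace (Cexp (Ci * (RtoC PI * z))) with (Cexp (Ci * (RtoC PI * z)) - Cexp (- (Ci * (RtoC PI * z)))
    + Cexp (- (Ci * (RtoC PI * z)))) by ring. rewrite E. ring.
have H2 : Cexp (2 * (Ci * (RtoC PI * z))) = 1.
  replace (2 * (Ci * (RtoC PI * z))) with (Ci * (RtoC PI * z) + Ci * (RtoC PI * z)) by ring.
  by rewrite Cexp_plus {2}H1 Cexp_opp.
have Hre : Re (2 * (Ci * (RtoC PI * z))) = (- (2 * PI * Im z))%R by rewrite /Re /Im /=; ring.
have Him : Im (2 * (Ci * (RtoC PI * z))) = (2 * (PI * Re z))%R by rewrite /Re /Im /=; ring.
have H3 : Im z = 0%R.
  have := f_equal Cmod H2. rewrite Cmod_Cexp Hre Cmod_1 -exp_0 => /exp_inv h. nra.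
have H4 : cos (2 * (PI * Re z)) = 1%R.
  have := f_equal fst H2. rewrite /Cexp Hre Him H3 Rmult_0_r Ropp_0 exp_0 /=. lra.
have H5 : sin (PI * Re z) = 0%R by rewrite cos_2a_sin in H4; nra.
have [k Hk] := sin_eq_0_0 _ H5.
apply: (Hz k). apply: injective_projections => /=; last exact: H3.
apply: (Rmult_eq_reg_l PI); last lra. rewrite -/(Re z) Hk. ring.
Qed.

Lemma rgamma_neq_0 (z : C) : nonint z -> rgamma z <> 0.
Proof.
move=> Hz H. have hpi := PI_RGT_0. apply: (Csin_PI_neq_0 z Hz).
have := rgamma_reflection z. rewrite H Cmult_0_l => h.
replace (Csin (RtoC PI * z)) with (Csin (RtoC PI * z) / RtoC PI * RtoC PI) by (field; apply: RtoC_neq_0; lra).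
rewrite -h. ring.
Qed.

(** Doubling each of the [2 (n + 1)] factors on the left gives the even and the odd factors of the
    product on the right. *)
Lemma rising_duplication (z : C) (n : nat) :
  rising z n * rising (z + / 2) n * RtoC (4 ^ S n) = rising (2 * z) (S (2 * n)).
Proof.
elim: n => [|n IH]; first by rewrite /= Rmult_1_r; field; apply: RtoC_neq_0; lra.
have -> : (S (2 * S n) = S (S (S (2 * n))))%nat by lia.
have -> : rising (2 * z) (S (S (S (2 * n)))) = rising (2 * z) (S (2 * n)) *
   (2 * z + RtoC (INR (S (S (2 * n))))) * (2 * z + RtoC (INR (S (S (S (2 * n)))))) by [].
rewrite -IH.
have -> : rising z (S n) = rising z n * (z + RtoC (INR (S n))) by [].
have -> : rising (z + / 2) (S n) = rising (z + / 2) n * (z + / 2 + RtoC (INR (S n))) by [].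
have -> : RtoC (4 ^ S (S n)) = RtoC 4 * RtoC (4 ^ S n) by rewrite -RtoC_mult.
set F := RtoC (4 ^ S n).
have -> : INR (S (S (2 * n))) = (2 * (INR n + 1))%R by rewrite !S_INR mult_INR [INR 2]/=; ring.
have -> : INR (S (S (S (2 * n)))) = (2 * (INR n + 1) + 1)%R by rewrite !S_INR mult_INR [INR 2]/=; ring.
rewrite S_INR !RtoC_plus !RtoC_mult !RtoC_plus. field.
Qed.

(** It does not depend on [z], so its limit can be read off at [z = 1/2] from [rgamma (1/2)] and
    [rgamma 1], which replaces Stirling's formula. *)
Definition dup_const (n : nat) : R :=
  (INR (fact (2 * n)) * exp (- (ln (INR n) / 2)) * INR n / (INR (fact n) ^ 2 * 4 ^ S n))%R.

Lemma rgamma_n_duplication (z : C) (n : nat) : (1 <= n)%nat ->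
  rgamma_n n z * rgamma_n n (z + / 2) =
  RtoC (dup_const n) * (Cexp (RtoC (ln 2) * (2 * z)) * rgamma_n (2 * n) (2 * z) * (2 + (2 * z + 1) * RtoC (/ INR n))).
Proof.
move=> Hn. have hn : (0 < INR n)%R by apply: lt_0_INR; lia.
have EI2 : INR 2 = 2%R by [].
rewrite /rgamma_n mult_INR EI2 ln_mult //; last lra.
have E1 : Cexp (- RtoC (ln (INR n)) * z) * Cexp (- RtoC (ln (INR n)) * (z + / 2)) =
  RtoC (exp (- (ln (INR n) / 2))) * Cexp (- RtoC (ln (INR n)) * (2 * z)).
  rewrite -Cexp_RtoC -!Cexp_plus. f_equal. rewrite RtoC_opp RtoC_div; last lra.
  field.
have E2 : Cexp (RtoC (ln 2) * (2 * z)) * Cexp (- RtoC (ln 2 + ln (INR n)) * (2 * z)) =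
   Cexp (- RtoC (ln (INR n)) * (2 * z)).
  rewrite -Cexp_plus. f_equal. rewrite RtoC_plus. ring.
have E3 := rising_duplication z n.
have E4 : rising (2 * z) (S (2 * n)) = rising (2 * z) (2 * n) * (2 * z + RtoC (2 * INR n + 1)).
  have -> : (2 * INR n + 1)%R = INR (S (2 * n)) by rewrite S_INR mult_INR EI2. done.
have h4 : (4 ^ S n)%R <> 0%R by apply: pow_nonzero; lra.
have hf := INR_fact_neq_0 n. have hf2 := INR_fact_neq_0 (2 * n).
have hC4 := RtoC_neq_0 _ h4. have hCf := RtoC_neq_0 _ hf. have hCf2 := RtoC_neq_0 _ hf2.
have hCn := RtoC_neq_0 (INR n) ltac:(lra).
have E5 : rising z n * rising (z + / 2) n = rising (2 * z) (2 * n) * (2 * z + RtoC (2 * INR n + 1)) / RtoC (4 ^ S n).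
  rewrite -E4 -E3. field. exact: hC4.
have E6 : RtoC (dup_const n) = RtoC (INR (fact (2 * n))) * RtoC (exp (- (ln (INR n) / 2))) * RtoC (INR n) /
   (RtoC (INR (fact n)) ^ 2 * RtoC (4 ^ S n)).
  rewrite /dup_const RtoC_div; last by apply: Rmult_integral_contrapositive; split=> //; exact: pow_nonzero.
  by rewrite !RtoC_mult RtoC_pow.
rewrite E6.
replace (Cexp (- RtoC (ln (INR n)) * z) * (rising z n * RtoC (/ INR (fact n))) *
  (Cexp (- RtoC (ln (INR n)) * (z + / 2)) * (rising (z + / 2) n * RtoC (/ INR (fact n))))) with
  ((Cexp (- RtoC (ln (INR n)) * z) * Cexp (- RtoC (ln (INR n)) * (z + / 2))) *
   (rising z n * rising (z + / 2) n) * RtoC (/ INR (fact n)) ^ 2) by ring.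
replace (Cexp (RtoC (ln 2) * (2 * z)) *
  (Cexp (- RtoC (ln 2 + ln (INR n)) * (2 * z)) *
   (rising (2 * z) (2 * n) * RtoC (/ INR (fact (2 * n)))))) with
  ((Cexp (RtoC (ln 2) * (2 * z)) * Cexp (- RtoC (ln 2 + ln (INR n)) * (2 * z))) *
   (rising (2 * z) (2 * n) * RtoC (/ INR (fact (2 * n))))) by ring.
rewrite E1 E2 E5 !RtoC_inv //; try lra.
rewrite RtoC_plus RtoC_mult. field. by repeat split.
Qed.

Lemma rgamma_1 : rgamma 1 = 1.
Proof.
apply: (Ctends_unique _ _ _ (rgamma_lim 1)).
have L : Ctends (fun n => 1 + RtoC (/ INR n)) (1 + RtoC 0).
  apply: Ctends_plus; first exact: Ctends_const. apply: (proj1 (Ctends_RtoC _ _)). exact: inv_INR_lim.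
replace (1 + 0) with (RtoC 1) in L by ring.
apply: (Ctends_ext_loc _ _ _ 1 _ L) => n Hn.
have hn : (0 < INR n)%R by apply: lt_0_INR; lia.
have E : rising 1 n = RtoC (INR (fact (S n))).
  clear. elim: n => [|n IH] //. have -> : rising 1 (S n) = rising 1 n * (1 + RtoC (INR (S n))) by [].
  rewrite IH (fact_simpl (S n)) mult_INR RtoC_mult (S_INR (S n)) RtoC_plus. ring.
rewrite /rgamma_n E.
replace (- RtoC (ln (INR n)) * 1) with (RtoC (- ln (INR n))) by (rewrite RtoC_opp; ring).
rewrite Cexp_RtoC exp_Ropp exp_ln // fact_simpl mult_INR S_INR -!RtoC_mult -RtoC_plus. f_equal.
have := INR_fact_neq_0 n => hf. field. split=> //. lra.
Qed.

(** Reflection at [1/2] gives the square; the sign follows from the approximants being nonnegative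
    reals. *)
Lemma rgamma_half : rgamma (/ 2) = RtoC (/ sqrt PI).
Proof.
have hpi := PI_RGT_0. have hC2 : RtoC 2 <> 0 by apply: RtoC_neq_0; lra.
have hs : (0 < sqrt PI)%R by exact: sqrt_lt_R0.
have hss : (sqrt PI * sqrt PI = PI)%R by apply: sqrt_sqrt; lra.
have h1 : rgamma (/ 2) * rgamma (/ 2) = RtoC (/ PI).
  have := rgamma_reflection (/ 2). replace (1 - / 2) with (/ 2) by field.
  move=> ->.
  have -> : Csin (RtoC PI * / 2) = 1.
    rewrite /Csin.
    have -> : Ci * (RtoC PI * / 2) = (0, PI / 2)%R by apply: injective_projections => /=; field.
    have -> : Cexp (0, (PI / 2)%R) = Ci.
      rewrite /Cexp /= exp_0 cos_PI2 sin_PI2. apply: injective_projections => /=; ring.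
    have -> : Cexp (- (0, (PI / 2)%R)) = - Ci.
      rewrite /Cexp /= Ropp_0 exp_0 cos_neg sin_neg cos_PI2 sin_PI2. apply: injective_projections => /=; ring.
    field. move=> /(f_equal snd) /=; lra.
  rewrite RtoC_inv; last lra. field. apply: RtoC_neq_0; lra.
have h2 : (rgamma (/ 2) - RtoC (/ sqrt PI)) * (rgamma (/ 2) + RtoC (/ sqrt PI)) = 0.
  replace (_ * _) with (rgamma (/ 2) * rgamma (/ 2) - RtoC (/ sqrt PI) * RtoC (/ sqrt PI)) by ring.
  rewrite h1 -RtoC_mult -Rinv_mult hss. ring.
case: (Ceq_dec (rgamma (/ 2) - RtoC (/ sqrt PI)) 0) => [h|hn].
  replace (rgamma (/ 2)) with (rgamma (/ 2) - RtoC (/ sqrt PI) + RtoC (/ sqrt PI)) by ring. rewrite h; ring.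
case: (Ceq_dec (rgamma (/ 2) + RtoC (/ sqrt PI)) 0) => [h|hn2]; last by have := Cmult_neq_0 _ _ hn hn2.
exfalso.
have hE : rgamma (/ 2) = RtoC (- / sqrt PI).
  rewrite RtoC_opp. replace (rgamma (/ 2)) with (rgamma (/ 2) + RtoC (/ sqrt PI) - RtoC (/ sqrt PI)) by ring.
  rewrite h; ring.
pose r := fun n => (exp (- (ln (INR n) / 2)) * ((Rprod (fun k => / 2 + INR k) (S n)) * / INR (fact n)))%R.
have Er : forall n, rgamma_n n (/ 2) = RtoC (r n).
  move=> n. rewrite /rgamma_n /r (RtoC_mult (exp _)) (RtoC_mult (Rprod _ _)) -Cexp_RtoC. f_equal.
    f_equal. rewrite RtoC_opp RtoC_div; last lra. field.
  f_equal. elim: n => [|n IH].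
    rewrite /= Rmult_1_l Rplus_0_r RtoC_inv //.
  have -> : rising (/ 2) (S n) = rising (/ 2) n * (/ 2 + RtoC (INR (S n))) by [].
  rewrite IH. have -> : Rprod (fun k => / 2 + INR k)%R (S (S n)) =
    (Rprod (fun k => / 2 + INR k)%R (S n) * (/ 2 + INR (S n)))%R by [].
  by rewrite (RtoC_mult (Rprod _ _)) RtoC_plus RtoC_inv.
have Lr : is_lim_seq r (- / sqrt PI)%R.
  apply: (proj2 (Ctends_RtoC _ _)). rewrite -hE. apply: Ctends_ext (rgamma_lim (/ 2)) => n. exact: Er.
have hpos : forall n, (0 <= r n)%R.
  move=> n. apply: Rmult_le_pos; first by left; exact: exp_pos.
  apply: Rmult_le_pos; last by left; exact: Rinv_0_lt_compat (INR_fact_lt_0 n).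
  elim: (S n) => [|m IH] /=; first lra. apply: Rmult_le_pos => //. have := pos_INR m. lra.
have := is_lim_seq_le _ _ 0 (- / sqrt PI)%R hpos (is_lim_seq_const 0) Lr.
rewrite /=. have := Rinv_0_lt_compat _ hs. lra.
Qed.

Lemma rgamma_duplication (z : C) :
  rgamma z * rgamma (z + / 2) = RtoC (/ (2 * sqrt PI)) * (Cexp (RtoC (ln 2) * (2 * z)) * rgamma (2 * z)).
Proof.
have hpi := PI_RGT_0. have hC2 : RtoC 2 <> 0 by apply: RtoC_neq_0; lra.
have hs : (0 < sqrt PI)%R by exact: sqrt_lt_R0.
have L2 : forall w, Ctends (fun n => Cexp (RtoC (ln 2) * (2 * w)) * rgamma_n (2 * n) (2 * w) * (2 + (2 * w + 1) * RtoC (/ INR n)))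
   (Cexp (RtoC (ln 2) * (2 * w)) * rgamma (2 * w) * (2 + (2 * w + 1) * RtoC 0)).
  move=> w. apply: Ctends_mult.
    apply: Ctends_scal. have := rgamma_lim (2 * w) => /Ctends_eps H.
    apply/Ctends_eps => eps He. have [N HN] := H eps He. exists N => n Hn. apply: HN. lia.
  apply: Ctends_plus; first exact: Ctends_const. apply: Ctends_scal. apply: (proj1 (Ctends_RtoC _ _)). exact: inv_INR_lim.
(* At [z = 1/2] all factors other than the constant have known limits; the bracket
   [2 + (2 z + 1) / n] contributes the factor 2 that turns [4 * sqrt PI] into [2 * sqrt PI] at the
   end. *)
have Ld : Ctends (fun n => RtoC (dup_const n)) (RtoC (/ (4 * sqrt PI))).
  have E1 : 2 * / 2 = 1 by field.
  have E2 : / 2 + / 2 = 1 by field.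
  have H := L2 (/ 2). rewrite E1 rgamma_1 in H.
  have e1 : RtoC (ln 2) * 1 = RtoC (ln 2) by ring. rewrite e1 Cexp_RtoC exp_ln in H; last lra.
  have hne : RtoC 2 * 1 * (2 + (1 + 1) * 0) <> 0.
    replace (RtoC 2 * 1 * (2 + (1 + 1) * 0)) with (RtoC 2 * RtoC 2) by ring. exact: Cmult_neq_0.
  have L := Ctends_mult _ _ _ _ (Ctends_rgamma_mult (/ 2) (/ 2 + / 2)) (Ctends_inv _ _ hne H).
  have E : rgamma (/ 2) * rgamma (/ 2 + / 2) * / (RtoC 2 * 1 * (2 + (1 + 1) * 0)) = RtoC (/ (4 * sqrt PI)).
    rewrite E2 rgamma_1 rgamma_half.
    have hsC : RtoC (sqrt PI) <> 0 by apply: RtoC_neq_0; lra.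
    rewrite RtoC_inv; last lra. rewrite RtoC_inv; last lra. rewrite RtoC_mult.
    field. exact: hsC.
  rewrite E in L.
  have hne0 : (0 < Cmod (RtoC 2 * 1 * (2 + (1 + 1) * 0)))%R by apply/Cmod_gt_0.
  have [N HN] := proj1 (Ctends_eps _ _) H _ hne0.
  apply: (Ctends_ext_loc _ _ _ (S N) _ L) => n Hn.
  rewrite rgamma_n_duplication; last lia.
  rewrite E1 e1 Cexp_RtoC exp_ln; last lra.
  set X := RtoC 2 * rgamma_n (2 * n) 1 * (2 + (1 + 1) * RtoC (/ INR n)).
  have hX : X <> 0.
    move=> hX. have := HN n ltac:(lia). rewrite -/X hX.
    replace (0 - _) with (- (RtoC 2 * 1 * (2 + (1 + 1) * 0))) by ring. rewrite Cmod_opp. lra.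
  field. exact: hX.
apply: (Ctends_unique _ _ _ (Ctends_rgamma_mult _ _)).
have L := Ctends_mult _ _ _ _ Ld (L2 z).
replace (RtoC (/ (4 * sqrt PI)) * (Cexp (RtoC (ln 2) * (2 * z)) * rgamma (2 * z) * (2 + (2 * z + 1) * 0)))
  with (RtoC (/ (2 * sqrt PI)) * (Cexp (RtoC (ln 2) * (2 * z)) * rgamma (2 * z))) in L; last first.
  have -> : (/ (2 * sqrt PI) = / (4 * sqrt PI) * 2)%R by field; lra.
  rewrite RtoC_mult. ring.
apply: (Ctends_ext_loc _ _ _ 1 _ L) => n Hn. by rewrite rgamma_n_duplication.
Qed.

(** * Improper integrals *)

Open Scope R_scope.

(** Continuity is included so that every [RInt] between positive bounds exists. The two ends of the
    interval move independently. *)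
Definition improp (f : R -> R) (l : R) : Prop :=
  (forall x, 0 < x -> continuous f x) /\
  forall eps, 0 < eps -> exists A B, 0 < A < B /\
    forall a b, 0 < a <= A -> B <= b -> Rabs (RInt f a b - l) < eps.

Lemma improp_RInt_ex (f : R -> R) (a b : R) : (forall x, 0 < x -> continuous f x) ->
  0 < a -> 0 < b -> ex_RInt f a b.
Proof.
move=> Hf Ha Hb. apply: (ex_RInt_continuous (V := R_CompleteNormedModule)) => z Hz. apply: Hf.
have := Rmin_glb_lt _ _ _ Ha Hb. lra.
Qed.

Lemma improp_ext (f g : R -> R) (l : R) : (forall x, 0 < x -> f x = g x) ->
  improp f l -> improp g l.
Proof.
move=> H [Hc Hl]. split.
- move=> x Hx. apply: (continuous_ext_loc _ f); last exact: Hc.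
  exists (mkposreal x Hx) => y Hy. apply: H.
  have : Rabs (y - x) < x by exact: Hy. move=> /Rabs_def2. lra.
- move=> eps He. have [A [B [HAB H2]]] := Hl eps He. exists A, B; split=> // a b Ha Hb.
  rewrite -(RInt_ext f g); first exact: H2.
  move=> x. rewrite Rmin_left; last lra. move=> Hx. apply: H. lra.
Qed.

Lemma improp_plus (f g : R -> R) (l m : R) :
  improp f l -> improp g m -> improp (fun x => f x + g x) (l + m).
Proof.
move=> [Hf Hl] [Hg Hm]. split.
- move=> x Hx. apply: (continuous_plus (V := R_NormedModule)); [exact: Hf|exact: Hg].
- move=> eps He. have [A [B [HAB H1]]] := Hl (eps / 2) ltac:(lra).
  have [A' [B' [HAB' H2]]] := Hm (eps / 2) ltac:(lra).
  exists (Rmin A A'), (Rmax B B').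
  have h1 := Rmin_l A A'. have h2 := Rmin_r A A'. have h3 := Rmax_l B B'. have h4 := Rmax_r B B'.
  split; first by split; [apply: Rmin_glb_lt; lra|lra].
  move=> a b Ha Hb.
  have -> : RInt (fun x => f x + g x) a b = RInt f a b + RInt g a b.
    apply: (RInt_plus (V := R_CompleteNormedModule)); apply: improp_RInt_ex => //; lra.
  have -> : RInt f a b + RInt g a b - (l + m) = (RInt f a b - l) + (RInt g a b - m) by ring.
  apply: Rle_lt_trans; first exact: Rabs_triang.
  have := H1 a b ltac:(lra) ltac:(lra). have := H2 a b ltac:(lra) ltac:(lra). lra.
Qed.

Lemma improp_scal (c : R) (f : R -> R) (l : R) : improp f l -> improp (fun x => c * f x) (c * l).
Proof.
move=> [Hf Hl]. split.
- move=> x Hx. apply: (continuous_scal_r (K := R_AbsRing) (V := R_NormedModule)). exact: Hf.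
- move=> eps He. have hc : 0 < Rabs c + 1 by have := Rabs_pos c; lra.
  have [A [B [HAB H]]] := Hl (eps / (Rabs c + 1)) ltac:(exact: Rdiv_lt_0_compat).
  exists A, B; split=> // a b Ha Hb.
  have -> : RInt (fun x => c * f x) a b = c * RInt f a b.
    apply: (RInt_scal (V := R_CompleteNormedModule)). apply: improp_RInt_ex => //; lra.
  have -> : c * RInt f a b - c * l = c * (RInt f a b - l) by ring.
  rewrite Rabs_mult. have := H a b Ha Hb => /Rlt_div_r h. have {}h := h hc.
  have := Rabs_pos (RInt f a b - l). nra.
Qed.

Lemma improp_minus (f g : R -> R) (l m : R) :
  improp f l -> improp g m -> improp (fun x => f x - g x) (l - m).
Proof.
move=> Hf Hg. have := improp_plus _ _ _ _ Hf (improp_scal (-1) _ _ Hg).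
have -> : l + -1 * m = l - m by ring.
apply: improp_ext => x _. ring.
Qed.

Lemma improp_le (f g : R -> R) (l m : R) : (forall x, 0 < x -> f x <= g x) ->
  improp f l -> improp g m -> l <= m.
Proof.
move=> H [Hf Hl] [Hg Hm]. apply: le_epsilon => eps He.
have [A [B [HAB H1]]] := Hl (eps / 2) ltac:(lra).
have [A' [B' [HAB' H2]]] := Hm (eps / 2) ltac:(lra).
have h1 := Rmin_l A A'. have h2 := Rmin_r A A'. have h3 := Rmax_l B B'. have h4 := Rmax_r B B'.
have h5 : 0 < Rmin A A' by apply: Rmin_glb_lt; lra.
have := H1 (Rmin A A') (Rmax B B') ltac:(lra) ltac:(lra) => /Rabs_def2.
have := H2 (Rmin A A') (Rmax B B') ltac:(lra) ltac:(lra) => /Rabs_def2.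
have : RInt f (Rmin A A') (Rmax B B') <= RInt g (Rmin A A') (Rmax B B').
  apply: RInt_le; [lra|apply: improp_RInt_ex => //; lra|apply: improp_RInt_ex => //; lra|].
  move=> x Hx. apply: H. lra.
lra.
Qed.

Lemma improp_unique (f : R -> R) (l m : R) : improp f l -> improp f m -> l = m.
Proof.
move=> Hl Hm. apply: Rle_antisym.
- exact: (improp_le f f l m (fun x _ => Rle_refl _) Hl Hm).
- exact: (improp_le f f m l (fun x _ => Rle_refl _) Hm Hl).
Qed.

Definition lim0 (F : R -> R) (l : R) : Prop :=
  forall eps, 0 < eps -> exists A, 0 < A /\ forall x, 0 < x <= A -> Rabs (F x - l) < eps.
Definition liminfty (F : R -> R) (l : R) : Prop :=
  forall eps, 0 < eps -> exists B, forall x, 0 < x -> B <= x -> Rabs (F x - l) < eps.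

Lemma improp_FTC (F f : R -> R) (la lb : R) :
  (forall x, 0 < x -> is_derive F x (f x)) -> (forall x, 0 < x -> continuous f x) ->
  lim0 F la -> liminfty F lb -> improp f (lb - la).
Proof.
move=> HF Hf H0 Hoo. split=> // eps He.
have [A [HA H1]] := H0 (eps / 2) ltac:(lra). have [B H2] := Hoo (eps / 2) ltac:(lra).
exists A, (Rmax B (A + 1)). have h1 := Rmax_l B (A + 1). have h2 := Rmax_r B (A + 1).
split; first lra. move=> a b Ha Hb.
have -> : RInt f a b = F b - F a.
  apply: (is_RInt_unique (V := R_CompleteNormedModule)). have H : is_RInt f a b (minus (F b) (F a)); last exact: H.
    apply: is_RInt_derive.
  - move=> x. rewrite Rmin_left; last lra. move=> Hx. apply: HF. lra.
  - move=> x. rewrite Rmin_left; last lra. move=> Hx. apply: Hf. lra.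
have -> : F b - F a - (lb - la) = (F b - lb) - (F a - la) by ring.
have := H1 a Ha => /Rabs_def2. have := H2 b ltac:(lra) ltac:(lra) => /Rabs_def2. move=> h h'.
apply: Rabs_def1; lra.
Qed.

Lemma improp_scale (c : R) (f : R -> R) (l : R) : 0 < c ->
  improp f l -> improp (fun x => f (c * x)) (l / c).
Proof.
move=> Hc [Hf Hl].
have Hcont : forall x, 0 < x -> continuous (fun x => f (c * x)) x.
  move=> x Hx. apply: (continuous_comp (fun x => c * x) f).
    apply: (continuous_scal_r (K := R_AbsRing) (V := R_NormedModule)). exact: continuous_id.
  apply: Hf. exact: Rmult_lt_0_compat.
split=> // eps He.
have [A [B [HAB H]]] := Hl (eps * c) ltac:(nra).
exists (A / c), (B / c). split.
  split; first by apply: Rdiv_lt_0_compat; lra.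
  apply: Rmult_lt_compat_r; [exact: Rinv_0_lt_compat|lra].
move=> a b [Ha1 Ha2] Hb.
have Ha : 0 < c * a <= A by split; [nra|move: Ha2 => /Rle_div_r Ha2; have := Ha2 Hc; lra].
have Hb' : B <= c * b by move: Hb => /Rle_div_l Hb; have := Hb Hc; lra.
have hB0 : 0 < B / c by apply: Rdiv_lt_0_compat; lra.
have hab : 0 < b by lra.
have E : c * RInt (fun x => f (c * x)) a b = RInt f (c * a) (c * b).
  have := RInt_comp_lin (V := R_CompleteNormedModule) f c 0 a b. rewrite !Rplus_0_r => <-.
    have E0 : RInt (fun x => c * f (c * x)) a b = c * RInt (fun x => f (c * x)) a b.
      apply: (RInt_scal (V := R_CompleteNormedModule)). apply: improp_RInt_ex => //; lra.
    rewrite -E0. apply: RInt_ext => x _. by rewrite Rplus_0_r.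
  apply: improp_RInt_ex => //; lra.
have -> : RInt (fun x => f (c * x)) a b - l / c = (RInt f (c * a) (c * b) - l) / c by rewrite -E; field; lra.
have := H _ _ Ha Hb' => h.
rewrite /Rdiv Rabs_mult (Rabs_pos_eq (/ c)); last by left; exact: Rinv_0_lt_compat.
apply: (Rmult_lt_reg_r c) => //. rewrite Rmult_assoc Rinv_l; lra.
Qed.

(** For a nonnegative integrand the value is the supremum of the integrals over compact
    subintervals, bounded here by [m]. *)
Lemma improp_dominated (f g : R -> R) (m : R) : (forall x, 0 < x -> continuous f x) ->
  (forall x, 0 < x -> 0 <= f x <= g x) -> improp g m -> exists l, improp f l.
Proof.
move=> Hf Hfg Hg. have [Hgc Hgl] := Hg.
have ex := fun a b => improp_RInt_ex f a b Hf. have exg := fun a b => improp_RInt_ex g a b Hgc.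
have mono : forall (h : R -> R), (forall x, 0 < x -> continuous h x) -> (forall x, 0 < x -> 0 <= h x) ->
    forall a b a' b', 0 < a' <= a -> a <= b -> b <= b' -> RInt h a b <= RInt h a' b'.
  move=> h Hh Hpos a b a' b' Ha Hab Hb.
  have e := fun a b => improp_RInt_ex h a b Hh.
  have E1 := RInt_Chasles (V := R_CompleteNormedModule) h a' a b' (e a' a ltac:(lra) ltac:(lra)) (e a b' ltac:(lra) ltac:(lra)).
  have E2 := RInt_Chasles (V := R_CompleteNormedModule) h a b b' (e a b ltac:(lra) ltac:(lra)) (e b b' ltac:(lra) ltac:(lra)).
  have p1 : 0 <= RInt h a' a.
    apply: RInt_ge_0; [lra|apply: e; lra|move=> x Hx; apply: Hpos; lra].
  have p2 : 0 <= RInt h b b'.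
    apply: RInt_ge_0; [lra|apply: e; lra|move=> x Hx; apply: Hpos; lra].
  move: E1 E2. rewrite /plus /=. lra.
have gpos : forall x, 0 < x -> 0 <= g x by move=> x Hx; have := Hfg x Hx; lra.
have fpos : forall x, 0 < x -> 0 <= f x by move=> x Hx; have := Hfg x Hx; lra.
have bound : forall a b, 0 < a -> a <= b -> RInt f a b <= m.
  move=> a b Ha Hab. apply: Rle_trans.
    apply: (RInt_le f g) => //; [apply: ex; lra|apply: exg; lra|].
    move=> x Hx. apply: (proj2 (Hfg x _)). lra.
  apply: le_epsilon => eps He. have [A [B [HAB H]]] := Hgl eps He.
  have h1 := Rmin_l A a. have h2 := Rmin_r A a. have h3 := Rmax_l B b. have h4 := Rmax_r B b.
  have h5 : 0 < Rmin A a by apply: Rmin_glb_lt; lra.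
  have := mono g Hgc gpos a b (Rmin A a) (Rmax B b) ltac:(lra) Hab ltac:(lra).
  have := H (Rmin A a) (Rmax B b) ltac:(lra) ltac:(lra) => /Rabs_def2. lra.
pose S := fun v => exists a b, 0 < a <= b /\ v = RInt f a b.
have [l [Hl1 Hl2]] : {l | is_lub S l}.
  apply: completeness.
    exists m => v [a [b [Hab ->]]]. apply: bound; lra.
  exists (RInt f 1 1), 1, 1. split=> //. lra.
exists l. split=> // eps He.
have [a [b [Hab Hv]]] : exists a b, 0 < a <= b /\ l - eps < RInt f a b.
  apply: Classical_Prop.NNPP => hn.
  have : l <= l - eps; last lra.
  apply: Hl2 => v [a [b [Hab ->]]]. case: (Rle_lt_dec (RInt f a b) (l - eps)) => // h.
  case: hn. by exists a, b.
exists a, (b + 1). split; first lra. move=> a' b' Ha' Hb'.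
have h1 := mono f Hf fpos a b a' b' ltac:(lra) ltac:(lra) ltac:(lra).
have h2 : RInt f a' b' <= l by apply: Hl1; exists a', b'; split=> //; lra.
apply: Rabs_def1; lra.
Qed.

(** * Real powers and their limits at 0 and at infinity *)

Lemma Rpower_pos (x a : R) : 0 < Rpower x a.
Proof. exact: exp_pos. Qed.

Lemma Rpower_pred (x a : R) : 0 < x -> Rpower x (a - 1) = Rpower x a / x.
Proof. move=> Hx. rewrite /Rminus Rpower_plus Rpower_Ropp Rpower_1 //. Qed.

Lemma Rpower_le_base (x y a : R) : 0 < x -> x <= y -> 0 <= a -> Rpower x a <= Rpower y a.
Proof. move=> Hx Hxy Ha. apply: Rle_Rpower_l => //. Qed.

Lemma Rpower_Rmult (x y a : R) : 0 < x -> 0 < y -> Rpower (x * y) a = Rpower x a * Rpower y a.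
Proof. move=> Hx Hy. by rewrite Rpower_mult_distr. Qed.

Lemma lim0_Rpower (a : R) : 0 < a -> lim0 (fun x => Rpower x a) 0.
Proof.
move=> Ha eps He. exists (Rpower (eps / 2) (/ a)). split; first exact: Rpower_pos.
move=> x [Hx1 Hx2]. rewrite Rminus_0_r Rabs_pos_eq; last by left; exact: Rpower_pos.
apply: (Rle_lt_trans _ (Rpower (Rpower (eps / 2) (/ a)) a)); first by apply: Rpower_le_base => //; lra.
rewrite Rpower_mult Rinv_l; last lra. rewrite Rpower_1; lra.
Qed.

Lemma liminfty_Rpower (a : R) : a < 0 -> liminfty (fun x => Rpower x a) 0.
Proof.
move=> Ha eps He. have [A [HA H]] := lim0_Rpower (- a) ltac:(lra) eps He.
exists (/ A) => x Hx0 Hx.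
have hx : / x <= A by rewrite -(Rinv_inv A); apply: Rinv_le_contravar => //; exact: Rinv_0_lt_compat.
have := H (/ x) ltac:(split; [exact: Rinv_0_lt_compat|done]).
have -> : Rpower (/ x) (- a) = Rpower x a; last done.
by rewrite /Rpower ln_Rinv //; f_equal; ring.
Qed.

Lemma lim0_squeeze (F H : R -> R) (K : R) : (forall x, 0 < x -> Rabs (F x) <= K * H x) ->
  lim0 H 0 -> lim0 F 0.
Proof.
move=> HF HH eps He. have hK : 0 < Rabs K + 1 by have := Rabs_pos K; lra.
have [A [HA H2]] := HH (eps / (Rabs K + 1)) ltac:(exact: Rdiv_lt_0_compat).
exists A; split=> // x Hx. have := H2 x Hx. rewrite !Rminus_0_r => /Rlt_div_r h. have {}h := h hK.
apply: Rle_lt_trans; first by apply: HF; lra.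
have := Rle_abs (K * H x). rewrite Rabs_mult. have := Rabs_pos (H x). nra.
Qed.

Lemma liminfty_squeeze (F H : R -> R) (K : R) : (forall x, 0 < x -> Rabs (F x) <= K * H x) ->
  liminfty H 0 -> liminfty F 0.
Proof.
move=> HF HH eps He. have hK : 0 < Rabs K + 1 by have := Rabs_pos K; lra.
have [A H2] := HH (eps / (Rabs K + 1)) ltac:(exact: Rdiv_lt_0_compat).
exists A => x Hx0 Hx. have := H2 x Hx0 Hx. rewrite !Rminus_0_r => /Rlt_div_r h. have {}h := h hK.
apply: Rle_lt_trans; first by apply: HF; lra.
have := Rle_abs (K * H x). rewrite Rabs_mult. have := Rabs_pos (H x). nra.
Qed.

(** * The Gamma and Beta integrals *)

Lemma is_derive_Rpower (a x : R) : 0 < x -> is_derive (fun y => Rpower y a) x (a * Rpower x (a - 1)).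
Proof. move=> Hx. apply/is_derive_Reals. exact: derivable_pt_lim_power. Qed.

Lemma continuous_of_derive (f : R -> R) (x l : R) : is_derive f x l -> continuous f x.
Proof. move=> H. apply: (ex_derive_continuous (K := R_AbsRing) (V := R_NormedModule)). by exists l. Qed.

Lemma continuous_Rpower (a x : R) : 0 < x -> continuous (fun y => Rpower y a) x.
Proof. move=> Hx. exact: continuous_of_derive (is_derive_Rpower a x Hx). Qed.

Lemma Rpower_ge_self (t a : R) : 0 < t <= 1 -> 0 <= a <= 1 -> t <= Rpower t a <= 1.
Proof.
move=> Ht Ha. rewrite /Rpower.
have hl : ln t <= 0.
  rewrite -ln_1. case: (proj2 Ht) => [h|->]; [left; apply: ln_increasing; lra|lra].
split.
- rewrite -{1}(exp_ln t); last lra.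
  have h : ln t <= a * ln t by nra.
  case: h => [h|<-]; [left; exact: exp_increasing|lra].
- rewrite -exp_0. have h : a * ln t <= 0 by nra.
  case: h => [h|->]; [left; exact: exp_increasing|lra].
Qed.

(** The weighted mean inequality for 1 and [x]: the bound [ln y <= y - 1] at [1 / A] and at [x / A],
    with weights [1 - t] and [t], has right-hand sides that cancel. *)
Lemma Rpower_concave (t x : R) : 0 <= t <= 1 -> 0 < x -> Rpower x t <= 1 + t * (x - 1).
Proof.
move=> Ht Hx. set A := 1 + t * (x - 1).
have hA : 0 < A by rewrite /A; nra.
have lnle : forall y : R, 0 < y -> ln y <= y - 1.
  move=> y Hy. have := exp_ineq1_le (ln y). rewrite exp_ln //. lra.
have h1 := lnle (/ A) (Rinv_0_lt_compat _ hA).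
have h2 := lnle (x / A) ltac:(exact: Rdiv_lt_0_compat).
rewrite ln_Rinv // in h1. rewrite ln_div // in h2.
have h3 : (1 - t) * (- ln A) + t * (ln x - ln A) <= (1 - t) * (/ A - 1) + t * (x / A - 1).
  apply: Rplus_le_compat; apply: Rmult_le_compat_l; lra.
have h4 : (1 - t) * (/ A - 1) + t * (x / A - 1) = 0 by rewrite /A; field; rewrite -/A; lra.
have h5 : t * ln x <= ln A by lra.
rewrite /Rpower. apply: (Rle_trans _ (exp (ln A))); last by rewrite exp_ln //; exact: Rle_refl.
case: h5 => [h|->]; [left; exact: exp_increasing|lra].
Qed.

Definition gam (s x : R) : R := Rpower x (s - 1) * exp (- x).

Lemma gam_pos (s x : R) : 0 < gam s x.
Proof. apply: Rmult_lt_0_compat; [exact: Rpower_pos|exact: exp_pos]. Qed.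

Lemma gam_continuous (s x : R) : 0 < x -> continuous (gam s) x.
Proof.
move=> Hx. apply: (continuous_of_derive _ _ (((s - 1) * Rpower x (s - 1 - 1)) * exp (- x) + Rpower x (s - 1) * (- exp (- x)))).
apply: (is_derive_mult (K := R_AbsRing)); [exact: is_derive_Rpower| |exact: Rmult_comm].
auto_derive => //. ring.
Qed.

Lemma Rpower_frac_derive (s x : R) : 0 < s -> 0 < x ->
  is_derive (fun x => Rpower x s * Rpower (1 + x) (- s) / s) x (Rpower x (s - 1) * Rpower (1 + x) (- s - 1)).
Proof.
move=> Hs Hx. rewrite !Rpower_pred //; last lra. rewrite /Rpower.
auto_derive; first by repeat split; lra.
field. lra.
Qed.

(** The integrand has the primitive [(x / (1 + x))^s / s]. It serves as the integrable majorant of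
    [gam s]. *)
Lemma beta_kernel_integral (s : R) : 0 < s <= 1 ->
  improp (fun x => Rpower x (s - 1) * Rpower (1 + x) (- s - 1)) (/ s).
Proof.
move=> Hs. rewrite -(Rminus_0_r (/ s)).
have E : forall x, 0 < x -> Rpower x s * Rpower (1 + x) (- s) = Rpower (x / (1 + x)) s.
  move=> x Hx. rewrite /Rdiv Rpower_Rmult //; last by apply: Rinv_0_lt_compat; lra.
  f_equal. rewrite /Rpower ln_Rinv; last lra. f_equal. ring.
have hf : forall x, 0 < x -> 0 < x / (1 + x) <= 1.
  move=> x Hx. split; first by apply: Rdiv_lt_0_compat; lra. apply/Rle_div_l; lra.
apply: (improp_FTC (fun x => Rpower x s * Rpower (1 + x) (- s) / s)).
- move=> x Hx. apply: Rpower_frac_derive; lra.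
- move=> x Hx. apply: (continuous_mult (K := R_AbsRing)); first exact: continuous_Rpower.
  apply: (continuous_comp (fun x => 1 + x) (fun y => Rpower y (- s - 1))).
    apply: (continuous_of_derive _ _ 1). auto_derive => //.
  apply: continuous_Rpower. lra.
- apply: (lim0_squeeze _ (fun x => Rpower x s) (/ s)); last by apply: lim0_Rpower; lra.
  move=> x Hx. rewrite E // /Rdiv Rabs_mult (Rabs_pos_eq (/ s)); last by left; apply: Rinv_0_lt_compat; lra.
  rewrite Rmult_comm. apply: Rmult_le_compat_l; first by left; apply: Rinv_0_lt_compat; lra.
  rewrite Rabs_pos_eq; last by left; exact: Rpower_pos.
  apply: Rpower_le_base; [exact: (proj1 (hf x Hx))| |lra].
  apply/Rle_div_l; nra.
(* At infinity [1 - t^s <= 1 - t <= 1 / x] for [t = x / (1 + x)], by [s <= 1]. *)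
- move=> eps He.
  have [B HB] := liminfty_Rpower (-1) ltac:(lra) (eps * s) ltac:(nra).
  exists B => x Hx0 Hx. have := HB x Hx0 Hx.
  have -> : Rpower x (-1) = / x by rewrite Rpower_Ropp Rpower_1.
  rewrite Rminus_0_r Rabs_pos_eq; last by left; exact: Rinv_0_lt_compat.
  move=> h. rewrite E // -Rabs_Ropp.
  have [h1 h2] := Rpower_ge_self (x / (1 + x)) s (hf x Hx0) ltac:(lra).
  have -> : - (Rpower (x / (1 + x)) s / s - / s) = (1 - Rpower (x / (1 + x)) s) / s by field; lra.
  rewrite Rabs_pos_eq; last by apply: Rdiv_le_0_compat; lra.
  apply/Rlt_div_l; first lra.
  have : 1 - x / (1 + x) <= / x; last lra.
  have -> : 1 - x / (1 + x) = / (1 + x) by field; lra.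
  apply: Rinv_le_contravar; lra.
Qed.

Lemma gam_ex (s : R) : 0 < s <= 1 -> exists l, improp (gam s) l.
Proof.
move=> Hs.
apply: (improp_dominated _ (fun x => 4 * (Rpower x (s - 1) * Rpower (1 + x) (- s - 1))) (4 * / s)).
- exact: gam_continuous.
- move=> x Hx. split; first by left; exact: gam_pos.
  rewrite /gam. have hp := Rpower_pos x (s - 1).
  have -> : 4 * (Rpower x (s - 1) * Rpower (1 + x) (- s - 1)) = Rpower x (s - 1) * (4 * Rpower (1 + x) (- s - 1)) by ring.
  apply: Rmult_le_compat_l; first lra.
  (* The constant 4 comes from [(1 + x)^(s + 1) <= (1 + x)^2 <= 4 (1 + x / 2)^2 <= 4 e^x]. *)
  have h1 : Rpower (1 + x) (s + 1) <= (1 + x) ^ 2.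
    have -> : (1 + x) ^ 2 = Rpower (1 + x) (1 + 1) by rewrite Rpower_plus Rpower_1; [ring|lra].
    apply: Rle_Rpower; lra.
  have h2 : (1 + x / 2) ^ 2 <= exp x.
    have -> : exp x = exp (x / 2) ^ 2 by rewrite /= Rmult_1_r -exp_plus; f_equal; field.
    apply: pow_incr. have := exp_ineq1_le (x / 2). lra.
  have h3 : (1 + x) ^ 2 <= 4 * (1 + x / 2) ^ 2 by nra.
  have h4 : Rpower (1 + x) (- s - 1) * Rpower (1 + x) (s + 1) = 1.
    rewrite -Rpower_plus. have -> : - s - 1 + (s + 1) = 0 by ring. rewrite Rpower_O; lra.
  have h5 := exp_mul_opp x. have h6 := exp_pos (- x). have h7 := Rpower_pos (1 + x) (- s - 1).
  have h8 : Rpower (1 + x) (s + 1) <= 4 * exp x by lra.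
  have := Rmult_le_compat_l _ _ _ (Rlt_le _ _ (Rmult_lt_0_compat _ _ h6 h7)) h8.
  have -> : exp (- x) * Rpower (1 + x) (- s - 1) * Rpower (1 + x) (s + 1) = exp (- x).
    by rewrite Rmult_assoc h4 Rmult_1_r.
  have -> : exp (- x) * Rpower (1 + x) (- s - 1) * (4 * exp x) = 4 * Rpower (1 + x) (- s - 1) * (exp x * exp (- x)) by ring.
  rewrite h5. lra.
- apply: improp_scal. exact: beta_kernel_integral.
Qed.

Lemma gam_succ (s l : R) : 0 < s -> improp (gam s) l -> improp (gam (s + 1)) (s * l).
Proof.
move=> Hs Hl.
have HF : improp (fun x => s * gam s x - gam (s + 1) x) (0 - 0).
  apply: (improp_FTC (fun x => Rpower x s * exp (- x))).
  - move=> x Hx. have -> : s * gam s x - gam (s + 1) x = (s * Rpower x (s - 1)) * exp (- x) + Rpower x s * (- exp (- x)).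
      rewrite /gam. have -> : s + 1 - 1 = s by ring. ring.
    apply: (is_derive_mult (K := R_AbsRing)); [exact: is_derive_Rpower| |exact: Rmult_comm].
    auto_derive => //. ring.
  - move=> x Hx. apply: (continuous_minus (V := R_NormedModule)); last exact: gam_continuous.
    apply: (continuous_scal_r (K := R_AbsRing) (V := R_NormedModule)). exact: gam_continuous.
  - apply: (lim0_squeeze _ (fun x => Rpower x s) 1); last exact: lim0_Rpower.
    move=> x Hx. have h := Rpower_pos x s. have h2 := exp_pos (- x).
    rewrite Rabs_pos_eq; last nra. have : exp (- x) <= 1; last nra.
    rewrite -exp_0. left. apply: exp_increasing. lra.
  (* The constant is the maximum of [x^(s + 1) e^(-x)], attained at [x = s + 1]; the tangent of [ln]
     at that point proves the bound. *)
  - apply: (liminfty_squeeze _ (fun x => Rpower x (-1)) (exp ((s + 1) * (ln (s + 1) - 1)))); last by apply: liminfty_Rpower; lra.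
    move=> x Hx. have h := Rpower_pos x s. have h2 := exp_pos (- x).
    rewrite Rabs_pos_eq; last nra.
    rewrite /Rpower -!exp_plus.
    have hx : ln x <= x / (s + 1) - 1 + ln (s + 1).
      have := exp_ineq1_le (ln (x / (s + 1))). rewrite exp_ln; last by apply: Rdiv_lt_0_compat; lra.
      rewrite ln_div; lra.
    have hle : s * ln x + - x <= (s + 1) * (ln (s + 1) - 1) + -1 * ln x.
      have := Rmult_le_compat_l (s + 1) _ _ ltac:(lra) hx.
      have -> : (s + 1) * (x / (s + 1) - 1 + ln (s + 1)) = x - (s + 1) + (s + 1) * ln (s + 1) by field; lra.
      lra.
    case: hle => [hle|->]; [left; exact: exp_increasing|lra].
have := improp_minus _ _ _ _ (improp_scal s _ _ Hl) HF.
have -> : s * l - (0 - 0) = s * l by ring.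
apply: improp_ext => x _. ring.
Qed.

Lemma gam_1 : improp (gam 1) 1.
Proof.
have H : improp (gam 1) (0 - - (1)); last by rewrite (_ : 0 - - (1) = 1) in H; [|ring].
apply: (improp_FTC (fun x => - exp (- x))).
- move=> x Hx. rewrite /gam Rminus_diag Rpower_O //. auto_derive => //. ring.
- exact: gam_continuous.
- move=> eps He. exists eps. split=> // x Hx.
  have h := exp_ineq1_le (- x). have h2 : exp (- x) < 1 by rewrite -exp_0; apply: exp_increasing; lra.
  have -> : - exp (- x) - - (1) = 1 - exp (- x) by ring.
  apply: Rabs_def1; last lra.
  case: (Req_dec x eps) => [E|hne]; last lra.
  have := exp_ineq1 (- x). lra.
- apply: (liminfty_squeeze _ (fun x => Rpower x (-1)) 1); last by apply: liminfty_Rpower; lra.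
  move=> x Hx. rewrite Rabs_Ropp Rabs_pos_eq; last by left; exact: exp_pos.
  have -> : Rpower x (-1) = / x by rewrite Rpower_Ropp Rpower_1.
  rewrite Rmult_1_l exp_Ropp. apply: Rinv_le_contravar => //. have := exp_ineq1_le x. lra.
Qed.

Lemma gam_nat (n : nat) : improp (gam (INR n + 1)) (INR (fact n)).
Proof.
elim: n => [|n IH]; first by rewrite /= Rplus_0_l; exact: gam_1.
have hn := pos_INR n. have h := gam_succ (INR n + 1) _ ltac:(lra) IH.
by rewrite fact_simpl mult_INR S_INR.
Qed.

Lemma gam_shift (s l : R) (n : nat) : 0 < s -> improp (gam s) l ->
  improp (gam (s + INR n)) (l * Rprod (fun k => s + INR k) n).
Proof.
move=> Hs Hl. elim: n => [|n IH]; first by rewrite /= Rplus_0_r Rmult_1_r.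
have hn := pos_INR n. have h := gam_succ (s + INR n) _ ltac:(lra) IH.
have -> : s + INR (S n) = s + INR n + 1 by rewrite S_INR; ring.
have -> : l * Rprod (fun k => s + INR k) (S n) = (s + INR n) * (l * Rprod (fun k => s + INR k) n).
  rewrite [Rprod _ (S n)]/=. ring.
exact: h.
Qed.

(** From the tangent line of [x^t] at [x = a]. *)
Lemma gam_log_convex (a t l m : R) : 0 < a -> 0 <= t <= 1 ->
  improp (gam a) l -> improp (gam (a + t)) m -> m <= Rpower a t * l.
Proof.
move=> Ha Ht Hl Hm.
have H1 := gam_succ _ _ Ha Hl.
have H2 := improp_plus _ _ _ _ (improp_scal (Rpower a t * (1 - t)) _ _ Hl)
  (improp_scal (Rpower a t * (t / a)) _ _ H1).
have -> : Rpower a t * l = Rpower a t * (1 - t) * l + Rpower a t * (t / a) * (a * l) by field; lra.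
apply: (improp_le _ _ _ _ _ Hm H2) => x Hx.
have hc := Rpower_concave t (x / a) Ht ltac:(exact: Rdiv_lt_0_compat).
have -> : gam (a + t) x = gam a x * (Rpower a t * Rpower (x / a) t).
  rewrite -Rpower_Rmult //; last exact: Rdiv_lt_0_compat.
  have -> : a * (x / a) = x by field; lra.
  rewrite /gam. have -> : a + t - 1 = (a - 1) + t by ring. rewrite Rpower_plus. ring.
have -> : gam (a + 1) x = gam a x * x.
  rewrite /gam. have -> : a + 1 - 1 = a by ring. rewrite Rpower_pred //. field. lra.
have hg := gam_pos a x. have hp := Rpower_pos a t.
have -> : Rpower a t * (1 - t) * gam a x + Rpower a t * (t / a) * (gam a x * x) =
  gam a x * (Rpower a t * (1 + t * (x / a - 1))) by field; lra.
apply: Rmult_le_compat_l; first lra. apply: Rmult_le_compat_l; lra.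
Qed.

Definition Rrgamma_n (n : nat) (s : R) : R :=
  Rpower (INR n) (- s) * (Rprod (fun k => s + INR k) (S n) * / INR (fact n)).

Lemma lim_affine_ratio (c d : R) : is_lim_seq (fun n => (INR n + c) / (INR n + d)) 1.
Proof.
have L : is_lim_seq (fun n => (1 + c * / INR n) * / (1 + d * / INR n)) ((1 + c * 0) * / (1 + d * 0)).
  have Li : is_lim_seq (fun n => / INR n) 0.
    have := is_lim_seq_inv _ _ is_lim_seq_INR. by apply.
  have La : forall e, is_lim_seq (fun n => 1 + e * / INR n) (1 + e * 0).
    move=> e. apply: is_lim_seq_plus'; first exact: is_lim_seq_const.
    apply: is_lim_seq_mult' => //. exact: is_lim_seq_const.
  apply: is_lim_seq_mult' => //. apply: is_lim_seq_inv0 => //. lra.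
have E : (1 + c * 0) * / (1 + d * 0) = 1 by field; lra.
rewrite E in L. apply: is_lim_seq_ext_loc L.
have [N HN] : exists N : nat, Rabs d < INR N by exact: INR_unbounded.
exists (S N) => n Hn. have hn : INR N < INR n by apply: lt_INR; lia.
have hd := Rle_abs (- d). rewrite Rabs_Ropp in hd.
have h0 : 0 < INR n by apply: lt_0_INR; lia.
field. repeat split; lra.
Qed.

(** The Bohr-Mollerup argument: log-convexity compares the integral at [s + n + 1] with the
    factorials that are the integrals at [n + 1] and [n + 2], and this squeezes
    [g * Rrgamma_n n s]. *)
Lemma gamma_integral (s : R) : 0 < s < 1 ->
  exists g, improp (gam s) g /\ is_lim_seq (fun n => g * Rrgamma_n n s) 1.
Proof.
move=> Hs. have [g Hg] := gam_ex s ltac:(lra). exists g; split=> //.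
have hb : forall n, (1 <= n)%nat -> (INR n + 1) / (INR n + 2) <= g * Rrgamma_n n s <= (INR n + 1) / (INR n + 0).
  move=> n Hn. have hn : 0 < INR n by apply: lt_0_INR; lia.
  have hf := INR_fact_lt_0 n.
  have H := gam_shift s g (S n) ltac:(lra) Hg. rewrite S_INR in H.
  have -> : g * Rrgamma_n n s = g * Rprod (fun k => s + INR k) (S n) / INR (fact n) * Rpower (INR n) (- s).
    rewrite /Rrgamma_n. field. lra.
  set P := g * Rprod (fun k => s + INR k) (S n) in H *.
  have hns := Rpower_pos (INR n) s. have hns2 := Rpower_pos (INR n) (- s).
  have hone : Rpower (INR n) (- s) * Rpower (INR n) s = 1.
    by rewrite -Rpower_plus Rplus_opp_l Rpower_O.
  have up : P <= Rpower (INR n + 1) s * INR (fact n).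
    apply: (gam_log_convex (INR n + 1) s _ _ ltac:(lra) ltac:(lra) (gam_nat n)).
    by have -> : INR n + 1 + s = s + (INR n + 1) by ring.
  have lo : INR (fact n) * (INR n + 1) <= Rpower (INR n + s + 1) (1 - s) * P.
    have E1 : s + (INR n + 1) = INR n + s + 1 by ring. rewrite E1 in H.
    have := gam_nat (S n). rewrite fact_simpl mult_INR S_INR Rmult_comm => H2.
    apply: (gam_log_convex (INR n + s + 1) (1 - s) _ _ ltac:(lra) ltac:(lra) H).
    by have -> : INR n + s + 1 + (1 - s) = INR n + 1 + 1 by ring.
  split.
  - apply/Rle_div_l; first lra.
    have h1 : Rpower (INR n + s + 1) (1 - s) * Rpower (INR n) s <= INR n + 2.
      apply: (Rle_trans _ (Rpower (INR n + 2) (1 - s) * Rpower (INR n + 2) s)).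
        apply: Rmult_le_compat; try (left; exact: Rpower_pos); apply: Rpower_le_base; lra.
      rewrite -Rpower_plus. have -> : 1 - s + s = 1 by ring. rewrite Rpower_1; lra.
    have h2 : 0 < P / INR (fact n) * Rpower (INR n) (- s).
      have hP : 0 < P.
        have h3 := Rpower_pos (INR n + s + 1) (1 - s). have h4 : 0 < INR (fact n) * (INR n + 1) by apply: Rmult_lt_0_compat; lra.
        apply: (Rmult_lt_reg_l (Rpower (INR n + s + 1) (1 - s))) => //. lra.
      apply: Rmult_lt_0_compat => //. exact: Rdiv_lt_0_compat.
    apply: Rle_trans; last (apply: Rmult_le_compat_l; [lra|exact: h1]).
    have -> : P / INR (fact n) * Rpower (INR n) (- s) * (Rpower (INR n + s + 1) (1 - s) * Rpower (INR n) s) =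
      (Rpower (INR n + s + 1) (1 - s) * P) / INR (fact n) * (Rpower (INR n) (- s) * Rpower (INR n) s) by field; lra.
    rewrite hone Rmult_1_r. apply/Rle_div_r => //. lra.
  - rewrite Rplus_0_r.
    apply: (Rle_trans _ (Rpower (INR n + 1) s * Rpower (INR n) (- s))).
      apply: Rmult_le_compat_r; first lra. apply/Rle_div_l => //.
    have -> : Rpower (INR n + 1) s * Rpower (INR n) (- s) = Rpower ((INR n + 1) / INR n) s.
      rewrite /Rdiv Rpower_Rmult; [|lra|exact: Rinv_0_lt_compat]. f_equal.
      rewrite /Rpower ln_Rinv //. f_equal. ring.
    have h1 : 1 <= (INR n + 1) / INR n by apply/Rle_div_r; lra.
    rewrite -{2}(Rpower_1 ((INR n + 1) / INR n)); last lra.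
    apply: Rle_Rpower; lra.
apply: (is_lim_seq_le_le_loc (fun n => (INR n + 1) / (INR n + 2)) _ (fun n => (INR n + 1) / (INR n + 0))).
- exists 1%nat. exact: hb.
- exact: lim_affine_ratio.
- exact: lim_affine_ratio.
Qed.

(** Only [c = 1] is wanted, for the Mellin transform of one partial fraction. The exponent is freed
    so that steps from [c] to [c + 1] play the part that steps from [s] to [s + 1] play for
    [gam]. *)
Definition bet (s c u : R) : R := Rpower u s * Rpower (1 + u ^ 2) (- c).

Lemma bet_pos (s c u : R) : 0 < bet s c u.
Proof. apply: Rmult_lt_0_compat; exact: Rpower_pos. Qed.

Lemma is_derive_Rpower_sq (c u : R) :
  is_derive (fun u => Rpower (1 + u ^ 2) c) u (2 * u * c * Rpower (1 + u ^ 2) (c - 1)).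
Proof.
have h : 0 < 1 + u ^ 2 by have := pow2_ge_0 u; lra.
rewrite Rpower_pred // /Rpower. auto_derive; first by rewrite /= in h.
rewrite /= in h *. field. lra.
Qed.

Lemma bet_continuous (s c u : R) : 0 < u -> continuous (bet s c) u.
Proof.
move=> Hu. apply: (continuous_mult (K := R_AbsRing)); first exact: continuous_Rpower.
exact: continuous_of_derive (is_derive_Rpower_sq _ _).
Qed.

Lemma bet_succ (s c u : R) : bet s (c + 1) u * (1 + u ^ 2) = bet s c u.
Proof.
have h : 0 < 1 + u ^ 2 by have := pow2_ge_0 u; lra.
rewrite /bet. have -> : - (c + 1) = - c - 1 by ring. rewrite Rpower_pred //. field. lra.
Qed.

(** The integrand is the derivative of [u^(s + 1) (1 + u^2)^(- c)], and the condition on [c] makes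
    this vanish at infinity. *)
Lemma bet_by_parts (s c : R) : 0 < s -> (1 + s) / 2 < c ->
  improp (fun u => (s + 1 - 2 * c) * bet s c u + 2 * c * bet s (c + 1) u) 0.
Proof.
move=> Hs Hc. rewrite -(Rminus_0_r 0).
apply: (improp_FTC (fun u => Rpower u (s + 1) * Rpower (1 + u ^ 2) (- c))).
- move=> u Hu.
  have -> : (s + 1 - 2 * c) * bet s c u + 2 * c * bet s (c + 1) u =
    ((s + 1) * Rpower u (s + 1 - 1)) * Rpower (1 + u ^ 2) (- c) +
    Rpower u (s + 1) * (2 * u * (- c) * Rpower (1 + u ^ 2) (- c - 1)).
    rewrite -(bet_succ s c u) /bet. have -> : - (c + 1) = - c - 1 by ring.
    have -> : s + 1 - 1 = s by ring.
    have h : 0 < 1 + u ^ 2 by have := pow2_ge_0 u; lra.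
    rewrite (Rpower_pred (1 + u ^ 2)) // Rpower_plus (Rpower_1 u) //. field. lra.
  apply: (is_derive_mult (K := R_AbsRing)); [exact: is_derive_Rpower|exact: is_derive_Rpower_sq|exact: Rmult_comm].
- move=> u Hu. apply: (continuous_plus (V := R_NormedModule));
    apply: (continuous_scal_r (K := R_AbsRing) (V := R_NormedModule)); exact: bet_continuous.
- apply: (lim0_squeeze _ (fun u => Rpower u (s + 1)) 1); last by apply: lim0_Rpower; lra.
  move=> u Hu. have h1 := Rpower_pos u (s + 1). have h2 := Rpower_pos (1 + u ^ 2) (- c).
  rewrite Rabs_pos_eq; last nra.
  have : Rpower (1 + u ^ 2) (- c) <= 1; last nra.
  have h : 1 <= 1 + u ^ 2 by have := pow2_ge_0 u; lra.
  apply: (Rle_trans _ (Rpower (1 + u ^ 2) 0)); [apply: Rle_Rpower; lra|rewrite Rpower_O; lra].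
- apply: (liminfty_squeeze _ (fun u => Rpower u (s + 1 - 2 * c)) 1); last by apply: liminfty_Rpower; lra.
  move=> u Hu. have h1 := Rpower_pos u (s + 1). have h2 := Rpower_pos (1 + u ^ 2) (- c).
  rewrite Rabs_pos_eq; last nra.
  rewrite Rmult_1_l. have -> : s + 1 - 2 * c = s + 1 + - (2 * c) by ring. rewrite (Rpower_plus (s + 1) (- (2 * c))).
  apply: Rmult_le_compat_l; first lra.
  have -> : Rpower u (- (2 * c)) = Rpower (u ^ 2) (- c).
    have -> : u ^ 2 = u * u by ring. rewrite Rpower_Rmult // -Rpower_plus. f_equal. ring.
  have hu := pow_lt u 2 Hu.
  rewrite !Rpower_Ropp. apply: Rinv_le_contravar; first exact: Rpower_pos.
  apply: Rpower_le_base; lra.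
Qed.

(** Read downwards, the recurrence yields existence as well as the value; this is how the exponent 1
    is reached from the exponent 2. *)
Lemma bet_down (s c m : R) : 0 < s -> (1 + s) / 2 < c -> improp (bet s (c + 1)) m ->
  improp (bet s c) (m * c / (c - (1 + s) / 2)).
Proof.
move=> Hs Hc Hm.
have H := improp_scal (/ (2 * c - (1 + s))) _ _ (improp_minus _ _ _ _ (improp_scal (2 * c) _ _ Hm) (bet_by_parts s c Hs Hc)).
have E : / (2 * c - (1 + s)) * (2 * c * m - 0) = m * c / (c - (1 + s) / 2) by field; lra.
rewrite E in H. apply: improp_ext H => u Hu. field. lra.
Qed.

Lemma bet_up (s c l m : R) : 0 < s -> (1 + s) / 2 < c -> improp (bet s c) l ->
  improp (bet s (c + 1)) m -> m = l * (c - (1 + s) / 2) / c.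
Proof.
move=> Hs Hc Hl Hm. have := improp_unique _ _ _ Hl (bet_down _ _ _ Hs Hc Hm).
move=> ->. field. lra.
Qed.

Lemma bet_le (s c d u : R) : c <= d -> bet s d u <= bet s c u.
Proof.
move=> H. apply: Rmult_le_compat_l; first by left; exact: Rpower_pos.
apply: Rle_Rpower; last lra. have := pow2_ge_0 u. lra.
Qed.

Lemma bet_mono_ex (s c d l : R) : c <= d -> improp (bet s c) l -> exists m, improp (bet s d) m.
Proof.
move=> H Hl. apply: (improp_dominated _ (bet s c) l) => //; first exact: bet_continuous.
move=> u Hu. split; [left; exact: bet_pos|exact: bet_le].
Qed.

(** The exponent at which there is an elementary primitive, [(u^2 / (1 + u^2))^a / (2 a)] with
    [a = (1 + s) / 2]. *)
Lemma bet_base (s : R) : 0 < s < 1 -> improp (bet s ((1 + s) / 2 + 1)) (/ (1 + s)).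
Proof.
move=> Hs. pose a := (1 + s) / 2. rewrite -/a. have Ea : 1 + s = 2 * a by rewrite /a; field.
have Ha : 0 < a < 1 by rewrite /a; lra.
rewrite -(Rminus_0_r (/ (1 + s))) Ea.
have E : forall u, 0 < u -> Rpower u (2 * a) * Rpower (1 + u ^ 2) (- a) = Rpower (u ^ 2 / (1 + u ^ 2)) a.
  move=> u Hu. have hu := pow_lt u 2 Hu.
  rewrite /Rdiv Rpower_Rmult //; last by apply: Rinv_0_lt_compat; lra.
  f_equal.
    have -> : u ^ 2 = u * u by ring. rewrite Rpower_Rmult // -Rpower_plus. f_equal. ring.
  rewrite /Rpower ln_Rinv; last lra. f_equal. ring.
have hf : forall u, 0 < u -> 0 < u ^ 2 / (1 + u ^ 2) <= 1.
  move=> u Hu. have hu := pow_lt u 2 Hu. split; first by apply: Rdiv_lt_0_compat; lra. apply/Rle_div_l; lra.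
apply: (improp_FTC (fun u => Rpower u (2 * a) * Rpower (1 + u ^ 2) (- a) * / (2 * a))).
- move=> u Hu.
  have -> : bet s (a + 1) u = (((2 * a) * Rpower u (2 * a - 1)) * Rpower (1 + u ^ 2) (- a) +
    Rpower u (2 * a) * (2 * u * (- a) * Rpower (1 + u ^ 2) (- a - 1))) * / (2 * a).
    have hu := pow_lt u 2 Hu.
    rewrite /bet. have -> : - (a + 1) = - a - 1 by ring. have -> : s = 2 * a - 1 by lra.
    rewrite !Rpower_pred //; last lra. field. lra.
  have H := is_derive_mult (K := R_AbsRing) _ _ u _ _ (is_derive_Rpower (2 * a) u Hu) (is_derive_Rpower_sq (- a) u) Rmult_comm.
  have := is_derive_scal _ u (/ (2 * a)) _ H.
  move=> H2. rewrite (Rmult_comm _ (/ (2 * a))).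
  apply: (is_derive_ext (fun u => / (2 * a) * (Rpower u (2 * a) * Rpower (1 + u ^ 2) (- a))));
    first by move=> t; exact: Rmult_comm.
  exact: H2.
- move=> u Hu. exact: bet_continuous.
- apply: (lim0_squeeze _ (fun u => Rpower u (2 * a)) (/ (2 * a))); last by apply: lim0_Rpower; lra.
  move=> u Hu. have h1 := Rpower_pos u (2 * a). have h2 := Rpower_pos (1 + u ^ 2) (- a).
  have hi : 0 < / (2 * a) by apply: Rinv_0_lt_compat; lra.
  rewrite Rabs_pos_eq; last by apply: Rmult_le_pos; nra.
  rewrite Rmult_comm. apply: Rmult_le_compat_l; first lra.
  have : Rpower (1 + u ^ 2) (- a) <= 1; last nra.
  have h : 1 <= 1 + u ^ 2 by have := pow2_ge_0 u; lra.
  apply: (Rle_trans _ (Rpower (1 + u ^ 2) 0)); [apply: Rle_Rpower; lra|rewrite Rpower_O; lra].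
- move=> eps He.
  have [B HB] := liminfty_Rpower (-1) ltac:(lra) (eps * (2 * a)) ltac:(nra).
  exists (Rmax B 1) => u Hu0 Hu. have hB := Rmax_l B 1. have hB1 := Rmax_r B 1.
  have := HB u Hu0 ltac:(lra).
  have -> : Rpower u (-1) = / u by rewrite Rpower_Ropp Rpower_1.
  rewrite Rminus_0_r Rabs_pos_eq; last by left; exact: Rinv_0_lt_compat.
  move=> h. rewrite E // -Rabs_Ropp.
  have [h1 h2] := Rpower_ge_self (u ^ 2 / (1 + u ^ 2)) a (hf u Hu0) ltac:(lra).
  have -> : - (Rpower (u ^ 2 / (1 + u ^ 2)) a * / (2 * a) - / (2 * a)) = (1 - Rpower (u ^ 2 / (1 + u ^ 2)) a) / (2 * a) by field; lra.
  rewrite Rabs_pos_eq; last by apply: Rdiv_le_0_compat; lra.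
  apply/Rlt_div_l; first lra.
  have hu := pow_lt u 2 Hu0.
  have : 1 - u ^ 2 / (1 + u ^ 2) <= / u; last lra.
  have -> : 1 - u ^ 2 / (1 + u ^ 2) = / (1 + u ^ 2) by field; lra.
  apply: Rinv_le_contravar; nra.
Qed.

(** Identifies [2 j] with the product of Gamma values at [(1 + s) / 2] and [(1 - s) / 2] without a
    double integral. The integral is known up to the factor [j] at the exponents [n + 1] ([C1]) and
    exactly at [a + n + 1] ([C2]). It decreases in the exponent, so the two interlacing sequences
    squeeze [j]. *)
Lemma beta_integral (s : R) : 0 < s < 1 ->
  exists j, improp (fun u => Rpower u s / (1 + u ^ 2)) j /\
    is_lim_seq (fun n => 2 * j * Rrgamma_n n ((1 + s) / 2) * Rrgamma_n n ((1 - s) / 2)) 1.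
Proof.
move=> Hs. pose a := (1 + s) / 2. pose b := (1 - s) / 2. rewrite -/a -/b.
have Ha : 0 < a < 1 by rewrite /a; lra.
have Eb : b = 1 - a by rewrite /a /b; field.
have Hbase := bet_base s Hs. rewrite -/a in Hbase.
have [m2 Hm2] : exists m, improp (bet s (1 + 1)) m by apply: bet_mono_ex Hbase; lra.
have Hj := bet_down s 1 m2 ltac:(lra) ltac:(rewrite -/a; lra) Hm2.
set j := m2 * 1 / _ in Hj.
have C1 : forall n, improp (bet s (INR n + 1)) (j * Rprod (fun k => b + INR k) n / INR (fact n)).
  elim=> [|n IH].
    rewrite /= Rplus_0_l. have -> : j * 1 / 1 = j by field. exact: Hj.
  have hn := pos_INR n.
  have [m Hm] : exists m, improp (bet s (INR n + 1 + 1)) m by apply: bet_mono_ex IH; lra.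
  have E := bet_up s (INR n + 1) _ _ ltac:(lra) ltac:(rewrite -/a; lra) IH Hm.
  rewrite S_INR. rewrite fact_simpl mult_INR S_INR.
  have -> : j * Rprod (fun k => b + INR k) (S n) / ((INR n + 1) * INR (fact n)) = m.
    rewrite E -/a [Rprod _ (S n)]/= Eb. have hf := INR_fact_lt_0 n. field. lra.
  exact: Hm.
have PApos : forall n, 0 < Rprod (fun k => a + INR k) n.
  elim=> [|n IH] /=; first lra. apply: Rmult_lt_0_compat => //. have := pos_INR n. lra.
have C2 : forall n, improp (bet s (a + INR n + 1)) (INR (fact n) / (2 * Rprod (fun k => a + INR k) (S n))).
  elim=> [|n IH].
    rewrite /= Rplus_0_r. have -> : 1 / (2 * (1 * a)) = / (1 + s) by rewrite /a; field; lra. exact: Hbase.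
  have hn := pos_INR n.
  have [m Hm] : exists m, improp (bet s (a + INR n + 1 + 1)) m by apply: bet_mono_ex IH; lra.
  have E := bet_up s (a + INR n + 1) _ _ ltac:(lra) ltac:(rewrite -/a; lra) IH Hm.
  have -> : a + INR (S n) + 1 = a + INR n + 1 + 1 by rewrite S_INR; ring.
  have -> : INR (fact (S n)) / (2 * Rprod (fun k => a + INR k) (S (S n))) = m; last exact: Hm.
  rewrite E -/a. have hP := PApos (S n).
  have -> : Rprod (fun k => a + INR k) (S (S n)) = Rprod (fun k => a + INR k) (S n) * (a + INR (S n)) by [].
  rewrite fact_simpl mult_INR S_INR. field. lra.
exists j. split.
  apply: improp_ext Hj => u Hu. have h : 0 < 1 + u ^ 2 by have := pow2_ge_0 u; lra.
  by rewrite /bet Rpower_Ropp Rpower_1.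
have hb : forall n, (1 <= n)%nat ->
    (INR n + b) / (INR n + 0) <= 2 * j * Rrgamma_n n a * Rrgamma_n n b <=
    ((INR n + b) / (INR n + 0)) * ((INR n + a) / (INR n + 0)).
  move=> n Hn. have hn : 0 < INR n by apply: lt_0_INR; lia.
  have hf := INR_fact_lt_0 n. have hP := PApos (S n). have hPn := PApos n.
  have lo : INR (fact n) / (2 * Rprod (fun k => a + INR k) (S n)) <= j * Rprod (fun k => b + INR k) n / INR (fact n).
    apply: (improp_le _ _ _ _ _ (C2 n) (C1 n)) => u Hu. apply: bet_le. lra.
  have up : j * Rprod (fun k => b + INR k) n / INR (fact n) <= INR (fact n) / (2 * Rprod (fun k => a + INR k) (S n)) * ((INR n + a) / INR n).
    (* The upper bound compares the exponent [n + 1] with [a + n], which is the exponent of [C2] at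
       the predecessor of [n]. *)
    have [p Hp] : exists p, n = S p by exists (pred n); lia.
    have hp := pos_INR p.
    have := improp_le _ _ _ _ _ (C1 n) (C2 p). rewrite Hp.
    have -> : INR (fact p) / (2 * Rprod (fun k => a + INR k) (S p)) =
       INR (fact (S p)) / (2 * Rprod (fun k => a + INR k) (S (S p))) * ((INR (S p) + a) / INR (S p)).
      have -> : Rprod (fun k => a + INR k) (S (S p)) = Rprod (fun k => a + INR k) (S p) * (a + INR (S p)) by [].
      have hPp := PApos (S p).
      rewrite fact_simpl mult_INR S_INR. field. lra.
    apply=> u Hu. apply: bet_le. rewrite S_INR. lra.
  have hpow : Rpower (INR n) (- a) * Rpower (INR n) (- b) = / INR n.
    rewrite -Rpower_plus Eb. have -> : - a + - (1 - a) = - (1) by ring. rewrite Rpower_Ropp Rpower_1 //.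
  set X := INR (fact n) / (2 * Rprod (fun k => a + INR k) (S n)) in lo up.
  have hX : 0 < X by apply: Rdiv_lt_0_compat; lra.
  have -> : 2 * j * Rrgamma_n n a * Rrgamma_n n b =
    (j * Rprod (fun k => b + INR k) n / INR (fact n)) / X * ((INR n + b) / INR n).
    have -> : 2 * j * Rrgamma_n n a * Rrgamma_n n b = (Rpower (INR n) (- a) * Rpower (INR n) (- b)) *
      (2 * j * (Rprod (fun k => a + INR k) (S n) * / INR (fact n)) * (Rprod (fun k => b + INR k) (S n) * / INR (fact n))).
      rewrite /Rrgamma_n. ring.
    rewrite hpow /X.
    have -> : Rprod (fun k => b + INR k) (S n) = Rprod (fun k => b + INR k) n * (b + INR n) by [].
    field. lra.
  have hbn : 0 < (INR n + b) / INR n by apply: Rdiv_lt_0_compat; lra.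
  rewrite !Rplus_0_r. split.
  - rewrite -{1}(Rmult_1_l ((INR n + b) / INR n)). apply: Rmult_le_compat_r; first lra.
    apply/Rle_div_r; lra.
  - rewrite Rmult_comm. apply: Rmult_le_compat_l; first lra. apply/Rle_div_l; lra.
apply: (is_lim_seq_le_le_loc (fun n => (INR n + b) / (INR n + 0)) _ (fun n => ((INR n + b) / (INR n + 0)) * ((INR n + a) / (INR n + 0)))).
- exists 1%nat. exact: hb.
- exact: lim_affine_ratio.
- have := is_lim_seq_mult' _ _ _ _ (lim_affine_ratio b 0) (lim_affine_ratio a 0). by rewrite Rmult_1_l.
Qed.

(** * The functional equation on the real interval (0, 1) *)

(** Tends to [zeta s] for [0 < s < 1]. *)
Definition zeta_approx (N : nat) (s : R) : R :=
  Rsum (fun k => Rpower (INR (S k)) (- s)) N - Rpower (INR N) (1 - s) / (1 - s).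

Lemma exp_moment (s g c : R) : 0 < c -> improp (gam s) g ->
  improp (fun x => Rpower x (s - 1) * exp (- (c * x))) (g * Rpower c (- s)).
Proof.
move=> Hc Hg. have H := improp_scal (Rpower c (1 - s)) _ _ (improp_scale c _ _ Hc Hg).
have E : Rpower c (1 - s) * (g / c) = g * Rpower c (- s).
  have -> : 1 - s = - s + 1 by ring. rewrite Rpower_plus Rpower_1 //. field. lra.
rewrite E in H. apply: improp_ext H => x Hx.
rewrite /gam Rpower_Rmult // -!Rmult_assoc -Rpower_plus.
have -> : 1 - s + (s - 1) = 0 by ring. rewrite Rpower_O //. ring.
Qed.

Lemma continuous_exp_lin (c x : R) : continuous (fun x => exp (- (c * x))) x.
Proof.
apply: (continuous_of_derive _ _ (- c * exp (- (c * x)))). auto_derive => //. ring.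
Qed.

(** Integration by parts reduces the integral to [exp_moment]. At [c = N] it produces the power
    subtracted in [zeta_approx N s]. *)
Lemma exp_diff_moment (s g c : R) : 0 < s < 1 -> 0 < c -> improp (gam s) g ->
  improp (fun x => Rpower x (s - 1) * ((1 - exp (- (c * x))) / x)) (g * (Rpower c (1 - s) / (1 - s))).
Proof.
move=> Hs Hc Hg. have H := exp_moment s g c Hc Hg.
have he : forall x, 0 < x -> 0 <= 1 - exp (- (c * x)) <= c * x /\ 1 - exp (- (c * x)) <= 1.
  move=> x Hx. have hcx : 0 < c * x by exact: Rmult_lt_0_compat.
  have := exp_ineq1_le (- (c * x)). have := exp_pos (- (c * x)).
  have : exp (- (c * x)) < 1 by rewrite -exp_0; apply: exp_increasing; lra. lra.
have HF : improp (fun x => Rpower x (s - 1) * ((1 - exp (- (c * x))) / x) -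
    c / (1 - s) * (Rpower x (s - 1) * exp (- (c * x)))) (0 - 0).
  apply: (improp_FTC (fun x => (Rpower x (s - 1) * (1 - exp (- (c * x)))) * / (s - 1))).
  - move=> x Hx.
    have D1 := is_derive_mult (K := R_AbsRing) _ (fun x => 1 - exp (- (c * x))) x _ (c * exp (- (c * x)))
      (is_derive_Rpower (s - 1) x Hx) ltac:(auto_derive => //; ring) Rmult_comm.
    have D2 := is_derive_scal _ x (/ (s - 1)) _ D1.
    have -> : Rpower x (s - 1) * ((1 - exp (- (c * x))) / x) - c / (1 - s) * (Rpower x (s - 1) * exp (- (c * x))) =
      / (s - 1) * (((s - 1) * Rpower x (s - 1 - 1)) * (1 - exp (- (c * x))) + Rpower x (s - 1) * (c * exp (- (c * x)))).
      rewrite (Rpower_pred x (s - 1)) //. field. lra.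
    apply: (is_derive_ext (fun x => / (s - 1) * (Rpower x (s - 1) * (1 - exp (- (c * x)))))); last exact: D2.
    move=> t. exact: Rmult_comm.
  - move=> x Hx.
    have Ce : continuous (fun x => 1 - exp (- (c * x))) x.
      apply: (continuous_minus (V := R_NormedModule)); [exact: continuous_const|exact: continuous_exp_lin].
    apply: (continuous_minus (V := R_NormedModule)).
      apply: (continuous_mult (K := R_AbsRing)); first exact: continuous_Rpower.
      apply: (continuous_mult (K := R_AbsRing)) => //. apply: continuous_Rinv. lra.
    apply: (continuous_scal_r (K := R_AbsRing) (V := R_NormedModule)).
    apply: (continuous_mult (K := R_AbsRing)); [exact: continuous_Rpower|exact: continuous_exp_lin].
  - apply: (lim0_squeeze _ (fun x => Rpower x s) (c / (1 - s))); last by apply: lim0_Rpower; lra.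
    move=> x Hx. have [h1 h2] := he x Hx. have hp := Rpower_pos x (s - 1).
    have -> : Rpower x (s - 1) * (1 - exp (- (c * x))) * / (s - 1) = - (Rpower x (s - 1) * (1 - exp (- (c * x))) / (1 - s)) by field; lra.
    rewrite Rabs_Ropp Rabs_pos_eq; last by apply: Rdiv_le_0_compat; [apply: Rmult_le_pos; lra|lra].
    have -> : Rpower x s = Rpower x (s - 1) * x by rewrite Rpower_pred //; field; lra.
    have -> : c / (1 - s) * (Rpower x (s - 1) * x) = Rpower x (s - 1) * (c * x) / (1 - s) by field; lra.
    apply: Rmult_le_compat_r; first by left; apply: Rinv_0_lt_compat; lra.
    apply: Rmult_le_compat_l; lra.
  - apply: (liminfty_squeeze _ (fun x => Rpower x (s - 1)) (/ (1 - s))); last by apply: liminfty_Rpower; lra.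
    move=> x Hx. have [h1 h2] := he x Hx. have hp := Rpower_pos x (s - 1).
    have -> : Rpower x (s - 1) * (1 - exp (- (c * x))) * / (s - 1) = - (/ (1 - s) * (Rpower x (s - 1) * (1 - exp (- (c * x))))) by field; lra.
    have hi : 0 < / (1 - s) by apply: Rinv_0_lt_compat; lra.
    rewrite Rabs_Ropp Rabs_pos_eq; last by apply: Rmult_le_pos; [lra|apply: Rmult_le_pos; lra].
    apply: Rmult_le_compat_l; [lra|nra].
have H2 := improp_plus _ _ _ _ HF (improp_scal (c / (1 - s)) _ _ H).
have E : 0 - 0 + c / (1 - s) * (g * Rpower c (- s)) = g * (Rpower c (1 - s) / (1 - s)).
  have -> : 1 - s = - s + 1 by ring. rewrite Rpower_plus Rpower_1 //. field. lra.
rewrite E in H2. apply: improp_ext H2 => x Hx. ring.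
Qed.

Lemma exp_minus_1_pos (x : R) : 0 < x -> 0 < exp x - 1.
Proof. move=> Hx. have := exp_ineq1 x. lra. Qed.

(** The geometric sum and its correction share the factor [1 - exp (- (N x))], so the distance from
    [bose x] is just [exp (- (N x)) * bose x] up to sign. *)
Lemma bose_partial_sum (x : R) (N : nat) : 0 < x ->
  Rsum (fun k => exp (- (INR (S k) * x))) N - (1 - exp (- (INR N * x))) / x =
  (1 - exp (- (INR N * x))) * bose x.
Proof.
move=> Hx. have h := exp_minus_1_pos x Hx.
have -> : Rsum (fun k => exp (- (INR (S k) * x))) N = (1 - exp (- (INR N * x))) / (exp x - 1).
  elim: N => [|n IH]; first by rewrite /= Rmult_0_l Ropp_0 exp_0 /Rdiv Rminus_diag Rmult_0_l.
  rewrite Rsum_S IH.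
  have -> : exp (- (INR n * x)) = exp (- (INR (S n) * x)) * exp x.
    rewrite -exp_plus S_INR. f_equal. ring.
  field. lra.
rewrite /bose. field. lra.
Qed.

Lemma phi_moment (s j c : R) : 0 < c -> improp (fun u => Rpower u s / (1 + u ^ 2)) j ->
  improp (fun x => Rpower x (s - 1) * (2 * x / (x ^ 2 + c ^ 2))) (2 * Rpower c (s - 1) * j).
Proof.
move=> Hc Hj. have hi := Rinv_0_lt_compat _ Hc.
have H := improp_scal (2 * Rpower c (s - 2)) _ _ (improp_scale (/ c) _ _ hi Hj).
have Ec : Rpower c (s - 1) = Rpower c (s - 2) * c.
  have -> : s - 2 = s - 1 - 1 by ring. rewrite (Rpower_pred c (s - 1)) //. field. lra.
have E : 2 * Rpower c (s - 2) * (j / / c) = 2 * Rpower c (s - 1) * j by rewrite Ec; field; lra.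
rewrite E in H. apply: improp_ext H => x Hx.
have hc2 := pow_lt c 2 Hc. have hx2 := pow_lt x 2 Hx.
rewrite Rpower_Rmult //.
have -> : Rpower (/ c) s = / Rpower c s by rewrite -Rpower_Ropp /Rpower ln_Rinv //; f_equal; ring.
have -> : Rpower c (s - 2) = Rpower c s / c / c.
  have -> : s - 2 = s - 1 - 1 by ring. by rewrite !Rpower_pred.
rewrite Rpower_pred //. have hp := Rpower_pos c s.
have h1 : 0 < 1 + (/ c * x) ^ 2 by have := pow2_ge_0 (/ c * x); lra.
field. repeat split; try lra.
Qed.

Lemma atan_le (t : R) : 0 <= t -> 0 <= atan t <= t.
Proof.
move=> Ht. case: (Req_dec t 0) => [->|Hn]; first by rewrite atan_0; lra.
have [c [Hc1 Hc2]] := MVT_cor2 atan (fun x => / (1 + x ^ 2)) 0 t ltac:(lra)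
  ltac:(move=> x Hx; apply/is_derive_Reals; auto_derive => //; field; nra).
rewrite atan_0 !Rminus_0_r in Hc1. rewrite Hc1.
have h : 1 <= 1 + c ^ 2 by have := pow2_ge_0 c; lra.
have h1 : 0 < / (1 + c ^ 2) by apply: Rinv_0_lt_compat; lra.
have h2 : / (1 + c ^ 2) <= 1 by rewrite -Rinv_1; apply: Rinv_le_contravar; lra.
nra.
Qed.

(** By parts this reduces to [phi_moment]. At [c = 2 PI N] it produces the power [N^s / s]
    subtracted in [zeta_approx N (1 - s)]. *)
Lemma atan_moment (s j c : R) : 0 < s < 1 -> 0 < c -> improp (fun u => Rpower u s / (1 + u ^ 2)) j ->
  improp (fun x => Rpower x (s - 1) * (PI / 2 - atan (x / c))) (Rpower c s * j / s).
Proof.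
move=> Hs Hc Hj. have hpi := PI_RGT_0.
have H := improp_scal (c / (2 * s)) _ _ (phi_moment s j c Hc Hj).
have hat : forall x, 0 < x -> 0 <= PI / 2 - atan (x / c) <= c / x.
  move=> x Hx. have hxc : 0 < x / c by exact: Rdiv_lt_0_compat.
  rewrite -atan_inv //. have := atan_le (/ (x / c)) ltac:(left; exact: Rinv_0_lt_compat).
  have -> : / (x / c) = c / x by field; lra. done.
have Dat : forall x, is_derive (fun x => PI / 2 - atan (x / c)) x (- (c / (x ^ 2 + c ^ 2))).
  move=> x. have hc2 := pow_lt c 2 Hc. have hx2 := pow2_ge_0 x.
  auto_derive; first by []. field. rewrite /= in hc2 hx2. repeat split; try lra; nra.
have HF : improp (fun x => Rpower x (s - 1) * (PI / 2 - atan (x / c)) -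
    c / (2 * s) * (Rpower x (s - 1) * (2 * x / (x ^ 2 + c ^ 2)))) (0 - 0).
  apply: (improp_FTC (fun x => (Rpower x s * (PI / 2 - atan (x / c))) * / s)).
  - move=> x Hx.
    have D1 := is_derive_mult (K := R_AbsRing) _ _ x _ _ (is_derive_Rpower s x Hx) (Dat x) Rmult_comm.
    have D2 := is_derive_scal _ x (/ s) _ D1.
    have -> : Rpower x (s - 1) * (PI / 2 - atan (x / c)) - c / (2 * s) * (Rpower x (s - 1) * (2 * x / (x ^ 2 + c ^ 2))) =
      / s * ((s * Rpower x (s - 1)) * (PI / 2 - atan (x / c)) + Rpower x s * (- (c / (x ^ 2 + c ^ 2)))).
      have hc2 := pow_lt c 2 Hc. have hx2 := pow_lt x 2 Hx. rewrite Rpower_pred //. field. lra.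
    apply: (is_derive_ext (fun x => / s * (Rpower x s * (PI / 2 - atan (x / c))))); last exact: D2.
    move=> t. exact: Rmult_comm.
  - move=> x Hx. apply: (continuous_minus (V := R_NormedModule)).
      apply: (continuous_mult (K := R_AbsRing)); [exact: continuous_Rpower|exact: continuous_of_derive (Dat x)].
    exact: (proj1 H).
  - apply: (lim0_squeeze _ (fun x => Rpower x s) (PI / 2 / s)); last by apply: lim0_Rpower; lra.
    move=> x Hx. have [h1 h2] := hat x Hx. have hp := Rpower_pos x s.
    have hxc : 0 < x / c by exact: Rdiv_lt_0_compat.
    have h3 : 0 <= atan (x / c) by have := atan_le (x / c); lra.
    have hi : 0 < / s by apply: Rinv_0_lt_compat; lra.
    rewrite Rabs_pos_eq; last by apply: Rmult_le_pos; [apply: Rmult_le_pos; lra|lra].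
    have -> : PI / 2 / s * Rpower x s = Rpower x s * (PI / 2) * / s by field; lra.
    apply: Rmult_le_compat_r; first lra. apply: Rmult_le_compat_l; lra.
  - apply: (liminfty_squeeze _ (fun x => Rpower x (s - 1)) (c / s)); last by apply: liminfty_Rpower; lra.
    move=> x Hx. have [h1 h2] := hat x Hx. have hp := Rpower_pos x s.
    have hi : 0 < / s by apply: Rinv_0_lt_compat; lra.
    rewrite Rabs_pos_eq; last by apply: Rmult_le_pos; [apply: Rmult_le_pos; lra|lra].
    rewrite Rpower_pred //.
    have -> : c / s * (Rpower x s / x) = Rpower x s * (c / x) * / s by field; lra.
    apply: Rmult_le_compat_r; first lra. apply: Rmult_le_compat_l; lra.
have H2 := improp_plus _ _ _ _ HF H.
have E : 0 - 0 + c / (2 * s) * (2 * Rpower c (s - 1) * j) = Rpower c s * j / s.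
  rewrite Rpower_pred //. field. lra.
rewrite E in H2. apply: improp_ext H2 => x Hx. ring.
Qed.

(** A primitive of [phi_at x] in [t]. For [x > 0] it tends to 0 at infinity and to [- 1/2] at 0, so
    [/ 2 + atan_prim x N] is the integral of [phi_at x] over [[0, N]]. *)
Definition atan_prim (x t : R) : R := - (atan (x / (2 * PI * t)) / PI).
Definition phi_at (x t : R) : R := 2 * x / (x ^ 2 + (2 * PI * t) ^ 2).

Lemma phi_at_decr (x t u : R) : 0 < x -> 0 < t <= u -> phi_at x u <= phi_at x t.
Proof.
move=> Hx Ht. have hpi := PI_RGT_0. have hx2 := pow_lt x 2 Hx.
rewrite /phi_at. apply: Rmult_le_compat_l; first lra.
apply: Rinv_le_contravar.
  have := pow2_ge_0 (2 * PI * t). lra.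
apply: Rplus_le_compat_l. apply: pow_incr. nra.
Qed.

Lemma atan_prim_step (x t : R) : 0 < x -> 0 < t ->
  phi_at x (t + 1) <= atan_prim x (t + 1) - atan_prim x t <= phi_at x t.
Proof.
move=> Hx Ht. have hpi := PI_RGT_0.
have hD : forall u, t <= u <= t + 1 -> derivable_pt_lim (atan_prim x) u (phi_at x u).
  move=> u Hu. apply/is_derive_Reals. rewrite /atan_prim /phi_at.
  have h2 : 0 < PI * u by nra. have hx2 := pow_lt x 2 Hx. have hp2 := pow_lt _ 2 h2.
  auto_derive; first by repeat split; nra.
  field. rewrite /= in hx2 hp2. repeat split; try lra; nra.
have [c [Hc1 Hc2]] := MVT_cor2 (atan_prim x) (phi_at x) t (t + 1) ltac:(lra) hD.
have E : t + 1 - t = 1 by ring. rewrite E Rmult_1_r in Hc1. rewrite Hc1.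
split; apply: phi_at_decr; lra.
Qed.

(** The integral test: the middle quantity is the sum of [phi_at x] over the integers beyond [N]
    minus its integral from [N] to infinity, and [phi_at x] is decreasing. *)
Lemma bose_remainder (x : R) (N : nat) : 0 < x -> (1 <= N)%nat ->
  - phi_at x (INR N) <=
  bose x - (Rsum (bose_term x) N - / PI * (PI / 2 - atan (x / (2 * PI * INR N)))) <= 0.
Proof.
move=> Hx HN. have hpi := PI_RGT_0. have hN : 0 < INR N by apply: lt_0_INR; lia.
(* The last [phi_at] term in the lower bound lets the induction close; being nonnegative, it is
   dropped before the limit. *)
have Hb : forall M, atan_prim x (INR (N + M)) - atan_prim x (INR N) - phi_at x (INR N) + phi_at x (INR (N + M))
    <= Rsum (fun i => bose_term x (N + i)) M <= atan_prim x (INR (N + M)) - atan_prim x (INR N).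
  elim=> [|M IH]; first by rewrite Nat.add_0_r /=; lra.
  rewrite Rsum_S.
  have hM : 0 < INR (N + M) by apply: lt_0_INR; lia.
  have := atan_prim_step x (INR (N + M)) Hx hM.
  rewrite Nat.add_succ_r S_INR.
  have -> : bose_term x (N + M) = phi_at x (INR (N + M) + 1) by rewrite /bose_term /phi_at -S_INR.
  lra.
have LS := is_lim_seq_minus' _ _ _ _ (proj1 (is_lim_seq_incr_n _ N _) (bose_partial_fractions x Hx)) (is_lim_seq_const (Rsum (bose_term x) N)).
have {}LS : is_lim_seq (fun M => Rsum (fun i => bose_term x (N + i)) M) (bose x + / 2 - Rsum (bose_term x) N).
  apply: is_lim_seq_ext LS => M. rewrite Nat.add_comm Rsum_app. ring.
have LA : is_lim_seq (fun M => atan_prim x (INR (N + M))) 0.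
  have H0 : is_lim_seq (fun M => x / (2 * PI) * / INR (M + N)) (x / (2 * PI) * 0).
    apply: is_lim_seq_mult'; first exact: is_lim_seq_const.
    apply: (proj1 (is_lim_seq_incr_n (fun n => / INR n) N 0)).
    have := is_lim_seq_inv _ _ is_lim_seq_INR. by apply.
  rewrite Rmult_0_r in H0.
  have H1 : is_lim_seq (fun M => atan (x / (2 * PI) * / INR (M + N))) (atan 0).
    apply: is_lim_seq_continuous => //. apply: derivable_continuous_pt. exact: derivable_pt_atan.
  rewrite atan_0 in H1.
  have H2 := is_lim_seq_mult' _ _ _ _ H1 (is_lim_seq_const (- / PI)). rewrite Rmult_0_l in H2.
  apply: is_lim_seq_ext H2 => M. rewrite /atan_prim Nat.add_comm.
  have hM : 0 < INR (N + M) by apply: lt_0_INR; lia.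
  have -> : x / (2 * PI) * / INR (N + M) = x / (2 * PI * INR (N + M)) by field; lra.
  field. lra.
have LA2 := is_lim_seq_minus' _ _ _ _ LA (is_lim_seq_const (atan_prim x (INR N))).
have LA3 := is_lim_seq_minus' _ _ _ _ LA2 (is_lim_seq_const (phi_at x (INR N))).
have h1 := is_lim_seq_le _ _ _ _ (fun M => proj2 (Hb M)) LS LA2.
have h2 := is_lim_seq_le _ _ (0 - atan_prim x (INR N) - phi_at x (INR N)) _ _ LA3 LS.
rewrite /= in h1 h2.
have {}h2 : 0 - atan_prim x (INR N) - phi_at x (INR N) <= bose x + / 2 - Rsum (bose_term x) N.
  apply: h2 => M. have := proj1 (Hb M).
  have : 0 <= phi_at x (INR (N + M)); last lra.
  apply: Rdiv_le_0_compat; first lra. have := pow_lt x 2 Hx. have := pow2_ge_0 (2 * PI * INR (N + M)). lra.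
have E : / PI * (PI / 2 - atan (x / (2 * PI * INR N))) = / 2 + atan_prim x (INR N).
  rewrite /atan_prim. field. lra.
rewrite E. lra.
Qed.

Lemma bose_bounds (x : R) : 0 < x -> - / 2 <= bose x <= 0.
Proof.
move=> Hx. have hpi := PI_RGT_0. split.
- have := is_lim_seq_le (fun _ => 0) _ 0 _ _ (is_lim_seq_const 0) (bose_partial_fractions x Hx).
  rewrite /= => h. have : 0 <= bose x + / 2; last lra.
  apply: h => n. apply: Rsum_nonneg => k. apply: Rdiv_le_0_compat; first lra.
  have := pow_lt x 2 Hx. have := pow2_ge_0 (2 * PI * INR (S k)). lra.
- rewrite /bose. have h := exp_minus_1_pos x Hx.
  have : / (exp x - 1) <= / x; last lra.
  apply: Rinv_le_contravar => //. have := exp_ineq1_le x. lra.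
Qed.

Lemma improp_Rsum (f : nat -> R -> R) (l : nat -> R) (N : nat) :
  (forall k, improp (f k) (l k)) -> improp (fun x => Rsum (fun k => f k x) N) (Rsum l N).
Proof.
move=> H. elim: N => [|n IH] /=.
  have h := improp_scal 0 _ _ (H O). rewrite Rmult_0_l in h.
  apply: improp_ext h => x _. ring.
exact: improp_plus.
Qed.

(** Both sums are Mellin transforms of approximations of [bose], from its
    expansions in exponentials and in partial fractions. *)
Lemma real_functional_equation (s g j : R) : 0 < s < 1 ->
  improp (gam s) g -> improp (fun u => Rpower u s / (1 + u ^ 2)) j ->
  is_lim_seq (fun N => g * zeta_approx N s - 2 * Rpower (2 * PI) (s - 1) * j * zeta_approx N (1 - s)) 0.
Proof.
move=> Hs Hg Hj. have hpi := PI_RGT_0. set K := 2 * Rpower (2 * PI) (s - 1) * j.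
pose A := fun N x => Rsum (fun k => exp (- (INR (S k) * x))) N - (1 - exp (- (INR N * x))) / x.
pose B := fun N x => Rsum (bose_term x) N - / PI * (PI / 2 - atan (x / (2 * PI * INR N))).
have HA : forall N, (1 <= N)%nat -> improp (fun x => Rpower x (s - 1) * A N x) (g * zeta_approx N s).
  move=> N HN. have hN : 0 < INR N by apply: lt_0_INR; lia.
  have H1 := improp_Rsum _ _ N (fun k => exp_moment s g (INR (S k)) ltac:(apply: lt_0_INR; lia) Hg).
  have H2 := improp_minus _ _ _ _ H1 (exp_diff_moment s g (INR N) Hs hN Hg).
  have E : Rsum (fun k => g * Rpower (INR (S k)) (- s)) N - g * (Rpower (INR N) (1 - s) / (1 - s)) = g * zeta_approx N s.
    rewrite Rsum_scal /zeta_approx. ring.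
  rewrite E in H2. apply: improp_ext H2 => x Hx. rewrite Rsum_scal /A. ring.
have HB : forall N, (1 <= N)%nat -> improp (fun x => Rpower x (s - 1) * B N x) (K * zeta_approx N (1 - s)).
  move=> N HN. have hN : 0 < INR N by apply: lt_0_INR; lia.
  have h2 : forall k, 0 < 2 * PI * INR (S k).
    move=> k. have : 0 < INR (S k) by apply: lt_0_INR; lia. nra.
  have H1 := improp_Rsum _ _ N (fun k => phi_moment s j (2 * PI * INR (S k)) (h2 k) Hj).
  have H2 := improp_minus _ _ _ _ H1 (improp_scal (/ PI) _ _ (atan_moment s j (2 * PI * INR N) Hs ltac:(nra) Hj)).
  have E : Rsum (fun k => 2 * Rpower (2 * PI * INR (S k)) (s - 1) * j) N - / PI * (Rpower (2 * PI * INR N) s * j / s) =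
    K * zeta_approx N (1 - s).
    rewrite (Rsum_ext _ (fun k => K * Rpower (INR (S k)) (- (1 - s)))); last first.
      move=> k _. rewrite Rpower_Rmult; [|lra|apply: lt_0_INR; lia].
      have -> : - (1 - s) = s - 1 by ring. rewrite /K. ring.
    rewrite Rsum_scal /zeta_approx. have -> : 1 - (1 - s) = s by ring.
    rewrite Rpower_Rmult //; last lra.
    have -> : Rpower (2 * PI) s = Rpower (2 * PI) (s - 1) * (2 * PI).
      rewrite Rpower_pred; last lra. field. lra.
    rewrite /K. field. lra.
  rewrite E in H2. apply: improp_ext H2 => x Hx. rewrite Rsum_scal /B /bose_term. ring.
(* [A N] and [B N] both approximate [bose], with a difference of at most
   [exp (- (N x)) + phi_at x N]. The Mellin transform of this bound is known from [exp_moment] and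
   [phi_moment] and decays in [N]. *)
have bound : forall N, (1 <= N)%nat ->
    Rabs (g * zeta_approx N s - K * zeta_approx N (1 - s)) <= g * Rpower (INR N) (- s) + K * Rpower (INR N) (s - 1).
  move=> N HN. have hN : 0 < INR N by apply: lt_0_INR; lia.
  have HD := improp_minus _ _ _ _ (HA N HN) (HB N HN).
  have HE := exp_moment s g (INR N) hN Hg.
  have HP := phi_moment s j (2 * PI * INR N) ltac:(nra) Hj.
  have HU := improp_plus _ _ _ _ HE HP.
  have EU : g * Rpower (INR N) (- s) + 2 * Rpower (2 * PI * INR N) (s - 1) * j = g * Rpower (INR N) (- s) + K * Rpower (INR N) (s - 1).
    rewrite Rpower_Rmult //; last lra. rewrite /K. ring.
  rewrite EU in HU. have HL := improp_scal (-1) _ _ HU.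
  have hpt : forall x, 0 < x -> - (exp (- (INR N * x)) + phi_at x (INR N)) <= A N x - B N x <= exp (- (INR N * x)) + phi_at x (INR N).
    move=> x Hx.
    have -> : A N x = (1 - exp (- (INR N * x))) * bose x by exact: bose_partial_sum.
    have := bose_remainder x N Hx HN. rewrite -/(B N x).
    have := bose_bounds x Hx. have := exp_pos (- (INR N * x)).
    have : 0 <= phi_at x (INR N).
      apply: Rdiv_le_0_compat; first lra. have := pow_lt x 2 Hx. have := pow2_ge_0 (2 * PI * INR N). lra.
    move=> p1 p2 p3 p4.
    have p5 : - exp (- (INR N * x)) <= exp (- (INR N * x)) * bose x <= 0 by nra.
    lra.
  apply: Rabs_le. split.
  - have -> : - (g * Rpower (INR N) (- s) + K * Rpower (INR N) (s - 1)) = -1 * (g * Rpower (INR N) (- s) + K * Rpower (INR N) (s - 1)) by ring.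
    apply: (improp_le _ _ _ _ _ HL HD) => x Hx.
    have := hpt x Hx. have := Rpower_pos x (s - 1). rewrite /phi_at. nra.
  - apply: (improp_le _ _ _ _ _ HD HU) => x Hx.
    have := hpt x Hx. have := Rpower_pos x (s - 1). rewrite /phi_at. nra.
have Lz : forall a, a < 0 -> is_lim_seq (fun N => Rpower (INR N) a) 0.
  move=> a Ha. apply/is_lim_seq_Reals => eps He. have [T HT] := liminfty_Rpower a Ha eps He.
  have [M HM] : exists M : nat, T < INR M by exact: INR_unbounded.
  exists (S M) => n Hn. apply: HT; first by apply: lt_0_INR; lia.
  have : INR M <= INR n by apply: le_INR; lia. lra.
have LU : is_lim_seq (fun N => g * Rpower (INR N) (- s) + K * Rpower (INR N) (s - 1)) 0.
  have := is_lim_seq_plus' _ _ _ _ (is_lim_seq_mult' _ _ _ _ (is_lim_seq_const g) (Lz (- s) ltac:(lra)))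
    (is_lim_seq_mult' _ _ _ _ (is_lim_seq_const K) (Lz (s - 1) ltac:(lra))).
  by rewrite !Rmult_0_r Rplus_0_r.
apply: (is_lim_seq_le_le_loc (fun N => - (g * Rpower (INR N) (- s) + K * Rpower (INR N) (s - 1))) _ _ 0 _ _ LU).
- exists 1%nat => N HN. have := bound N HN => /Rabs_le_between. lra.
- have := proj1 (is_lim_seq_opp _ _) LU. by rewrite /= Ropp_0.
Qed.

(** * Continuation of zeta to the right half plane *)

Open Scope C_scope.

(** [(s - 1) * zeta s] for [Re s > 0] is the limit of these functions. *)
Definition zeta_n (n : nat) (s : C) : C :=
  (s - 1) * Csum (fun k => Rcpow (INR (S k)) (- s)) n + Rcpow (INR n) (1 - s).

Lemma Rcpow_real (x a : R) : Rcpow x (RtoC a) = RtoC (Rpower x a).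
Proof. by rewrite /Rcpow -RtoC_mult Cexp_RtoC. Qed.

Lemma Cmod_Rcpow (x : R) (s : C) : Cmod (Rcpow x s) = Rpower x (Re s).
Proof.
rewrite /Rcpow Cmod_Cexp /Rpower. f_equal. rewrite /Re /=. ring.
Qed.

Lemma Rcpow_plus (x : R) (s t : C) : Rcpow x (s + t) = Rcpow x s * Rcpow x t.
Proof. rewrite /Rcpow -Cexp_plus. f_equal. ring. Qed.

Lemma Rcpow_1 (x : R) : (0 < x)%R -> Rcpow x 1 = RtoC x.
Proof. move=> Hx. by rewrite Rcpow_real Rpower_1. Qed.

Lemma entire_Rcpow (x : R) (c d : C) : entire (fun s => Rcpow x (c * s + d)).
Proof.
apply: (entire_ext (fun s => Cexp ((RtoC (ln x) * c) * s + RtoC (ln x) * d))); last exact: entire_affine entire_Cexp.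
move=> s. rewrite /Rcpow. f_equal. ring.
Qed.

Lemma entire_zeta_n (n : nat) : entire (zeta_n n).
Proof.
apply: entire_plus.
  apply: entire_mult; first by apply: entire_minus; [exact: entire_id|exact: entire_const].
  elim: n => [|n IH] /=; first exact: entire_const.
  apply: entire_plus => //.
  apply: (entire_ext (fun s => Rcpow (INR (S n)) (- (1) * s + 0))); last exact: entire_Rcpow.
  move=> s. f_equal. ring.
apply: (entire_ext (fun s => Rcpow (INR n) (- (1) * s + 1))); last exact: entire_Rcpow.
move=> s. f_equal. ring.
Qed.

(** The increment is of order [n^(-1 - Re s)]. It is bounded by a difference of powers [n^(- d)], so
    that the sum over [n] telescopes and the estimate is uniform on [Re s >= d]. *)
Lemma zeta_n_step (n : nat) (s : C) (B d : R) : (1 <= n)%nat -> (Cmod (1 - s) <= B)%R ->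
  (0 < d <= Re s)%R ->
  (Cmod (zeta_n (S n) s - zeta_n n s) <=
   2 * (2 * (B + B ^ 2 * exp B)) / d * (Rpower (INR n) (- d) - Rpower (INR (S n)) (- d)))%R.
Proof.
move=> Hn HB Hd.
have [l1 l2] := ln_succ_bounds n Hn. set l := (ln (INR (S n)) - ln (INR n))%R in l1 l2.
have h0 : (1 <= INR n)%R by apply: (le_INR 1).
have h1 : (INR (S n) = INR n + 1)%R by exact: S_INR.
set x := (/ INR n)%R in l2. set y := (/ INR (S n))%R in l1.
have hy : (0 < y)%R by apply: Rinv_0_lt_compat; lra.
have hx : (0 < x)%R by apply: Rinv_0_lt_compat; lra.
have hx1 : (x <= 1)%R by rewrite -Rinv_1; apply: Rinv_le_contravar; lra.
have hxy : (x - y = x * y)%R by rewrite /x /y h1; field; lra.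
have hx2y : (x <= 2 * y)%R.
  rewrite /x /y h1. apply: (Rmult_le_reg_r (INR n * (INR n + 1))); first nra. field_simplify; lra.
have hz := Cmod_ge_0 (1 - s).
set w := - (1 - s) * RtoC l.
have hw : (Cmod w = Cmod (1 - s) * l)%R by rewrite /w Cmod_mult Cmod_opp Cmod_R Rabs_pos_eq //; lra.
set e := Cexp w - 1 - w.
have he : (Cmod e <= B ^ 2 * exp B * x ^ 2)%R.
  apply: Rle_trans; first exact: Cexp_quadratic. rewrite hw Rpow_mult_distr.
  have e1 : (exp (Cmod (1 - s) * l) <= exp B)%R.
    have h : (Cmod (1 - s) * l <= B)%R by nra.
    case: h => [h|->]; [left; exact: exp_increasing|lra].
  have e2 : (Cmod (1 - s) ^ 2 * l ^ 2 <= B ^ 2 * x ^ 2)%R.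
    apply: Rmult_le_compat; try exact: pow2_ge_0; apply: pow_incr; lra.
  have e3 := exp_pos (Cmod (1 - s) * l).
  have e4 : (0 <= Cmod (1 - s) ^ 2 * l ^ 2)%R by apply: Rmult_le_pos; exact: pow2_ge_0.
  apply: (Rle_trans _ (B ^ 2 * x ^ 2 * exp B)); last by right; ring.
  apply: Rmult_le_compat; lra.
have Ew : Rcpow (INR n) (1 - s) = Rcpow (INR (S n)) (1 - s) * Cexp w.
  rewrite /Rcpow -Cexp_plus. f_equal. rewrite /w /l RtoC_minus. ring.
have Es : Rcpow (INR (S n)) (- s) = Rcpow (INR (S n)) (1 - s) * RtoC y.
  have hn1 : RtoC (INR (S n)) <> 0 by apply: RtoC_neq_0; lra.
  have -> : 1 - s = - s + 1 by ring. rewrite Rcpow_plus Rcpow_1; last lra.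
  rewrite /y RtoC_inv; last lra. field. exact: hn1.
(* The new term of the sum cancels the first-order part of the change in [n^(1 - s)] up to [l - y],
   which is of second order. *)
have E : zeta_n (S n) s - zeta_n n s = Rcpow (INR (S n)) (1 - s) * ((1 - s) * RtoC (l - y) - e).
  have -> : zeta_n (S n) s = (s - 1) * (Csum (fun k => Rcpow (INR (S k)) (- s)) n + Rcpow (INR (S n)) (- s))
     + Rcpow (INR (S n)) (1 - s) by [].
  rewrite /zeta_n Ew Es /e RtoC_minus /w. ring.
rewrite E Cmod_mult Cmod_Rcpow.
have hre : Re (1 - s) = (1 - Re s)%R by rewrite /Re /=; ring. rewrite hre.
have hbr : (Cmod ((1 - s) * RtoC (l - y) - e) <= (B + B ^ 2 * exp B) * (2 * (x * y)))%R.
  apply: Rle_trans; first exact: Cmod_minus_le.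
  have a1 : (Cmod ((1 - s) * RtoC (l - y)) <= B * (x * y))%R.
    rewrite Cmod_mult Cmod_R -hxy. apply: Rmult_le_compat; [exact: hz|exact: Rabs_pos|done|].
    rewrite Rabs_pos_eq; lra.
  have a2 : (B ^ 2 * exp B * x ^ 2 <= B ^ 2 * exp B * (2 * (x * y)))%R.
    apply: Rmult_le_compat_l; last nra. apply: Rmult_le_pos; [exact: pow2_ge_0|left; exact: exp_pos].
  have a3 : (0 <= B * (x * y))%R by apply: Rmult_le_pos; nra.
  lra.
have hC : (0 <= B + B ^ 2 * exp B)%R.
  have : (0 <= B ^ 2 * exp B)%R by apply: Rmult_le_pos; [exact: pow2_ge_0|left; exact: exp_pos]. lra.
have hp1 : (Rpower (INR (S n)) (1 - Re s) <= Rpower (INR (S n)) (- d) * INR (S n))%R.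
  have -> : (Rpower (INR (S n)) (- d) * INR (S n) = Rpower (INR (S n)) (1 - d))%R.
    have -> : (1 - d = - d + 1)%R by ring. rewrite Rpower_plus Rpower_1; lra.
  apply: Rle_Rpower; lra.
have hpd := Rpower_pos (INR (S n)) (- d).
(* Convexity of the exponential: [e^(d l) - 1 >= d l >= d y]. *)
have hconv : (Rpower (INR (S n)) (- d) * (d * y) <= Rpower (INR n) (- d) - Rpower (INR (S n)) (- d))%R.
  have -> : Rpower (INR n) (- d) = (Rpower (INR (S n)) (- d) * exp (d * l))%R.
    rewrite /Rpower -exp_plus /l. f_equal. ring.
  have h2 : (d * y <= exp (d * l) - 1)%R.
    have := exp_ineq1_le (d * l). have := Rmult_le_compat_l d _ _ ltac:(lra) l1. lra.
  have := Rmult_le_compat_l _ _ _ (Rlt_le _ _ hpd) h2. lra.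
apply: (Rle_trans _ (Rpower (INR (S n)) (- d) * INR (S n) * ((B + B ^ 2 * exp B) * (2 * (x * y))))).
  apply: Rmult_le_compat => //; [left; exact: Rpower_pos|exact: Cmod_ge_0].
have -> : (Rpower (INR (S n)) (- d) * INR (S n) * ((B + B ^ 2 * exp B) * (2 * (x * y))) =
  (2 * (B + B ^ 2 * exp B)) * (Rpower (INR (S n)) (- d) * x))%R.
  rewrite /y. field. lra.
have -> : (2 * (2 * (B + B ^ 2 * exp B)) / d * (Rpower (INR n) (- d) - Rpower (INR (S n)) (- d)) =
  2 * (B + B ^ 2 * exp B) * (2 / d * (Rpower (INR n) (- d) - Rpower (INR (S n)) (- d))))%R by field; lra.
apply: Rmult_le_compat_l; first lra.
have hd2 : (0 < 2 / d)%R by apply: Rdiv_lt_0_compat; lra.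
apply: Rle_trans; last (apply: Rmult_le_compat_l; [lra|exact: hconv]).
have -> : (2 / d * (Rpower (INR (S n)) (- d) * (d * y)) = Rpower (INR (S n)) (- d) * (2 * y))%R by field; lra.
apply: Rmult_le_compat_l; lra.
Qed.

Lemma Rpower_INR_lim (a : R) : (a < 0)%R -> is_lim_seq (fun n => Rpower (INR n) a) 0%R.
Proof.
move=> Ha. apply/is_lim_seq_Reals => eps He. have [T HT] := liminfty_Rpower a Ha eps He.
have [M HM] : exists M : nat, (T < INR M)%R by exact: INR_unbounded.
exists (S M) => n Hn. apply: HT; first by apply: lt_0_INR; lia.
have : (INR M <= INR n)%R by apply: le_INR; lia. lra.
Qed.

Lemma zeta_n_uniform (B d : R) : (0 <= B)%R -> (0 < d)%R -> exists K, (0 <= K)%R /\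
  forall s n m, (Cmod (1 - s) <= B)%R -> (d <= Re s)%R -> (1 <= n)%nat -> (n <= m)%nat ->
    (Cmod (zeta_n m s - zeta_n n s) <= K * Rpower (INR n) (- d))%R.
Proof.
move=> HB Hd. pose K := (2 * (2 * (B + B ^ 2 * exp B)) / d)%R.
have hK : (0 <= K)%R.
  apply: Rdiv_le_0_compat => //.
  have : (0 <= B ^ 2 * exp B)%R by apply: Rmult_le_pos; [exact: pow2_ge_0|left; exact: exp_pos]. lra.
exists K; split=> // s n m Hs Hre Hn Hm.
have h : (Cmod (zeta_n m s - zeta_n n s) <= K * (Rpower (INR n) (- d) - Rpower (INR m) (- d)))%R.
  elim: m Hm => [|m IH] Hm; first lia.
  case: (Nat.eq_dec n (S m)) => [->|Hne]; first by rewrite Csub_diag Cmod_0; lra.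
  have := IH ltac:(lia). have := zeta_n_step m s B d ltac:(lia) Hs ltac:(lra).
  have := Cmod_dist_triangle (zeta_n (S m) s) (zeta_n m s) (zeta_n n s). rewrite -/K. lra.
have := Rpower_pos (INR m) (- d). nra.
Qed.

Definition zeta_cont (s : C) : C := Clim eventually (fun n => zeta_n n s).

Lemma zeta_cont_lim (s : C) : (0 < Re s)%R -> Ctends (fun n => zeta_n n s) (zeta_cont s).
Proof.
move=> Hs.
have [l Hl] : exists l, Ctends (fun n => zeta_n n s) l; last first.
  by rewrite /zeta_cont (Clim_eventually _ _ Hl).
have [K [HK H]] := zeta_n_uniform (Cmod (1 - s)) (Re s) (Cmod_ge_0 _) Hs.
have L := is_lim_seq_mult' _ _ _ _ (is_lim_seq_const K) (Rpower_INR_lim (- Re s) ltac:(lra)).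
rewrite Rmult_0_r in L.
apply: Ctends_Cauchy => eps He.
have /is_lim_seq_Reals /(_ (eps / 2)%R ltac:(lra)) [N HN] := L.
exists (S N) => n m Hn Hm.
have := HN (S N) ltac:(lia). rewrite /Rdist Rminus_0_r => /Rabs_def2 hN.
have h1 := H s (S N) n (Rle_refl _) (Rle_refl _) ltac:(lia) Hn.
have h2 := H s (S N) m (Rle_refl _) (Rle_refl _) ltac:(lia) Hm.
rewrite Cmod_sub_sym in h2.
apply: Rle_trans; first exact: (Cmod_dist_triangle _ (zeta_n (S N) s)). lra.
Qed.

Lemma zeta_cont_analytic (s : C) : (0 < Re s)%R -> analytic_at zeta_cont s.
Proof.
move=> Hs. set r := (Re s / 2)%R.
have Hr : (0 < r)%R by rewrite /r; lra.
have hre : forall z, (Cmod (z - s) < r)%R -> (r <= Re z)%R.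
  move=> z Hz. have h : (Rabs (Re (z - s)) <= Cmod (z - s))%R.
    apply: Rle_trans (Rmax_Cmod _). exact: Rmax_l.
  have h2 := Rle_abs (- Re (z - s)). rewrite Rabs_Ropp in h2.
  have E : Re (z - s) = (Re z - Re s)%R by rewrite /Re /=; ring. rewrite E in h h2. rewrite /r in Hz *. lra.
pose B := (Cmod (1 - s) + r)%R. have hB : (0 <= B)%R by rewrite /B; have := Cmod_ge_0 (1 - s); lra.
have [K [HK H]] := zeta_n_uniform B r hB Hr.
have [a Ha] : exists a : nat -> nat -> C, forall n, expands (a n) s r (zeta_n n).
  exact: functional_choice (fun n => entire_zeta_n n s r Hr).
apply/analytic_at_expands.
have [b Hb] : exists b, expands b s r zeta_cont; last by exists b, r.
apply: (expands_uniform_limit a s r zeta_n zeta_cont Hr Ha) => eps He.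
have L := is_lim_seq_mult' _ _ _ _ (is_lim_seq_const K) (Rpower_INR_lim (- r) ltac:(lra)).
rewrite Rmult_0_r in L.
have /is_lim_seq_Reals /(_ eps He) [N HN] := L.
exists (S N) => n z Hn Hz.
have hz : (Cmod (1 - z) <= B)%R.
  have := Cmod_dist_triangle 1 s z. rewrite (Cmod_sub_sym s z) /B. lra.
rewrite Cmod_sub_sym. apply: (Ctends_le_bound_loc _ _ _ _ n _ (zeta_cont_lim z _)).
  move=> m Hm. apply: Rle_trans; first by apply: H => //; [exact: hre|lia].
  have := HN n ltac:(lia). rewrite /Rdist Rminus_0_r => /Rabs_def2. lra.
have := hre z Hz. lra.
Qed.

Lemma zeta_eq_cont (zeta : C -> C) (hzeta : is_riemann_zeta zeta) (x : R) : (0 < x < 1)%R ->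
  (RtoC x - 1) * zeta (RtoC x) = zeta_cont (RtoC x).
Proof.
move=> Hx. have [hser hana] := hzeta.
pose f := fun s => (s - 1) * zeta s - zeta_cont s.
have Hf : forall s, (0 < Re s)%R -> s <> 1 -> analytic_at f s.
  move=> s Hs Hs1. apply: analytic_minus; last exact: zeta_cont_analytic.
  apply: analytic_mult; last exact: hana.
  apply: analytic_minus; [exact: analytic_id|exact: analytic_const].
have H1 : forall s, (1 < Re s)%R -> f s = 0.
  move=> s Hs.
  rewrite /f. have -> : zeta_cont s = (s - 1) * zeta s; last by ring.
  have hs0 : (0 < Re s)%R by lra.
  apply: (Ctends_unique _ _ _ (zeta_cont_lim s hs0)).
  have -> : (s - 1) * zeta s = (s - 1) * zeta s + 0 by ring.
  apply: Ctends_plus.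
    apply: Ctends_scal. apply/is_series_Csum. exact: hser.
  apply: (Ctends_le _ (fun n => Rpower (INR n) (1 - Re s))); last by apply: Rpower_INR_lim; lra.
  move=> n. have -> : Rcpow (INR n) (1 - s) - 0 = Rcpow (INR n) (1 - s) by ring.
  by rewrite Cmod_Rcpow; right.
have V2 : vanishes_near f 2.
  exists 1%R. split; first lra. move=> z Hz. apply: H1.
  have h : (Rabs (Re (z - 2)) <= Cmod (z - 2))%R.
    apply: Rle_trans (Rmax_Cmod _). exact: Rmax_l.
  have h2 := Rle_abs (- Re (z - 2)). rewrite Rabs_Ropp in h2.
  have E : Re (z - 2) = (Re z - 2)%R by rewrite /Re /=; ring. rewrite E in h h2. lra.
(* The straight segment from 2 to [x] passes through the pole 1, so the continuation goes through
   [1 + Ci]. *)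
have V3 : vanishes_near f (1 + Ci).
  apply: (identity_on_segment f 2) => // t Ht. apply: Hf.
    rewrite /Re /=. lra.
  move=> h. have hi := f_equal snd h. rewrite /= in hi. have hr := f_equal fst h. rewrite /= in hr. nra.
have V4 : vanishes_near f (RtoC x).
  apply: (identity_on_segment f (1 + Ci)) => // t Ht. apply: Hf.
    rewrite /Re /=. nra.
  move=> h. have hi := f_equal snd h. rewrite /= in hi. have hr := f_equal fst h. rewrite /= in hr. nra.
have [d [Hd H]] := V4. have := H (RtoC x). rewrite Csub_diag Cmod_0 => h. have {}h := h Hd.
rewrite /f in h. replace ((RtoC x - 1) * zeta (RtoC x)) with
  ((RtoC x - 1) * zeta (RtoC x) - zeta_cont (RtoC x) + zeta_cont (RtoC x)) by ring. rewrite h. ring.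
Qed.

Lemma zeta_approx_lim (zeta : C -> C) (hzeta : is_riemann_zeta zeta) (x : R) : (0 < x < 1)%R ->
  Ctends (fun n => RtoC (zeta_approx n x)) (zeta (RtoC x)).
Proof.
move=> Hx. have hx1 : RtoC x - 1 <> 0.
  rewrite -RtoC_minus. apply: RtoC_neq_0. lra.
have L := Ctends_scal (/ (RtoC x - 1)) _ _ (zeta_cont_lim (RtoC x) (proj1 Hx)).
rewrite -(zeta_eq_cont zeta hzeta x Hx) in L.
replace (/ (RtoC x - 1) * ((RtoC x - 1) * zeta (RtoC x))) with (zeta (RtoC x)) in L by (field; exact: hx1).
apply: Ctends_ext L => n.
rewrite /zeta_n /zeta_approx RtoC_minus RtoC_div; last lra. rewrite -Csum_RtoC.
rewrite (Csum_ext (fun k => Rcpow (INR (S k)) (- RtoC x)) (fun k => RtoC (Rpower (INR (S k)) (- x)))); last first.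
  move=> k _. by rewrite -RtoC_opp Rcpow_real.
rewrite -[1 - RtoC x]RtoC_minus Rcpow_real RtoC_minus.
field. split=> //. move=> h. apply: hx1. replace (RtoC x - 1) with (- (1 - RtoC x)) by ring. rewrite h; ring.
Qed.

(** * The functional equation *)

Lemma Rrgamma_n_RtoC (n : nat) (a : R) : rgamma_n n (RtoC a) = RtoC (Rrgamma_n n a).
Proof.
rewrite /rgamma_n /Rrgamma_n (RtoC_mult (Rpower _ _)) (RtoC_mult (Rprod _ _)). f_equal.
  rewrite -RtoC_opp -RtoC_mult Cexp_RtoC /Rpower. do 2 f_equal. ring.
f_equal. elim: n => [|n IH]; first by rewrite /= Rmult_1_l Rplus_0_r.
have -> : rising (RtoC a) (S n) = rising (RtoC a) n * (RtoC a + RtoC (INR (S n))) by [].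
have -> : Rprod (fun k => a + INR k)%R (S (S n)) = (Rprod (fun k => a + INR k)%R (S n) * (a + INR (S n)))%R by [].
by rewrite (RtoC_mult (Rprod _ _)) RtoC_plus IH.
Qed.

(** The limit of [real_functional_equation] is the asymmetric form [g zeta(x) = K zeta(1 - x)]. The
    values of the Gamma and Beta integrals and the duplication formula make it symmetric. *)
Lemma functional_equation_real (zeta : C -> C) (hzeta : is_riemann_zeta zeta) (x : R) : (0 < x < 1)%R ->
  Rcpow PI (- (RtoC x / 2)) * zeta (RtoC x) * rgamma ((1 - RtoC x) / 2) =
  Rcpow PI (- ((1 - RtoC x) / 2)) * zeta (1 - RtoC x) * rgamma (RtoC x / 2).
Proof.
move=> Hx. have hpi := PI_RGT_0. have hs : (0 < sqrt PI)%R by exact: sqrt_lt_R0.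
have hC2 : RtoC 2 <> 0 by apply: RtoC_neq_0; lra.
have [g [Hg Lg]] := gamma_integral x Hx. have [j [Hj Lj]] := beta_integral x Hx.
set a := RtoC ((1 + x) / 2) . set b := RtoC ((1 - x) / 2).
have Eg : RtoC g * rgamma (RtoC x) = 1.
  have L := Ctends_scal (RtoC g) _ _ (rgamma_lim (RtoC x)).
  apply: (Ctends_unique _ _ _ L). move/Ctends_RtoC: Lg. apply: Ctends_ext => n.
  by rewrite Rrgamma_n_RtoC RtoC_mult.
have Ej : RtoC (2 * j) * rgamma a * rgamma b = 1.
  have L := Ctends_mult _ _ _ _ (Ctends_scal (RtoC (2 * j)) _ _ (rgamma_lim a)) (rgamma_lim b).
  apply: (Ctends_unique _ _ _ L). move/Ctends_RtoC: Lj. apply: Ctends_ext => n.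
  by rewrite !Rrgamma_n_RtoC -!RtoC_mult.
have Hx' : (0 < 1 - x < 1)%R by lra.
set K := (2 * Rpower (2 * PI) (x - 1) * j)%R.
have EF : RtoC g * zeta (RtoC x) = RtoC K * zeta (1 - RtoC x).
  have L1 := Ctends_scal (RtoC g) _ _ (zeta_approx_lim zeta hzeta x Hx).
  have L2 := Ctends_scal (RtoC K) _ _ (zeta_approx_lim zeta hzeta (1 - x) Hx').
  have L := Ctends_minus _ _ _ _ L1 L2.
  have L0 := real_functional_equation x g j Hx Hg Hj. rewrite -/K in L0. move/Ctends_RtoC: L0 => L0.
  have E : RtoC g * zeta (RtoC x) - RtoC K * zeta (RtoC (1 - x)) = 0.
    apply: (Ctends_unique _ _ _ L). apply: Ctends_ext L0 => n.
    by rewrite RtoC_minus !RtoC_mult.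
  rewrite RtoC_minus in E.
  replace (RtoC g * zeta (RtoC x)) with (RtoC g * zeta (RtoC x) - RtoC K * zeta (1 - RtoC x) + RtoC K * zeta (1 - RtoC x)) by ring.
  rewrite E. ring.
have D := rgamma_duplication (RtoC x / 2).
have Ea : RtoC x / 2 + / 2 = a.
  rewrite /a RtoC_div; last lra. rewrite RtoC_plus. field.
have Eb : (1 - RtoC x) / 2 = b.
  rewrite /b RtoC_div; last lra. by rewrite RtoC_minus.
have Ex : 2 * (RtoC x / 2) = RtoC x by field.
rewrite Ea Ex in D. rewrite Eb.
have Eb2 : - b = - (1 - RtoC x) / 2 by rewrite -Eb; field.
have hj : rgamma a <> 0 by move=> h; move: Ej; rewrite h Cmult_0_r Cmult_0_l => /RtoC_inj; lra.
have Q1 : Rcpow PI (- (RtoC x / 2)) = RtoC (Rpower PI (- (x / 2))).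
  by rewrite -Rcpow_real RtoC_opp RtoC_div.
have Q2 : Rcpow PI (- b) = RtoC (Rpower PI (- ((1 - x) / 2))).
  by rewrite -Rcpow_real RtoC_opp.
rewrite Q1 Q2.
set zx := zeta (RtoC x) in EF *. set z1 := zeta (1 - RtoC x) in EF *.
set A := rgamma a in D Ej hj *. set Bv := rgamma b in Ej *. set X := rgamma (RtoC x) in Eg D *.
set H := rgamma (RtoC x / 2) in D *.
have e1 : zx = RtoC K * X * z1.
  replace zx with ((RtoC g * zx) * X) by (replace (RtoC g * zx * X) with ((RtoC g * X) * zx) by ring; rewrite Eg; ring).
  rewrite EF. ring.
have e2 : zx * (A * Bv) = RtoC (Rpower (2 * PI) (x - 1)) * X * z1.
  rewrite e1 /K. have -> : (2 * Rpower (2 * PI) (x - 1) * j = Rpower (2 * PI) (x - 1) * (2 * j))%R by ring.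
  rewrite (RtoC_mult (Rpower _ _)).
  replace (_ * _) with (RtoC (Rpower (2 * PI) (x - 1)) * X * z1 * (RtoC (2 * j) * A * Bv)) by ring.
  rewrite Ej. ring.
have e3 : X = RtoC (2 * sqrt PI * Rpower 2 (- x)) * (H * A).
  rewrite D. rewrite -RtoC_mult Cexp_RtoC !Cmult_assoc -!RtoC_mult.
  have -> : (2 * sqrt PI * Rpower 2 (- x) * / (2 * sqrt PI) * exp (ln 2 * x) = 1)%R; last by ring.
  have h1 : (Rpower 2 (- x) * exp (ln 2 * x) = 1)%R.
    rewrite /Rpower -exp_plus. have -> : (- x * ln 2 + ln 2 * x = 0)%R by ring. exact: exp_0.
  have -> : (2 * sqrt PI * Rpower 2 (- x) * / (2 * sqrt PI) * exp (ln 2 * x) = Rpower 2 (- x) * exp (ln 2 * x))%R by field; lra.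
  exact: h1.
(* The factor [A], at [(1 + x) / 2], occurs both in the Beta integral and in the duplication
   formula, and is cancelled here. *)
have e4 : zx * Bv = RtoC (Rpower PI (x - / 2)) * H * z1.
  have h : (zx * Bv) * A = (RtoC (Rpower PI (x - / 2)) * H * z1) * A.
    replace ((zx * Bv) * A) with (zx * (A * Bv)) by ring. rewrite e2 e3.
    have -> : Rpower PI (x - / 2) = (Rpower (2 * PI) (x - 1) * (2 * sqrt PI * Rpower 2 (- x)))%R.
      rewrite Rpower_Rmult; [|lra|lra].
      have -> : sqrt PI = Rpower PI (/ 2) by rewrite Rpower_sqrt.
      have -> : (Rpower 2 (x - 1) * Rpower PI (x - 1) * (2 * Rpower PI (/ 2) * Rpower 2 (- x)) =
        (Rpower 2 (x - 1) * Rpower 2 (- x) * 2) * (Rpower PI (x - 1) * Rpower PI (/ 2)))%R by ring.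
      rewrite -!Rpower_plus. have -> : (x - 1 + - x = - (1))%R by ring.
      rewrite Rpower_Ropp Rpower_1; last lra. rewrite Rinv_l; last lra. rewrite Rmult_1_l. f_equal. field.
    rewrite (RtoC_mult (Rpower (2 * PI) (x - 1))). ring.
  replace (zx * Bv) with (zx * Bv * A * / A) by (field; exact: hj). rewrite h. field. exact: hj.
replace (RtoC (Rpower PI (- (x / 2))) * zx * Bv) with (RtoC (Rpower PI (- (x / 2))) * (zx * Bv)) by ring.
rewrite e4.
have -> : Rpower PI (- ((1 - x) / 2)) = (Rpower PI (- (x / 2)) * Rpower PI (x - / 2))%R.
  rewrite -Rpower_plus. f_equal. field.
rewrite (RtoC_mult (Rpower PI (- (x / 2)))). ring.
Qed.

(** The difference [f] of the two sides is analytic off 0 and 1 and vanishes on the interval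
    [(0, 1)]; it is continued from [1/2] along segments. *)
Lemma functional_equation (zeta : C -> C) (hzeta : is_riemann_zeta zeta) (s : C) : nonint s ->
  Rcpow PI (- (s / 2)) * zeta s * rgamma ((1 - s) / 2) =
  Rcpow PI (- ((1 - s) / 2)) * zeta (1 - s) * rgamma (s / 2).
Proof.
move=> Hs. have [_ hana] := hzeta.
(* The arguments are written as [c * s + d] to match [entire_affine]; the other side is then [P] at
   [1 - s]. *)
pose P := fun s => Rcpow PI (- / 2 * s + 0) * zeta s * rgamma (- / 2 * s + / 2).
pose f := fun s => P s - P (- (1) * s + 1).
have h12 : - / 2 <> 0 by move=> h; have := f_equal fst h; rewrite /=; lra.
have h1 : - (1) <> 0 by move=> h; have := f_equal fst h; rewrite /=; lra.
have HP : forall z : C, z <> 1 -> analytic_at P z.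
  move=> z Hz.
  apply: (analytic_mult (fun s => Rcpow PI (- / 2 * s + 0) * zeta s) (fun s => rgamma (- / 2 * s + / 2))).
    apply: (analytic_mult (fun s => Rcpow PI (- / 2 * s + 0)) zeta); last exact: hana.
    apply: entire_analytic. exact: entire_Rcpow.
  apply: entire_analytic. exact: entire_affine entire_rgamma.
have Hf : forall z : C, z <> 0 -> z <> 1 -> analytic_at f z.
  move=> z H0 H1. apply: analytic_minus; first exact: HP.
  apply: analytic_affine => //. apply: HP => h. apply: H0.
  replace z with (1 - (- (1) * z + 1)) by ring. rewrite h. ring.
have EP : forall z, P z = Rcpow PI (- (z / 2)) * zeta z * rgamma ((1 - z) / 2).
  move=> z. rewrite /P. f_equal; [f_equal; f_equal; field|f_equal; field].
have Ef : forall z, f z = Rcpow PI (- (z / 2)) * zeta z * rgamma ((1 - z) / 2) -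
   Rcpow PI (- ((1 - z) / 2)) * zeta (1 - z) * rgamma (z / 2).
  move=> z. rewrite /f !EP. have -> : - (1) * z + 1 = 1 - z by ring.
  by have -> : 1 - (1 - z) = z by ring.
have Hreal : forall x, (0 < x < 1)%R -> f (RtoC x) = 0.
  move=> x Hx. rewrite Ef functional_equation_real //. ring.
have V0 : vanishes_near f (RtoC (/ 2)).
  apply: analytic_vanishes_near.
    apply: Hf => /RtoC_inj; lra.
  move=> eps He. pose e := Rmin (eps / 2) (/ 4).
  have he : (0 < e)%R by apply: Rmin_glb_lt; lra.
  have he1 : (e <= eps / 2)%R by exact: Rmin_l. have he2 : (e <= / 4)%R by exact: Rmin_r.
  exists (RtoC (/ 2 + e)). split; first by move=> /RtoC_inj; lra.
  split; last by apply: Hreal; lra.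
  rewrite -RtoC_minus Cmod_R Rabs_pos_eq; lra.
have Hcoord : forall z : C, z = 0 \/ z = 1 -> Im z = 0%R /\ (Re z = 0%R \/ Re z = 1%R).
  move=> z [->|->]; rewrite /Re /Im /=; split; auto.
have Vs : vanishes_near f s.
  case: (Req_dec (Im s) 0) => Him.
  (* For real [s] the direct segment could meet 0 or 1. The detour through [Re s + i] meets the real
     axis only at its two ends. *)
  - have V1 : vanishes_near f (RtoC (Re s) + Ci).
      apply: (identity_on_segment f (RtoC (/ 2))) => // t Ht.
      have hne : ~ (RtoC (/ 2) + RtoC t * (RtoC (Re s) + Ci - RtoC (/ 2)) = 0 \/
          RtoC (/ 2) + RtoC t * (RtoC (Re s) + Ci - RtoC (/ 2)) = 1).
        move=> /Hcoord [hi hr]. rewrite /Re /Im /= in hi hr.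
        have ht : t = 0%R by lra. rewrite ht in hr. lra.
      apply: Hf => h; apply: hne; [by left|by right].
    apply: (identity_on_segment f (RtoC (Re s) + Ci)) => // t Ht.
    have Es : s = RtoC (Re s) by apply: injective_projections.
    have hne : ~ (RtoC (Re s) + Ci + RtoC t * (s - (RtoC (Re s) + Ci)) = 0 \/
        RtoC (Re s) + Ci + RtoC t * (s - (RtoC (Re s) + Ci)) = 1).
      have E : RtoC (Re s) + Ci + RtoC t * (s - (RtoC (Re s) + Ci)) = RtoC (Re s) + (1 - RtoC t) * Ci.
        rewrite {2}Es. ring.
      rewrite E => /Hcoord [hi hr]. rewrite /Re /Im /= in hi hr.
      case: hr => hr.
      + apply: (Hs 0%Z). rewrite Es. f_equal. rewrite /Re. rewrite /Re /Im in Him. lra.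
      + apply: (Hs 1%Z). rewrite Es. f_equal. rewrite /Re. rewrite /Re /Im in Him. lra.
    apply: Hf => h; apply: hne; [by left|by right].
  - apply: (identity_on_segment f (RtoC (/ 2))) => // t Ht.
    have hne : ~ (RtoC (/ 2) + RtoC t * (s - RtoC (/ 2)) = 0 \/ RtoC (/ 2) + RtoC t * (s - RtoC (/ 2)) = 1).
      move=> /Hcoord [hi hr]. rewrite /Re /Im /= in hi hr Him.
      have ht : t = 0%R by nra. rewrite ht in hr. lra.
    apply: Hf => h; apply: hne; [by left|by right].
have [d [Hd H]] := Vs. have := H s. rewrite Csub_diag Cmod_0 => h. have {}h := h Hd.
rewrite Ef in h.
exact: Ceq_minus.
Qed.

(** * The functions chi, Z_k and xi_k *)

Lemma nonint_reflect (s : C) : nonint s -> nonint (1 - s).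
Proof.
move=> Hs k h. apply: (Hs (1 - k)%Z). rewrite minus_IZR RtoC_minus -h. ring.
Qed.

Lemma nonint_half (s : C) : nonint s -> nonint (s / 2).
Proof.
move=> Hs k h. apply: (Hs (2 * k)%Z). rewrite mult_IZR RtoC_mult -h. field.
Qed.

Lemma Cmod_IZR_diff (k m : Z) : k <> m -> (1 <= Cmod (RtoC (IZR k) - RtoC (IZR m)))%R.
Proof.
move=> h. rewrite -RtoC_minus Cmod_R -minus_IZR -abs_IZR. apply: IZR_le. lia.
Qed.

(** If an integer other than [s] lies within [1/2] of [s], its distance is the radius: distinct
    integers are at least 1 apart, so no other is closer. If there is none, the radius is [1/2]. *)
Lemma nonint_punctured (s : C) : exists d, (0 < d)%R /\
  forall z, (Cmod (z - s) < d)%R -> z <> s -> nonint z.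
Proof.
case: (Classical_Prop.classic (exists k d, (0 < d)%R /\ (Cmod (RtoC (IZR k) - s) < / 2)%R /\ d = Cmod (RtoC (IZR k) - s))) => [[k [d [Hd [Hk Ed]]]]|Hno].
- exists d. split=> // z Hz _ m Hm. case: (Z.eq_dec k m) => h.
    rewrite Hm -h -Ed in Hz. lra.
  have := Cmod_IZR_diff k m h. have := Cmod_dist_triangle (RtoC (IZR k)) s (RtoC (IZR m)).
  rewrite (Cmod_sub_sym s) -Hm. lra.
- exists (/ 2)%R. split; first lra. move=> z Hz Hne m Hm.
  have h := Cmod_ge_0 (z - s).
  case: (Req_dec (Cmod (z - s)) 0) => h0.
    apply: Hne. apply: Ceq_minus. exact: Cmod_eq_0.
  apply: Hno. exists m, (Cmod (RtoC (IZR m) - s)). rewrite -Hm. split; first lra. by split.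
Qed.

Lemma Copen_nonint : Copen nonint.
Proof.
move=> s Hs. have [d [Hd H]] := nonint_punctured s. exists d. split=> // z Hz.
case: (Ceq_dec z s) => [-> //|h]. exact: H.
Qed.

(** Reflection at [s / 2] rewrites the sine, and duplication at [(1 - s) / 2] rewrites
    [Gamma (1 - s)]; the factor [rgamma (1 - s / 2)] common to both cancels. *)
Lemma chi_formula (s : C) : nonint s ->
  chi s = Rcpow PI (s - / 2) * rgamma (s / 2) * / rgamma ((1 - s) / 2).
Proof.
move=> Hs. have hpi := PI_RGT_0. have hsq : (0 < sqrt PI)%R by exact: sqrt_lt_R0.
have hpiC : RtoC PI <> 0 by apply: RtoC_neq_0; lra.
have hsqC : RtoC (sqrt PI) <> 0 by apply: RtoC_neq_0; lra.
have Hs1 := nonint_reflect s Hs.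
have h1 := rgamma_neq_0 _ Hs1. have h2 := rgamma_neq_0 _ (nonint_half _ Hs1).
rewrite /chi Gamma_rgamma //.
have E1 : Csin (RtoC PI * s / 2) = RtoC PI * (rgamma (s / 2) * rgamma (1 - s / 2)).
  rewrite rgamma_reflection. have -> : RtoC PI * (s / 2) = RtoC PI * s / 2 by field. field. exact: hpiC.
have D := rgamma_duplication ((1 - s) / 2).
have e1 : (1 - s) / 2 + / 2 = 1 - s / 2 by field.
have e2 : 2 * ((1 - s) / 2) = 1 - s by field.
rewrite e1 e2 in D.
rewrite E1.
have E2 : Rcpow 2 s * Cexp (RtoC (ln 2) * (1 - s)) = 2.
  rewrite /Rcpow -Cexp_plus. replace (s * RtoC (ln 2) + RtoC (ln 2) * (1 - s)) with (RtoC (ln 2)) by ring.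
  by rewrite Cexp_RtoC exp_ln; [|lra].
have E3 : Rcpow PI (s - / 2) * RtoC PI = Rcpow PI (s - 1) * RtoC PI * RtoC (sqrt PI).
  have -> : s - / 2 = (s - 1) + / 2 by field. rewrite Rcpow_plus.
  have -> : Rcpow PI (/ 2) = RtoC (sqrt PI).
    rewrite -Rpower_sqrt // -Rcpow_real. f_equal. by rewrite RtoC_inv.
  ring.
set A := rgamma ((1 - s) / 2) in h2 D *. set Bv := rgamma (1 - s / 2) in D *.
set G := rgamma (1 - s) in h1 D *. set H := rgamma (s / 2).
have E4 : Rcpow PI (s - / 2) = Rcpow PI (s - 1) * RtoC (sqrt PI).
  replace (Rcpow PI (s - / 2)) with (Rcpow PI (s - / 2) * RtoC PI * / RtoC PI) by (field; exact: hpiC).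
  rewrite E3. field. exact: hpiC.
rewrite E4.
have E5 : A * Bv * (2 * RtoC (sqrt PI)) = Cexp (RtoC (ln 2) * (1 - s)) * G.
  rewrite D RtoC_inv; last lra. rewrite RtoC_mult. field. exact: hsqC.
have E6 : A * Bv * RtoC (sqrt PI) * Rcpow 2 s = G.
  replace G with (Rcpow 2 s * Cexp (RtoC (ln 2) * (1 - s)) * G / 2) by (rewrite E2; field).
  replace (Rcpow 2 s * Cexp (RtoC (ln 2) * (1 - s)) * G) with (Rcpow 2 s * (Cexp (RtoC (ln 2) * (1 - s)) * G)) by ring.
  rewrite -E5. field.
have E7 : RtoC (sqrt PI) * RtoC (sqrt PI) = RtoC PI.
  rewrite -RtoC_mult sqrt_sqrt //. lra.
rewrite -E7.
have hG : A * Bv * RtoC (sqrt PI) * Rcpow 2 s <> 0 by rewrite E6.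
have hB : Bv <> 0 by move=> h; apply: hG; rewrite h; ring.
have hR : Rcpow 2 s <> 0 by exact: Cexp_neq_0.
rewrite -E6. field. by repeat split.
Qed.

Lemma chi_neq_0 (s : C) : nonint s -> chi s <> 0.
Proof.
move=> Hs. rewrite chi_formula //. apply: Cmult_neq_0.
  apply: Cmult_neq_0; first exact: Cexp_neq_0. apply: rgamma_neq_0. exact: nonint_half.
move=> h. have h2 := rgamma_neq_0 _ (nonint_half _ (nonint_reflect s Hs)).
have := Cinv_r _ h2. rewrite h Cmult_0_r => h3. exact: C1_nz (eq_sym h3).
Qed.

Lemma chi_reflect (s : C) : nonint s -> chi s * chi (1 - s) = 1.
Proof.
move=> Hs. have Hs1 := nonint_reflect s Hs.
have h1 := rgamma_neq_0 _ (nonint_half _ Hs). have h2 := rgamma_neq_0 _ (nonint_half _ Hs1).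
rewrite !chi_formula //. have -> : 1 - (1 - s) = s by ring.
have E : Rcpow PI (s - / 2) * Rcpow PI (1 - s - / 2) = 1.
  rewrite -Rcpow_plus. have -> : s - / 2 + (1 - s - / 2) = 0 by field.
  by rewrite /Rcpow Cmult_0_l Cexp_0.
replace (_ * _) with (Rcpow PI (s - / 2) * Rcpow PI (1 - s - / 2)).
  exact: E. field. by split.
Qed.

Lemma smooth_chi (n : nat) : smooth nonint n chi.
Proof.
apply: (smooth_ext _ _ (fun s => Rcpow PI (s - / 2) * rgamma (s / 2) * / rgamma ((1 - s) / 2))).
- exact: Copen_nonint.
- move=> s Hs. by rewrite chi_formula.
- apply: smooth_mult; first exact: Copen_nonint.
    apply: analytic_smooth => z _. apply: entire_analytic. apply: entire_mult.
      apply: (entire_ext (fun s => Rcpow PI (1 * s + (- / 2)))); last exact: entire_Rcpow.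
      move=> s. f_equal. ring.
    apply: (entire_ext (fun s => rgamma (/ 2 * s + 0))); last exact: entire_affine entire_rgamma.
    move=> s. f_equal. field.
  apply: smooth_inv; first exact: Copen_nonint.
    move=> z Hz. apply: rgamma_neq_0. apply: nonint_half. exact: nonint_reflect.
  apply: analytic_smooth => z _. apply: entire_analytic.
  apply: (entire_ext (fun s => rgamma (- / 2 * s + / 2))); last exact: entire_affine entire_rgamma.
  move=> s. f_equal. field.
Qed.

Lemma smooth_omega (n : nat) : smooth nonint n omega.
Proof.
apply: smooth_mult; first exact: Copen_nonint.
  exact: (proj2 (smooth_chi (S n))).
apply: smooth_inv; [exact: Copen_nonint|exact: chi_neq_0|exact: smooth_chi].
Qed.

Lemma nonint_ne_1 (s : C) : nonint s -> s <> 1.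
Proof. move=> Hs. exact: (Hs 1%Z). Qed.

Lemma smooth_Zk (zeta : C -> C) (hzeta : is_riemann_zeta zeta) (k n : nat) :
  smooth nonint n (Zk zeta k).
Proof.
elim: k n => [|k IH] n.
- apply: analytic_smooth => z Hz. apply: (proj2 hzeta). exact: nonint_ne_1.
- apply: (smooth_ext _ _ (fun s => C_derive (Zk zeta k) s + (- / 2) * omega s * Zk zeta k s)).
  + exact: Copen_nonint.
  + move=> s _ /=. ring.
  + have HO := Copen_nonint. apply: smooth_plus => //; first exact: (proj2 (IH (S n))).
    apply: smooth_mult => //. apply: smooth_mult => //; [exact: smooth_const|exact: smooth_omega].
Qed.

Lemma smooth_derive (f : C -> C) (s : C) : smooth nonint 1 f -> nonint s ->
  is_Cderive f s (C_derive f s).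
Proof.
move=> [H _] Hs. have [l Hl] := H s Hs. by rewrite (is_C_derive_unique _ _ _ Hl).
Qed.

Lemma Cm1_neq_0 : - (1) <> 0.
Proof. move=> h. have := f_equal fst h. rewrite /=; lra. Qed.

Lemma is_Cderive_reflect (f : C -> C) (s : C) : smooth nonint 1 f -> nonint s ->
  is_Cderive (fun z => f (1 - z)) s (- C_derive f (1 - s)).
Proof.
move=> Hf Hs.
have E : - (1) * s + 1 = 1 - s by ring.
have Hd : is_Cderive f (- (1) * s + 1) (C_derive f (1 - s)).
  rewrite E. apply: smooth_derive => //. exact: nonint_reflect.
have H := is_Cderive_affine f (- (1)) 1 s _ Cm1_neq_0 Hd.
have -> : - C_derive f (1 - s) = - (1) * C_derive f (1 - s) by ring.
apply: (is_Cderive_ext _ _ _ _ 1 Rlt_0_1 _ H) => y _. f_equal. ring.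
Qed.

Lemma omega_reflect (s : C) : nonint s -> omega (1 - s) = omega s.
Proof.
move=> Hs. have Hs1 := nonint_reflect s Hs.
have h1 := chi_neq_0 s Hs. have h2 := chi_neq_0 _ Hs1.
have D := is_Cderive_mult _ _ _ _ _ (smooth_derive chi s (smooth_chi 1) Hs)
  (is_Cderive_reflect chi s (smooth_chi 1) Hs).
have [d [Hd HdU]] := Copen_nonint s Hs.
have D1 : is_Cderive (fun y => chi y * chi (1 - y)) s (RtoC 0).
  apply: (is_Cderive_ext (fun _ => RtoC 1) _ _ _ d Hd); last exact: is_Cderive_const.
  move=> y Hy. rewrite chi_reflect //. exact: HdU.
have E := is_C_derive_unique _ _ _ D. rewrite (is_C_derive_unique _ _ _ D1) in E.
rewrite /omega. apply: Ceq_minus.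
replace (C_derive chi (1 - s) / chi (1 - s) - C_derive chi s / chi s) with
  (- (C_derive chi s * chi (1 - s) + chi s * - C_derive chi (1 - s)) / (chi s * chi (1 - s))) by (field; by split).
rewrite -E. field. by split.
Qed.

Lemma Zk_reflect (zeta : C -> C) (hzeta : is_riemann_zeta zeta) (k : nat) (s : C) : nonint s ->
  Zk zeta k s = (- (1)) ^ k * chi s * Zk zeta k (1 - s).
Proof.
elim: k s => [|k IH] s Hs; have Hs1 := nonint_reflect s Hs.
- have F := functional_equation zeta hzeta s Hs. rewrite chi_formula // [Zk _ 0]/= [_ ^ 0]/=.
  have h2 := rgamma_neq_0 _ (nonint_half _ Hs1).
  have hp : Rcpow PI (- (s / 2)) <> 0 by exact: Cexp_neq_0.
  have E : Rcpow PI (- ((1 - s) / 2)) = Rcpow PI (s - / 2) * Rcpow PI (- (s / 2)).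
    rewrite -Rcpow_plus. f_equal. field.
  rewrite E in F.
  replace (zeta s) with ((Rcpow PI (- (s / 2)) * zeta s * rgamma ((1 - s) / 2)) /
    (Rcpow PI (- (s / 2)) * rgamma ((1 - s) / 2))) by (field; by split).
  rewrite F. field. by split.
- have Dz := is_Cderive_reflect (Zk zeta k) s (smooth_Zk zeta hzeta k 1) Hs.
  have Dc := smooth_derive chi s (smooth_chi 1) Hs.
  have D := is_Cderive_mult _ _ _ _ _ (is_Cderive_const ((- (1)) ^ k) s) (is_Cderive_mult _ _ _ _ _ Dc Dz).
  have [d [Hd HdU]] := Copen_nonint s Hs.
  have D1 := is_Cderive_ext _ (Zk zeta k) s _ d Hd _ D.
  have {}D1 := is_C_derive_unique _ _ _ (D1 ltac:(move=> y Hy; rewrite (IH y (HdU y Hy)); ring)).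
  have Ew := omega_reflect s Hs. have hc := chi_neq_0 s Hs.
  (* Differentiating [chi] adds [omega] times the right-hand side, and the correction in [Zk] takes
     half of it away. The half that is left is the correction term at [1 - s], with the sign changed
     as the reflected derivative demands. *)
  have Ew2 : C_derive chi s = omega s * chi s by rewrite /omega; field.
  rewrite [LHS]/= D1 (IH s Hs) Ew2.
  have -> : Zk zeta (S k) (1 - s) = C_derive (Zk zeta k) (1 - s) - / 2 * omega (1 - s) * Zk zeta k (1 - s) by [].
  rewrite Ew Cpow_S. field.
Qed.

Lemma CpowerZ_pred (G : C) (k : nat) : G <> 0 -> CpowerZ G (Z.of_nat k - 1) = G ^ k / G.
Proof.
move=> hG. case: k => [|k]; first by rewrite /=; field.
have -> : (Z.of_nat (S k) - 1 = Z.of_nat k)%Z by lia.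
have E : CpowerZ G (Z.of_nat k) = G ^ k.
  case: k => [//|k] /=. by rewrite SuccNat2Pos.id_succ.
rewrite E Cpow_S. field. exact: hG.
Qed.

Lemma CpowerZ_of_nat (G : C) (k : nat) : CpowerZ G (Z.of_nat k) = G ^ k.
Proof. case: k => [//|k] /=. by rewrite SuccNat2Pos.id_succ. Qed.

(** Exchanging [s] and [1 - s] swaps the exponents [k - 1] and [k]. What remains is one quotient of
    Gamma factors and one power of [PI], which are those of [chi]. *)
Lemma xi_formula_reflect (zeta : C -> C) (hzeta : is_riemann_zeta zeta) (k : nat) (s : C) :
  nonint s -> xi_formula zeta k s = (- (1)) ^ k * xi_formula zeta k (1 - s).
Proof.
move=> Hs. have Hs1 := nonint_reflect s Hs.
have h1 := rgamma_neq_0 _ (nonint_half _ Hs). have h2 := rgamma_neq_0 _ (nonint_half _ Hs1).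
rewrite /xi_formula. have -> : 1 - (1 - s) = s by ring.
rewrite (Zk_reflect zeta hzeta k s Hs) chi_formula // !Gamma_rgamma //.
set A := rgamma (s / 2) in h1 *. set B := rgamma ((1 - s) / 2) in h2 *.
have hA : / A <> 0 by move=> h; have := Cinv_r _ h1; rewrite h Cmult_0_r => h3; exact: C1_nz (eq_sym h3).
have hB : / B <> 0 by move=> h; have := Cinv_r _ h2; rewrite h Cmult_0_r => h3; exact: C1_nz (eq_sym h3).
rewrite !CpowerZ_pred // !CpowerZ_of_nat !Cpow_inv //.
have hAk := Cpow_nz _ k h1. have hBk := Cpow_nz _ k h2.
have -> : Rcpow PI (- ((1 - s) / 2)) = Rcpow PI (- (s / 2)) * Rcpow PI (s - / 2).
  rewrite -Rcpow_plus. f_equal. field.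
set P := Rcpow PI _. set Q := Rcpow PI _. set Z := Zk zeta k (1 - s). set m := (- (1)) ^ k.
set a := A ^ k in hAk *. set b := B ^ k in hBk *.
field. by repeat split.
Qed.

(** So [Clim] is [0] where there is no limit, and the theorem does not require
    the singularities of [xi_formula] to be removable. *)
Lemma iota_empty (P : C -> Prop) : (forall l, ~ P l) ->
  iota (T := CompleteNormedModule.CompleteSpace _ C_R_CompleteNormedModule) P = RtoC 0.
Proof.
move=> HP.
have E : forall (Q : R -> Prop), (forall x, Q x) -> real (Lub_Rbar Q) = 0%R.
  move=> Q HQ. rewrite (is_lub_Rbar_unique Q p_infty) //. split.
  - by move=> x _.
  - move=> [b| |] Hb //.
      have := Hb (b + 1)%R (HQ _). rewrite /=. lra.
    exact: (Hb 0%R (HQ _)).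
rewrite /iota. apply: injective_projections; apply: E => x y Hy; by have := HP y Hy.
Qed.

Lemma locally'_reflect (s : C) (P : C -> Prop) :
  locally' s P -> locally' (1 - s) (fun z => P (1 - z)).
Proof.
have E1 : forall z : C, 1 - z - s = - (z - (1 - s)) by move=> z; ring.
have E2 : forall z : C, z = 1 - (1 - z) by move=> z; ring.
move=> /locally_Cmod [d Hd]. apply/locally_Cmod. exists d => z Hz Hne. apply: Hd.
- by rewrite E1 Cmod_opp.
- move=> h. apply: Hne. by rewrite (E2 z) h.
Qed.

(** A small punctured neighbourhood contains no integer, so [xi_formula_reflect] holds on all of it,
    even when [s] itself is an integer. *)
Lemma xi_limit_reflect (zeta : C -> C) (hzeta : is_riemann_zeta zeta) (k : nat) (s l : C) :
  filterlim (xi_formula zeta k) (locally' s) (locally l) ->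
  filterlim (xi_formula zeta k) (locally' (1 - s)) (locally ((- (1)) ^ k * l)).
Proof.
move=> /filterlim_C H. apply/filterlim_C => eps He.
have h1 := locally'_reflect s _ (H eps He).
have [d [Hd Hn]] := nonint_punctured (1 - s).
have h2 : locally' (1 - s) nonint.
  apply/locally_Cmod. exists (mkposreal d Hd) => z Hz Hne. exact: Hn.
apply: filter_imp (filter_and _ _ h1 h2) => z [Hz1 Hz2].
rewrite (xi_formula_reflect zeta hzeta k z Hz2).
have -> : (- (1)) ^ k * xi_formula zeta k (1 - z) - (- (1)) ^ k * l = (- (1)) ^ k * (xi_formula zeta k (1 - z) - l) by ring.
by rewrite Cmod_mult Cmod_pow Cmod_m1 pow1 Rmult_1_l.
Qed.

Lemma Cpow_m1_sq (k : nat) : (- (1)) ^ k * (- (1)) ^ k = 1.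
Proof. rewrite -Cpow_mult_l. have -> : - (1) * - (1) = 1 by ring. exact: Cpow_1_l. Qed.

Lemma locally'_proper (s : C) : ProperFilter' (locally' s).
Proof.
split; last by apply: within_filter; exact: locally_filter.
move=> /locally_Cmod [d Hd]. have hd := cond_pos d.
apply: (Hd (s + RtoC (d / 2))).
- replace (s + RtoC (d / 2) - s) with (RtoC (d / 2)) by ring. rewrite Cmod_R Rabs_pos_eq; lra.
- move=> h. have : RtoC (d / 2) = 0 by replace (RtoC (d / 2)) with (s + RtoC (d / 2) - s) by ring; rewrite h; ring.
  move=> /RtoC_inj. lra.
Qed.

Lemma Clim_locally' (f : C -> C) (s l : C) :
  filterlim f (locally' s) (locally l) -> Clim (locally' s) f = l.
Proof.
move=> H. have FF := locally'_proper s.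
exact: (iota_filterlim_locally (V := C_R_CompleteNormedModule) f l H).
Qed.

Theorem theorem2p1 (zeta : C -> C) (hzeta : is_riemann_zeta zeta)
  (k : nat) (s : C) :
  xi zeta k s = (- (1)) ^ k * xi zeta k (1 - s).
Proof.
case: (Classical_Prop.classic (exists l, filterlim (xi_formula zeta k) (locally' s) (locally l))) => [[l Hl]|Hno].
- rewrite /xi (Clim_locally' _ _ _ Hl) (Clim_locally' _ _ _ (xi_limit_reflect zeta hzeta k s l Hl)).
  by rewrite Cmult_assoc Cpow_m1_sq Cmult_1_l.
(* Reflecting a limit at [1 - s] would give one at [s]. With no limit on either side, both values
   are the default 0. *)
- have Hno' : forall l, ~ filterlim (xi_formula zeta k) (locally' (1 - s)) (locally l).
    move=> l Hl. apply: Hno. eexists.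
    have := xi_limit_reflect zeta hzeta k (1 - s) l Hl.
    have E : forall z : C, 1 - (1 - z) = z by move=> z; ring.
    rewrite E. apply.
  rewrite /xi /Clim !iota_empty //; first by rewrite Cmult_0_r.
  move=> l Hl. apply: Hno. by exists l.
Qed.
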